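(* Let $0<\beta<2$, $a=\frac2\beta-2$, $b>-1$, let $m\ge1$ be an integer, and let $(\lambda_1,\dots,\lambda_m)$ be $\beta$-Jacobi distributed with parameters $a,b$ (and size $m$). Then the smallest eigenvalue $\min_i\lambda_i$ has probability density function, for $\lambda\in(0,1)$, $$f_{\beta,b,m}(\lambda)=\tilde C_{\beta,b,m}\,\lambda^{-\beta/2}(1-\lambda)^{\beta m(b+m)/2-1}\Bigg(\frac{1}{\Gamma(-\frac\beta2)\,\Gamma(\frac{\beta m}{2}+1)}\,{}_2F_1\!\left(\tfrac{\beta(b+m-1)}{2},\tfrac{\beta(m-1)}{2};-\tfrac\beta2;\lambda\right)$$ $$\qquad-\ \lambda^{1+\beta/2}\,\frac{1}{\Gamma(\frac\beta2+2)\,\Gamma(\frac{\beta(m-1)}{2})}\,\frac{\Gamma(\frac{\beta(b+m)}{2}+1)}{\Gamma(\frac{\beta(b+m-1)}{2})}\,{}_2F_1\!\left(\tfrac{\beta m}{2}+1,\tfrac{\beta(b+m)}{2}+1;2+\tfrac\beta2;\lambda\right)\Bigg),$$ where $$\tilde C_{\beta,b,m}=\frac{\Gamma(-\frac\beta2)\,\Gamma(1+\frac\beta2)}{\Gamma(1-\frac\beta2)}\cdot\frac\beta2\,m(b+m)\cdot\frac{\Gamma(\frac\beta2(b+m-1)+1)}{\Gamma(\frac\beta2(b+m)+1)}\cdot\Gamma\!\left(\tfrac\beta2(m-1)+1\right).$$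
   Context: $\beta$-Jacobi ensemble: for $\beta>0$, $a,b>-1$ and an integer $m\ge1$, the numbers $\lambda_1,\dots,\lambda_m\in[0,1]$ are $\beta$-Jacobi distributed with parameters $a,b$ and size $m$ if their joint density on $[0,1]^m$ is proportional to $$\prod_{i=1}^m\lambda_i^{\frac{\beta}{2}(a+1)-1}(1-\lambda_i)^{\frac{\beta}{2}(b+1)-1}\prod_{i<j}|\lambda_i-\lambda_j|^{\beta}.$$ The $\lambda_i$ are called the eigenvalues of the ensemble. Here ${}_2F_1(\cdot,\cdot;\cdot;\cdot)$ is the classical one-variable Gauss hypergeometric function, and $1/\Gamma$ is read as $0$ at the poles of $\Gamma$. *)

(* Defs.v *)
From HB Require Import structures.
From mathcomp Require Import all_boot all_order all_algebra.
From mathcomp Require Import all_classical all_reals all_analysis.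
Import Order.TTheory GRing.Theory Num.Theory.
Import numFieldNormedType.Exports.

Set Implicit Arguments.
Unset Strict Implicit.
Unset Printing Implicit Defensive.

Local Open Scope classical_set_scope.
Local Open Scope ring_scope.

Section special_functions.
Context {R : realType}.
Implicit Types a b c x z : R.

Definition euler_integral x : R :=
  \int[lebesgue_measure]_(t in `]0, +oo[) (t `^ (x - 1) * expR (- t)).

(* Outside x > 0, Gamma is continued by Gamma x = Gamma (x + 1) / x, with the
   least number n of steps making x + n positive. At a pole one factor of the
   product is 0, so that Gamma x = 0 and (Gamma x)^-1 = 0 (see Gamma_pole). *)
Definition Gamma x : R :=
  let n := if 0 < x then 0%N else (Num.truncn (- x)).+1 in
  euler_integral (x + n%:R) / \prod_(i < n) (x + i%:R).

Lemma Gamma_pole n : Gamma (- n%:R) = 0.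
Proof.
rewrite /Gamma oppr_gt0 ltNge ler0n /= opprK natrK.
by rewrite big_ord_recr /= addNr mulr0 invr0 mulr0.
Qed.

Definition pochhammer x (k : nat) : R := \prod_(i < k) (x + i%:R).

(* The Gauss series; it converges for |z| < 1 and c not in {0, -1, -2, ...}. *)
Definition hyp2F1 a b c z : R :=
  limn (series (fun k : nat =>
    pochhammer a k * pochhammer b k / (pochhammer c k * k`!%:R) * z ^+ k)).

End special_functions.

Section lebesgue_measure_tuple.
Context {R : realType}.

Definition cons_tuple n (p : R * n.-tuple R) : n.+1.-tuple R :=
  [tuple of p.1 :: p.2].

Lemma measurable_cons_tuple n : measurable_fun setT (@cons_tuple n).
Proof. exact: measurable_cons. Qed.

Section step.
Variables (n : nat) (mu : {sigma_finite_measure set (n.-tuple R) -> \bar R}).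

Definition lebesgue_cons : set (n.+1.-tuple R) -> \bar R :=
  pushforward (lebesgue_measure \x mu)%E (@cons_tuple n).

Let lebesgue_cons0 : lebesgue_cons set0 = 0%E.
Proof. by rewrite /lebesgue_cons /pushforward preimage_set0 measure0. Qed.

Let lebesgue_cons_ge0 A : (0 <= lebesgue_cons A)%E.
Proof. exact: (measure_ge0 (lebesgue_measure \x mu)%E). Qed.

Let lebesgue_cons_sigma_additive : semi_sigma_additive lebesgue_cons.
Proof. apply: measure_semi_sigma_additive; exact: measurable_cons_tuple. Qed.

HB.instance Definition _ := isMeasure.Build _ _ _ lebesgue_cons
  lebesgue_cons0 lebesgue_cons_ge0 lebesgue_cons_sigma_additive.

Let lebesgue_cons_sigma_finite : sigma_finite setT lebesgue_cons.
Proof.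
have /sigma_finiteP[F [TF ndF Foo]] := sigma_finiteT (@lebesgue_measure R).
have /sigma_finiteP[G [TG ndG Goo]] := sigma_finiteT mu.
pose hd (x : n.+1.-tuple R) : R := thead x.
pose tl (x : n.+1.-tuple R) : n.-tuple R := [tuple of behead x].
have mhd : measurable_fun setT hd by exact: measurable_tnth.
have mtl : measurable_fun setT tl by exact: measurable_behead.
exists (fun k => hd @^-1` F k `&` tl @^-1` G k) => [|k].
  apply/esym/seteqP; split=> // x _.
  have : setT (hd x) by []. rewrite TF => -[i _ Fi].
  have : setT (tl x) by []. rewrite TG => -[j _ Gj].
  exists (maxn i j) => //; split.
    by have /subsetPset := ndF _ _ (leq_maxl i j); exact.
  by have /subsetPset := ndG _ _ (leq_maxr i j); exact.
have [mF Fk] := Foo k; have [mG Gk] := Goo k; split.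
  apply: measurableI; rewrite -[X in measurable X]setTI; first exact: mhd.
  exact: mtl.
rewrite /lebesgue_cons /pushforward.
rewrite [X in (lebesgue_measure \x mu)%E X](_ : _ = F k `*` G k).
  by rewrite product_measure1E// lte_mul_pinfty// ge0_fin_numE.
have tlK (p : R * n.-tuple R) : tl (cons_tuple p) = p.2 by exact: val_inj.
by apply/seteqP; split=> p /=; rewrite tlK.
Qed.

HB.instance Definition _ := Measure_isSigmaFinite.Build _ _ _ lebesgue_cons
  lebesgue_cons_sigma_finite.

End step.

(* Lebesgue measure on R^n, as an iterated product (see lebesgue_tuple_box). *)
Fixpoint lebesgue_tuple n : {sigma_finite_measure set (n.-tuple R) -> \bar R} :=
  match n with
  | 0 => dirac [tuple]
  | n'.+1 => lebesgue_cons (lebesgue_tuple n')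
  end.

Lemma lebesgue_tuple_box n (A : 'I_n -> set R) :
  (forall i, measurable (A i)) ->
  lebesgue_tuple n [set x | forall i, A i (tnth x i)] =
  (\prod_(i < n) lebesgue_measure (A i))%E.
Proof.
elim: n A => [|n IH] A mA.
  by rewrite big_ord0 /= diracE mem_set // => -[].
have mB : measurable
    [set x : n.-tuple R | forall i, A (lift ord0 i) (tnth x i)].
  rewrite (_ : mkset _ = \bigcap_(i in [set: 'I_n])
      ((fun x : n.-tuple R => tnth x i) @^-1` A (lift ord0 i))).
    apply: fin_bigcap_measurable => [|i _]; first exact: finite_finset.
    by rewrite -[X in measurable X]setTI; exact: measurable_tnth.
  by apply/seteqP; split=> x /= Ax i; [move=> _|]; exact: Ax.
rewrite big_ord_recl -IH //= /lebesgue_cons /pushforward.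
rewrite [X in (lebesgue_measure \x _)%E X](_ : _ =
  A ord0 `*` [set x | forall i, A (lift ord0 i) (tnth x i)]).
  by rewrite product_measure1E; [|exact: mA|exact: mB].
apply/seteqP; split=> -[y t] /=.
  move=> At; split=> [|i]; first exact: (At ord0).
  by have := At (lift ord0 i); rewrite tnthS.
move=> [Ay At] i; case: (unliftP ord0 i) => [j ->|->]; last exact: Ay.
by rewrite tnthS.
Qed.

End lebesgue_measure_tuple.

Section jacobi.
Context {R : realType}.

(* The measure nu is carried by D, with density f with respect to mu there. *)
Definition has_density d (T : measurableType d) (mu : {measure set T -> \bar R})
    (D : set T) (nu : set T -> \bar R) (f : T -> R) : Prop :=
  [/\ measurable_fun D f,
      forall x, D x -> 0 <= f x &
      forall A, measurable A -> nu A = (\int[mu]_(x in A `&` D) (f x)%:E)%E].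

Definition unit_cube m : set (m.-tuple R) :=
  [set x | forall i, 0 <= tnth x i <= 1].

Definition jacobi_weight (beta a b : R) m (x : m.-tuple R) : R :=
  (\prod_(i < m) (tnth x i `^ (beta / 2 * (a + 1) - 1) *
                  (1 - tnth x i) `^ (beta / 2 * (b + 1) - 1))) *
  \prod_(i < m) \prod_(j < m | (i < j)%N) `|tnth x i - tnth x j| `^ beta.

Definition jacobi_distributed (beta a b : R) m
    (nu : set (m.-tuple R) -> \bar R) : Prop :=
  exists2 c : R, 0 < c &
    has_density (lebesgue_tuple m) (@unit_cube m) nu
      (fun x => c * jacobi_weight beta a b x).

Definition tuple_min m (m_gt0 : (0 < m)%N) (x : m.-tuple R) : R :=
  \big[Num.min/tnth x (Ordinal m_gt0)]_(i < m) tnth x i.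

Definition min_const (beta b m : R) : R :=
  Gamma (- (beta / 2)) * Gamma (1 + beta / 2) / Gamma (1 - beta / 2) *
  (beta / 2 * m * (b + m)) *
  (Gamma (beta / 2 * (b + m - 1) + 1) / Gamma (beta / 2 * (b + m) + 1)) *
  Gamma (beta / 2 * (m - 1) + 1).

Definition min_pdf (beta b m x : R) : R :=
  min_const beta b m *
  x `^ (- (beta / 2)) * (1 - x) `^ (beta * m * (b + m) / 2 - 1) *
  ((Gamma (- (beta / 2)))^-1 * (Gamma (beta * m / 2 + 1))^-1 *
   hyp2F1 (beta * (b + m - 1) / 2) (beta * (m - 1) / 2) (- (beta / 2)) x -
   x `^ (1 + beta / 2) *
   ((Gamma (beta / 2 + 2))^-1 * (Gamma (beta * (m - 1) / 2))^-1) *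
   (Gamma (beta * (b + m) / 2 + 1) / Gamma (beta * (b + m - 1) / 2)) *
   hyp2F1 (beta * m / 2 + 1) (beta * (b + m) / 2 + 1) (2 + beta / 2) x).

End jacobi.

(* Main.v *)
From HB Require Import structures.
Require Import Defs.
From mathcomp Require Import all_boot all_order all_algebra.
From mathcomp Require Import fingroup perm.
From mathcomp Require Import all_classical all_reals all_analysis.
From mathcomp Require Import measurable_realfun ring lra.
Import Order.TTheory GRing.Theory Num.Theory.
Import numFieldNormedType.Exports.

(** Write h = beta / 2 and q = h (b + 1) - 1. For a = 2 / beta - 2 the weight
carries each x_i with the exponent - h. The substitution x_i = 1 - s y_i with
s = 1 - l maps the event that all x_i exceed l onto the open unit cube and gives
(jacobi_weight_affine, tail_integral)

  P (min > l) = K s^(A B / h) Y (s),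
  Y (t) = integral over the cube of
          prod_i y_i^q (1 - t y_i)^(- h) * prod_(i < j) |y_i - y_j|^(2 h),

where A = h m and B = h (b + m).

The exponent - h is special: because it matches the exponent 2 h of the
Vandermonde product, Y solves an equation of the second order. Indeed the
divergence of the integrand times the vector field (v (y_1), ..., v (y_m)), with
v (y) = y (1 - y) / (1 - t y), has integral 0, since v vanishes at 0 and 1. With
r_i = y_i / (1 - t y_i), the resulting identity involves the r_i only through
p = sum_i r_i and h p^2 + sum_i r_i^2 (score_total0E), and these are exactly the
factors that h^-1 d/dt and h^-1 d^2/dt^2 produce on (1 - t y_i)^(- h). This is the
hypergeometric equation (tail_int_ode), and Y, being regular at 0, is
Y (0) 2F1 (A, B; C; t) with C = A + B + 1 - h (tail_int_hyp2F1). The integrand is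
too singular for a direct integration by parts (|y_i - y_j|^(2 h) need not be
differentiable on the diagonals, y^q may be unbounded), hence y^q and
|y_i - y_j|^(2 h) are replaced by (y + e)^q and ((y_i - y_j)^2 + e)^h, and e tends to
0 by dominated convergence (ibp_limit).

The unknown constant is removed by letting l tend to 0, where the probability is
1, and Gauss's summation formula (gauss_sum) evaluates 2F1 (A, B; C; 1). Hence
P (min > l) = (1 - l)^(A B / h) 2F1 (A, B; C; 1 - l) / 2F1 (A, B; C; 1), the
function survival.

It remains to differentiate. The connection formula (hyp_connection) writes
2F1 (A, B; C; 1 - x) as a combination of 2F1 (A, B; h; x) and
x^(1 - h) 2F1 (A - h + 1, B - h + 1; 2 - h; x). On each of these two functions F,
the expression (A B / h) F - (1 - x) F', which the derivative of
(1 - x)^(A B / h) F contains, collapses to a single hypergeometric function by one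
contiguous relation each (contiguous_regular, contiguous_singular). These are the
two terms of the stated density (survival_densityE, survival_density_Gamma). A
finite measure on the line is determined by its values on the rays, so that
knowing P (min > l) for every l is enough (has_density_rays). *)

Set Implicit Arguments.
Unset Strict Implicit.
Unset Printing Implicit Defensive.

Local Open Scope classical_set_scope.
Local Open Scope ring_scope.

(** * Power series on the unit disk *)

Section power_series.
Context {R : realType}.
Implicit Types (f g : nat -> R) (x : R).

Definition psum f x : R := limn (pseries f x).

Definition unit_cvg f := forall x, `|x| < 1 -> cvgn (pseries f x).

(** For r < 0 the hypothesis forces u to vanish from K + 1 on; otherwise u is
dominated by a geometric series from K on. *)
Lemma ratio_cvg_series (u : nat -> R) (r : R) (K : nat) : r < 1 ->
  (forall k, (K <= k)%N -> `|u k.+1| <= r * `|u k|) -> cvgn (series u).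
Proof.
move=> r1 uK.
have [r0|r0] := ltP r 0.
  rewrite -(is_cvg_series_restrict K.+1).
  rewrite (_ : (fun n => _) = cst 0); first exact: is_cvg_cst.
  apply/funext => n /=; rewrite big_nat_cond big1// => i /andP[/andP[Ki _] _].
  case: i Ki => // i; rewrite ltnS => Ki.
  have ui := uK i Ki; apply/normr0_eq0/eqP; rewrite eq_le normr_ge0 andbT.
  by apply: (le_trans ui); rewrite nmulr_rle0.
apply: normed_cvg; rewrite -(is_cvg_series_restrict K).
have bnd k : `|u (K + k)%N| <= `|u K| * r ^+ k.
  elim: k => [|k IH]; first by rewrite addn0 expr0 mulr1.
  rewrite addnS; apply: (le_trans (uK _ _)); first exact: leq_addr.
  by rewrite exprS mulrCA ler_wpM2l.
have cg : cvgn (series (geometric `|u K| r)).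
  by apply: is_cvg_geometric_series; rewrite ger0_norm.
have cv : cvgn (series (fun k => `|u (K + k)%N|)).
  by apply: series_le_cvg cg => // k; exact: mulr_ge0 (exprn_ge0 _ _).
apply/cvg_ex; exists (limn (series (fun k => `|u (K + k)%N|))).
rewrite -(cvg_shiftn K) /= (_ : (fun n => _) = series (fun k => `|u (K + k)%N|)).
  exact: cv.
apply/funext => n; rewrite /series /= -{1}[K]add0n big_addn addnK.
by apply: eq_bigr => i _; rewrite addnC.
Qed.

Lemma cvg_psumD f g x l1 l2 : pseries f x @ \oo --> (l1 : R) ->
  pseries g x @ \oo --> (l2 : R) ->
  pseries (fun i => f i + g i) x @ \oo --> l1 + l2.
Proof.
move=> cf cg; rewrite (_ : pseries _ x = pseries f x \+ pseries g x).
  exact: cvgD.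
apply/funext => n; rewrite /pseries /series /= -big_split /=.
by apply: eq_bigr => i _; rewrite mulrDl.
Qed.

Lemma cvg_psumZ (k : R) f x l : pseries f x @ \oo --> (l : R) ->
  pseries (fun i => k * f i) x @ \oo --> k * l.
Proof.
move=> cf; rewrite (_ : pseries _ x = cst k \* pseries f x).
  by apply: cvgM => //; exact: cvg_cst.
apply/funext => n; rewrite /pseries /series /= mulr_sumr.
by apply: eq_bigr => i _; rewrite mulrA.
Qed.

Definition shift f (i : nat) : R := if i is j.+1 then f j else 0.

Lemma cvg_psum_shift f x l : pseries f x @ \oo --> (l : R) ->
  pseries (shift f) x @ \oo --> x * l.
Proof.
move=> cf; rewrite -cvg_shiftS /=.
rewrite (_ : (fun n => _) = cst x \* pseries f x).
  by apply: cvgM => //; exact: cvg_cst.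
apply/funext => n; rewrite /pseries /series /= big_nat_recl //= mul0r add0r mulr_sumr.
by apply: eq_bigr => i _; rewrite exprS; ring.
Qed.

Lemma cvg_psum f x : unit_cvg f -> `|x| < 1 -> pseries f x @ \oo --> psum f x.
Proof. by move=> cf x1; exact: cf. Qed.

Lemma unit_cvgZ (k : R) f : unit_cvg f -> unit_cvg (fun i => k * f i).
Proof.
by move=> cf x x1; apply/cvg_ex; exists (k * psum f x); apply/cvg_psumZ/cvg_psum.
Qed.

Lemma psumZ (k : R) f x : unit_cvg f -> `|x| < 1 ->
  psum (fun i => k * f i) x = k * psum f x.
Proof. by move=> cf x1; apply/cvg_lim => //; apply/cvg_psumZ/cvg_psum. Qed.

Lemma psum0 x : psum (fun=> 0) x = 0.
Proof.
rewrite /psum (_ : pseries _ _ = cst 0) ?lim_cst//; apply/funext => n.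
by rewrite /pseries /series /= big1// => i _; rewrite mul0r.
Qed.

Lemma psum_at0 f : psum f 0 = f 0%N.
Proof.
apply/cvg_lim => //; rewrite -cvg_shiftS /=.
rewrite (_ : (fun n => _) = cst (f 0%N)); first exact: cvg_cst.
apply/funext => n; rewrite /pseries /series /= big_nat_recl //= expr0 mulr1.
by rewrite big1 ?addr0// => i _; rewrite expr0n mulr0.
Qed.

(** Any K between |x| and 1 is a point of convergence of the series and of its
first two formal derivatives, and x lies inside the radius K. *)
Lemma is_derive_psum f x : unit_cvg f -> unit_cvg (pseries_diffs f) ->
  unit_cvg (pseries_diffs (pseries_diffs f)) -> `|x| < 1 ->
  is_derive x 1 (psum f) (psum (pseries_diffs f) x).
Proof.
move=> cf cdf cddf x1; pose K := (1 + `|x|) / 2.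
have x0 := normr_ge0 x.
have K0 : 0 < K by rewrite /K; lra.
have K1 : `|K| < 1 by rewrite gtr0_norm// /K; lra.
apply: (@pseries_snd_diffs _ f K); [exact: cf|exact: cdf|exact: cddf|].
by rewrite (gtr0_norm K0) /K; lra.
Qed.

End power_series.
Arguments cvg_psumZ {R} k {f x l}.

(** * The Gauss series and its differential equation *)

Section hypergeometric.
Context {R : realType}.
Implicit Types a b c x : R.

(** Since 1 / 0 = 0, this excludes the values of c for which the coefficients of
2F1 would silently be truncated. *)
Definition nonpole c := forall k : nat, c + k%:R != 0.

Lemma pos_nonpole c : 0 < c -> nonpole c.
Proof. by move=> c0 k; rewrite gt_eqF// ltr_wpDr. Qed.

Lemma nonpoleS c : nonpole c -> nonpole (c + 1).
Proof. by move=> cn k; have := cn k.+1; rewrite -natr1 addrAC addrA. Qed.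

Definition hypcoef a b c (k : nat) : R :=
  pochhammer a k * pochhammer b k / (pochhammer c k * k`!%:R).

Lemma hyp2F1E a b c : hyp2F1 a b c = psum (hypcoef a b c).
Proof. by []. Qed.

Lemma pochhammerS a k : pochhammer a k.+1 = pochhammer a k * (a + k%:R).
Proof. by rewrite /pochhammer big_ord_recr. Qed.

Lemma pochhammer0 a : pochhammer a 0 = 1.
Proof. by rewrite /pochhammer big_ord0. Qed.

Lemma pochhammerSl a k : pochhammer a k.+1 = a * pochhammer (a + 1) k.
Proof.
rewrite /pochhammer big_ord_recl /= addr0; congr (_ * _); apply: eq_bigr => i _.
by rewrite /= /bump /= add1n -natr1; ring.
Qed.

Lemma pochhammer_neq0 c k : nonpole c -> pochhammer c k != 0.
Proof. by move=> cn; apply/prodf_neq0 => i _; exact: cn. Qed.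

Lemma natfact_neq0 k : k`!%:R != 0 :> R.
Proof. by rewrite pnatr_eq0 -lt0n fact_gt0. Qed.

Lemma hypcoef0 a b c : hypcoef a b c 0 = 1.
Proof. by rewrite /hypcoef !pochhammer0 fact0 !mulr1 divr1. Qed.

Lemma hypcoefS a b c k : nonpole c ->
  hypcoef a b c k.+1 * ((c + k%:R) * k.+1%:R) =
  (a + k%:R) * (b + k%:R) * hypcoef a b c k.
Proof.
move=> cn; rewrite /hypcoef !pochhammerS factS natrM.
have := pochhammer_neq0 k cn; have := natfact_neq0 k; have := cn k.
have : k.+1%:R != 0 :> R by rewrite pnatr_eq0.
by move=> *; field; do ?[apply/andP; split].
Qed.

Lemma hypcoef_diffs a b c k : nonpole c ->
  pseries_diffs (hypcoef a b c) k = a * b / c * hypcoef (a + 1) (b + 1) (c + 1) k.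
Proof.
move=> cn; rewrite /pseries_diffs /hypcoef !pochhammerSl factS natrM.
have := pochhammer_neq0 k (nonpoleS cn); have := natfact_neq0 k.
have := cn 0%N; rewrite addr0.
have : k.+1%:R != 0 :> R by rewrite pnatr_eq0.
by move=> *; field; do ?[apply/andP; split].
Qed.

Lemma ratio_natr_cvg a b :
  (a + k%:R) / (b + k%:R) @[k --> \oo] --> (1 : R).
Proof.
have h (d : R) : (d + k%:R) / k.+1%:R @[k --> \oo] --> (1 : R).
  rewrite (_ : (fun k : nat => _) = (fun k : nat => 1 + (d - 1) * k.+1%:R^-1)).
    rewrite -[X in _ --> X]addr0 -[X in _ --> _ + X](mulr0 (d - 1)).
    apply: cvgD; first exact: cvg_cst.
    by apply: cvgM; [exact: cvg_cst|exact: cvg_harmonic].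
  apply/funext => k; have : k.+1%:R != 0 :> R by rewrite pnatr_eq0.
  by rewrite -natr1 => k0; field.
rewrite (_ : (fun k : nat => _) = (fun k : nat => ((a + k%:R) / k.+1%:R) / ((b + k%:R) / k.+1%:R))).
  rewrite -[X in _ --> X]divr1; apply: cvgM; first exact: h.
  by apply: cvgV; [exact: oner_neq0|exact: h].
apply/funext => k; have k0 : k.+1%:R != 0 :> R by rewrite pnatr_eq0.
by rewrite invf_div mulrA divfK.
Qed.

(** The ratio of consecutive terms tends to x. *)
Lemma unit_cvg_hypcoef a b c : nonpole c -> unit_cvg (hypcoef a b c).
Proof.
move=> cn x x1; rewrite /pseries.
pose q k := (a + k%:R) / (c + k%:R) * ((b + k%:R) / (1 + k%:R)) * x.
have qx : q k @[k --> \oo] --> x.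
  suff : q k @[k --> \oo] --> 1 * 1 * x by rewrite !mul1r.
  apply: cvgM; last exact: cvg_cst.
  by apply: cvgM; exact: ratio_natr_cvg.
have xr : `|x| < (1 + `|x|) / 2 by lra.
have [K _ HK] := @cvgr_norm_lt _ _ _ _ _ _ _ qx _ xr.
apply: (@ratio_cvg_series _ _ ((1 + `|x|) / 2) K); first by lra.
move=> k Kk; have := HK k Kk => /= /ltW qk.
rewrite (_ : _ * x ^+ k.+1 = q k * (hypcoef a b c k * x ^+ k)).
  by rewrite normrM ler_wpM2r.
have := hypcoefS a b k cn; rewrite /q exprS nat1r.
have := cn k; have : k.+1%:R != 0 :> R by rewrite pnatr_eq0.
move=> k0 ck E; apply: (mulIf (mulf_neq0 ck k0)).
transitivity (x * x ^+ k * (hypcoef a b c k.+1 * ((c + k%:R) * k.+1%:R))).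
  by ring.
by rewrite E; field; apply/andP.
Qed.

Lemma hypcoef_diffsE a b c : nonpole c -> pseries_diffs (hypcoef a b c) =
  (fun k => a * b / c * hypcoef (a + 1) (b + 1) (c + 1) k).
Proof. by move=> cn; apply/funext => k; exact: hypcoef_diffs. Qed.

Lemma diffsZ (k : R) f :
  pseries_diffs (fun i => k * f i) = (fun i => k * pseries_diffs f i).
Proof. by apply/funext => i; rewrite /pseries_diffs mulrCA. Qed.

Lemma unit_cvg_diffs a b c : nonpole c ->
  unit_cvg (pseries_diffs (hypcoef a b c)).
Proof.
move=> cn; rewrite hypcoef_diffsE//; apply/unit_cvgZ/unit_cvg_hypcoef.
exact: nonpoleS.
Qed.

Lemma unit_cvg_diffs2 a b c : nonpole c ->
  unit_cvg (pseries_diffs (pseries_diffs (hypcoef a b c))).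
Proof.
move=> cn; rewrite hypcoef_diffsE// diffsZ.
by apply/unit_cvgZ/unit_cvg_diffs/nonpoleS.
Qed.

(** Primes are derivatives of 2F1 in its argument, as sums of the
term-by-term differentiated series. *)
Definition hyp' a b c := psum (pseries_diffs (hypcoef a b c)).
Definition hyp'' a b c := psum (pseries_diffs (pseries_diffs (hypcoef a b c))).

Lemma hyp'E a b c x : nonpole c -> `|x| < 1 ->
  hyp' a b c x = a * b / c * hyp2F1 (a + 1) (b + 1) (c + 1) x.
Proof.
move=> cn x1; rewrite /hyp' hypcoef_diffsE// psumZ//.
exact/unit_cvg_hypcoef/nonpoleS.
Qed.

Lemma is_derive_hyp a b c x : nonpole c -> `|x| < 1 ->
  is_derive x 1 (hyp2F1 a b c) (hyp' a b c x).
Proof.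
by move=> cn x1; apply: is_derive_psum => //;
  [exact: unit_cvg_hypcoef|exact: unit_cvg_diffs|exact: unit_cvg_diffs2].
Qed.

Lemma is_derive_hyp' a b c x : nonpole c -> `|x| < 1 ->
  is_derive x 1 (hyp' a b c) (hyp'' a b c x).
Proof.
move=> cn x1; apply: is_derive_psum => //; first exact: unit_cvg_diffs.
  exact: unit_cvg_diffs2.
rewrite hypcoef_diffsE// !diffsZ; apply/unit_cvgZ/unit_cvg_diffs2.
exact: nonpoleS.
Qed.

Lemma hyp_at0 a b c : hyp2F1 a b c 0 = 1.
Proof. by rewrite hyp2F1E psum_at0 hypcoef0. Qed.

(** The equation is the recurrence hypcoefS read on the coefficient of each
power of x. *)
Lemma hyp_ode a b c x : nonpole c -> `|x| < 1 ->
  x * (1 - x) * hyp'' a b c x + (c - (a + b + 1) * x) * hyp' a b c x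
  - a * b * hyp2F1 a b c x = 0.
Proof.
move=> cn x1; set f := hypcoef a b c.
have c0 := cvg_psum (unit_cvg_hypcoef (a := a) (b := b) cn) x1.
have c1 := cvg_psum (unit_cvg_diffs (a := a) (b := b) cn) x1.
have c2 := cvg_psum (unit_cvg_diffs2 (a := a) (b := b) cn) x1.
have s2 := cvg_psum_shift c2; have ss2 := cvg_psum_shift s2.
have s1 := cvg_psum_shift c1.
have := cvg_psumD (cvg_psumD s2 (cvg_psumZ (-1) ss2))
  (cvg_psumD (cvg_psumD (cvg_psumZ c c1) (cvg_psumZ (- (a + b + 1)) s1))
             (cvg_psumZ (- (a * b)) c0)).
rewrite (_ : (fun i : nat => _) = (fun=> 0)); last first.
  apply/funext => -[|[|k]]; rewrite /= /pseries_diffs.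
  - have := hypcoefS a b 0 cn; rewrite !addr0 -/f; move: (f 0%N) (f 1%N) => ? ?.
    by move=> E; lra.
  - have := hypcoefS a b 1 cn; rewrite -/f; move: (f 1%N) (f 2%N) => ? ?.
    by move=> E; lra.
  - have := hypcoefS a b k.+2 cn; rewrite -/f; move: (f k.+2) (f k.+3) => ? ?.
    by rewrite -!natr1 => E; lra.
move=> h; have := psum0 x; rewrite /psum (cvg_lim _ h)// => E.
by rewrite -E /hyp'' /hyp' hyp2F1E /psum; ring.
Qed.

End hypergeometric.

(** * Derivatives of real functions *)

Section calculus.
Context {R : realType}.
Implicit Types (f g : R -> R) (x a k : R).

Lemma derive_eq f x (u v : R) : is_derive x 1 f u -> u = v -> is_derive x 1 f v.
Proof. by move=> h <-. Qed.

Lemma deriveM_fun f g x df dg : is_derive x 1 f df -> is_derive x 1 g dg ->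
  is_derive x 1 (fun y => f y * g y) (df * g x + f x * dg).
Proof.
move=> hf hg; apply: (derive_eq (is_deriveM hf hg)).
by rewrite /GRing.scale /=; ring.
Qed.

Lemma deriveD_fun f g x df dg : is_derive x 1 f df -> is_derive x 1 g dg ->
  is_derive x 1 (fun y => f y + g y) (df + dg).
Proof. by move=> hf hg; exact: is_deriveD hf hg. Qed.

Lemma deriveN_fun f x df : is_derive x 1 f df ->
  is_derive x 1 (fun y => - f y) (- df).
Proof. by move=> hf; exact: is_deriveN hf. Qed.

Lemma deriveB_fun f g x df dg : is_derive x 1 f df -> is_derive x 1 g dg ->
  is_derive x 1 (fun y => f y - g y) (df - dg).
Proof. by move=> hf hg; exact: is_deriveB hf hg. Qed.

Lemma deriveZ_fun k f x df : is_derive x 1 f df ->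
  is_derive x 1 (fun y => k * f y) (k * df).
Proof. by move=> hf; exact: (@is_deriveZ _ _ _ f k _ _ _ hf). Qed.

Lemma derive_comp_fun f g x a b : is_derive (g x) 1 f a -> is_derive x 1 g b ->
  is_derive x 1 (fun y => f (g y)) (a * b).
Proof. by move=> hf hg; exact: is_derive1_comp hf hg. Qed.

Lemma derive_powR a x : 0 < x ->
  is_derive x 1 (fun y => y `^ a) (a * x `^ (a - 1)).
Proof.
move=> x0; have xI : x \in `]0, +oo[ by rewrite in_itv /= x0.
have := powR_derive1 a xI; rewrite derive1E => <-.
by apply: DeriveDef => //; exact: derivable_powR.
Qed.

Lemma derive_onem x : is_derive x 1 (fun y : R => 1 - y) (-1).
Proof.
have := @deriveB_fun (fun=> 1) id x 0 1 (is_derive_cst _ _ _) (is_derive_id _ _).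
by rewrite sub0r.
Qed.

Lemma derive_powR_onem a x : x < 1 ->
  is_derive x 1 (fun y => (1 - y) `^ a) (- (a * (1 - x) `^ (a - 1))).
Proof.
move=> x1; have y0 : 0 < 1 - x by lra.
have := @derive_comp_fun (fun y => y `^ a) (fun y => 1 - y) x _ _
  (derive_powR a y0) (derive_onem x).
by rewrite mulrN1.
Qed.

Lemma powR_pred a x : 0 < x -> x * x `^ (a - 1) = x `^ a.
Proof.
move=> x0; rewrite -[X in X * _]powRr1 ?ltW// -powRD ?(gt_eqF x0) ?implybT//.
by congr (_ `^ _); ring.
Qed.

(** The mean value theorem, on an open interval. *)
Lemma derive0_cst f (u v : R) : (forall x, u < x < v -> is_derive x 1 f 0) ->
  forall x y, u < x < v -> u < y < v -> f x = f y.
Proof.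
move=> f0; suff h x y : u < x < v -> u < y < v -> x < y -> f x = f y.
  move=> x y hx hy; have [xy|xy|->//] := ltgtP x y; first exact: h.
  by apply/esym/h.
move=> /andP[ux xv] /andP[uy yv] xy.
have [||c _] := @MVT _ f (cst 0) x y xy.
- by move=> z; rewrite in_itv /= => /andP[xz zy]; apply: f0; apply/andP; split; lra.
- apply: derivable_within_continuous => z; rewrite in_itv /= => /andP[xz zy].
  by have [] : is_derive z 1 f 0 by apply: f0; apply/andP; split; lra.
- by rewrite /= mul0r => /eqP; rewrite subr_eq0 => /eqP.
Qed.

Lemma derive_continuous f x df : is_derive x 1 f df -> {for x, continuous f}.
Proof. by move=> [fd _]; apply: differentiable_continuous; exact/derivable1_diffP. Qed.

Lemma right_limit f x df : is_derive x 1 f df -> f z @[z --> x^'+] --> f x.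
Proof. by move=> /derive_continuous fc; exact: cvg_at_right_filter. Qed.

End calculus.

(** * Solutions of the hypergeometric equation on the unit interval *)

Section wronskian.
Context {R : realType}.
Implicit Types (a b c x : R) (y u v : R -> R).

(** Both y and its derivative are data: the boundary behaviour of y' decides
which solution y is. *)
Definition hyp_sol a b c y y' := exists y'' : R -> R, forall x, 0 < x < 1 ->
  [/\ is_derive x 1 y (y' x), is_derive x 1 y' (y'' x) &
   x * (1 - x) * y'' x + (c - (a + b + 1) * x) * y' x - a * b * y x = 0].

(** The integrating factor x^c (1 - x)^(a + b + 1 - c) turns the usual
Wronskian into a constant (Abel's identity). *)
Definition wronskian a b c y y' u u' x : R :=
  x `^ c * (1 - x) `^ (a + b + 1 - c) * (y x * u' x - y' x * u x).

Lemma wronskian_cst a b c y y' u u' : hyp_sol a b c y y' -> hyp_sol a b c u u' ->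
  forall x z, 0 < x < 1 -> 0 < z < 1 ->
  wronskian a b c y y' u u' x = wronskian a b c y y' u u' z.
Proof.
move=> [y'' hy] [u'' hu]; apply: derive0_cst => x x01.
have [dy dy' oy] := hy x x01; have [du du' ou] := hu x x01.
have /andP[x0 x1] := x01; have ox0 : 0 < 1 - x by lra.
set e := a + b + 1 - c.
apply: (derive_eq (deriveM_fun
  (deriveM_fun (derive_powR c x0) (derive_powR_onem e x1))
  (deriveB_fun (deriveM_fun dy du') (deriveM_fun dy' du)))).
rewrite -(powR_pred c x0) -(powR_pred e ox0).
set X := x `^ _; set Z := (1 - x) `^ _.
transitivity (X * Z * (y x * (x * (1 - x) * u'' x + (c - (a + b + 1) * x) * u' x
   - a * b * u x) - u x * (x * (1 - x) * y'' x + (c - (a + b + 1) * x) * y' x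
   - a * b * y x))).
  by rewrite /e; ring.
by rewrite oy ou; ring.
Qed.

Lemma right_unit : \forall x \near (0 : R)^'+, 0 < x < 1.
Proof. by near=> x; apply/andP; split; near: x; [exact: nbhs_right_gt|exact: nbhs_right_lt]. Unshelve. all: by end_near. Qed.

(** The constant value is read off at 0, where a solution enters only through
the limits of y and of x^c y'. *)
Lemma wronskian_lim a b c y y' u u' (ly ly' lu lu' : R) :
  hyp_sol a b c y y' -> hyp_sol a b c u u' ->
  y x @[x --> 0^'+] --> ly -> x `^ c * y' x @[x --> 0^'+] --> ly' ->
  u x @[x --> 0^'+] --> lu -> x `^ c * u' x @[x --> 0^'+] --> lu' ->
  forall x, 0 < x < 1 -> wronskian a b c y y' u u' x = ly * lu' - ly' * lu.
Proof.
move=> sy su cy cy' cu cu' x x01; set e := a + b + 1 - c.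
have co : (1 - x) `^ e @[x --> (0 : R)^'+] --> (1 : R).
  have := right_limit (derive_powR_onem e (@ltr01 R)).
  by rewrite subr0 powR1.
have h : (1 - z) `^ e * (y z * (z `^ c * u' z) - z `^ c * y' z * u z)
    @[z --> 0^'+] --> 1 * (ly * lu' - ly' * lu).
  by apply: cvgM => //; apply: cvgB; exact: cvgM.
rewrite -[RHS]mul1r -(cvg_lim _ h)//; apply/esym/cvg_lim => //.
apply: cvg_near_cst; near=> z.
rewrite (wronskian_cst sy su x01 (z:=z)); last by near: z; exact: right_unit.
by rewrite /wronskian -/e; ring.
Unshelve. all: by end_near. Qed.

(** The condition x^c y' -> 0 excludes the second local solution
x^(1 - c) g (x) at 0. It makes the Wronskian of y and u vanish, so that y / u is
constant. *)
Lemma hyp_sol_unique a b c y y' u u' (l lu : R) :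
  hyp_sol a b c y y' -> hyp_sol a b c u u' ->
  y x @[x --> 0^'+] --> l -> x `^ c * y' x @[x --> 0^'+] --> (0 : R) ->
  u x @[x --> 0^'+] --> lu -> x `^ c * u' x @[x --> 0^'+] --> (0 : R) ->
  lu != 0 -> (forall x, 0 < x < 1 -> u x != 0) ->
  forall x, 0 < x < 1 -> y x = l / lu * u x.
Proof.
move=> sy su cy cy' cu cu' lu0 u0 x x01.
have w0 (z : R) : 0 < z < 1 -> y z * u' z - y' z * u z = 0.
  move=> z01; have := wronskian_lim sy su cy cy' cu cu' z01.
  rewrite mulr0 mul0r subr0 /wronskian => /eqP; rewrite mulf_eq0 => /orP[|/eqP//].
  by move/andP: z01 => [z0 z1]; rewrite gt_eqF// mulr_gt0// powR_gt0// subr_gt0.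
have [y'' hy] := sy; have [u'' hu] := su.
have q0 (z : R) : 0 < z < 1 -> is_derive z 1 (fun x => y x * (u x)^-1) 0.
  move=> z01; have [dy _ _] := hy z z01; have [du _ _] := hu z z01.
  apply: (derive_eq (deriveM_fun dy (is_deriveV (u0 z z01) du))).
  rewrite /GRing.scale /= -[RHS](mulr0 (- (u z)^-2)) -(w0 z z01).
  by have := u0 z z01 => ?; field.
suff -> : l / lu = y x / u x by rewrite mulfVK ?u0.
have h : y z / u z @[z --> 0^'+] --> l / lu by apply: cvgM => //; exact: cvgV.
rewrite -(cvg_lim _ h)//; apply/cvg_lim => //; apply: cvg_near_cst.
near=> z; apply: (derive0_cst q0) => //; near: z; exact: right_unit.
Unshelve. all: by end_near. Qed.

(** The Plucker identity among the three Wronskians of y, u and v, whose values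
are known from the behaviour at 0; u is the regular solution and v the one that
behaves like x^(1 - c). *)
Lemma hyp_sol_connection a b c y y' u u' v v' (l l' : R) : c != 1 ->
  hyp_sol a b c y y' -> hyp_sol a b c u u' -> hyp_sol a b c v v' ->
  y x @[x --> 0^'+] --> l -> x `^ c * y' x @[x --> 0^'+] --> l' ->
  u x @[x --> 0^'+] --> (1 : R) -> x `^ c * u' x @[x --> 0^'+] --> (0 : R) ->
  v x @[x --> 0^'+] --> (0 : R) -> x `^ c * v' x @[x --> 0^'+] --> 1 - c ->
  forall x, 0 < x < 1 ->
  y x = l * u x + l' / (1 - c) * v x.
Proof.
move=> c1 sy su sv cy cy' cu cu' cv cv' x x01.
have := wronskian_lim su sv cu cu' cv cv' x01.
have := wronskian_lim sy sv cy cy' cv cv' x01.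
have := wronskian_lim sy su cy cy' cu cu' x01.
rewrite /wronskian; set p := _ `^ _ * _ => E1 E2 E3.
have c0 : 1 - c != 0 by rewrite subr_eq0 eq_sym.
apply: (mulfI c0).
transitivity (y x * (p * (u x * v' x - u' x * v x))).
  by rewrite E3; ring.
transitivity (u x * (p * (y x * v' x - y' x * v x)) -
   v x * (p * (y x * u' x - y' x * u x))); first by ring.
by rewrite E1 E2; field.
Qed.

End wronskian.

(** * Integrals over an increasing union of segments *)

Section ftc_exhaustion.
Context {R : realType}.
Implicit Types (f F : R -> R) (a b : R).
Local Notation leb := (@lebesgue_measure R).

Lemma FTC_closed f F a b : a < b ->
  (forall x, a <= x <= b -> is_derive x 1 F (f x)) ->
  (forall x, a <= x <= b -> {for x, continuous f}) ->
  (\int[leb]_(x in `[a, b]) (f x)%:E = (F b - F a)%:E)%E.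
Proof.
move=> ab dF cf; rewrite EFinB; apply: continuous_FTC2 => //.
- apply: continuous_in_subspaceT => x; rewrite inE /= in_itv /= => xab.
  exact: cf.
- split.
  + move=> x; rewrite in_itv /= => /andP[ax xb].
    by have [] : is_derive x 1 F (f x) by apply: dF; rewrite !ltW.
  + by apply: right_limit; apply: dF; rewrite lexx ltW.
  + apply: cvg_at_left_filter; apply: (@derive_continuous _ _ _ (f b)).
    by apply: dF; rewrite lexx ltW.
- move=> x; rewrite in_itv /= => /andP[ax xb].
  rewrite derive1E; have [_ ->//] : is_derive x 1 F (f x).
  by apply: dF; rewrite !ltW.
Qed.

(** Improper integrals of nonnegative functions, by monotone convergence along
the segments. *)
Lemma FTC_exhaust f F (a_ b_ : nat -> R) :
  (forall n, a_ n < b_ n) ->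
  {homo a_ : m n / (m <= n)%N >-> n <= m} ->
  {homo b_ : m n / (m <= n)%N >-> m <= n} ->
  (forall n x, a_ n <= x <= b_ n -> 0 <= f x) ->
  (forall n x, a_ n <= x <= b_ n -> is_derive x 1 F (f x)) ->
  (forall n x, a_ n <= x <= b_ n -> {for x, continuous f}) ->
  ((F (b_ n) - F (a_ n))%:E @[n --> \oo] -->
   \int[leb]_(x in \bigcup_n [set` `[a_ n, b_ n]]) (f x)%:E)%E.
Proof.
move=> ab da db f0 dF cf.
rewrite (_ : (fun n => _) =
    fun n => \int[leb]_(x in `[a_ n, b_ n]) (f x)%:E)%E; last first.
  apply/funext => n; exact/esym/(FTC_closed (ab n) (dF n) (cf n)).
apply: ge0_nondecreasing_set_cvg_integral.
- move=> m n mn; apply/subsetPset => x /=; rewrite !in_itv /= => /andP[ax xb].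
  by rewrite (le_trans (da _ _ mn))//= (le_trans xb)// db.
- by move=> n; exact: measurable_itv.
- move=> n; apply/measurable_EFinP.
  apply: subspace_continuous_measurable_fun; first exact: measurable_itv.
  apply: continuous_in_subspaceT => x; rewrite inE /= in_itv /=; exact: cf.
- by move=> n x /=; rewrite in_itv /= lee_fin; exact: f0.
Qed.

End ftc_exhaustion.

(** * Euler's integral *)

Section gamma.
Context {R : realType}.
Implicit Types (x t : R).
Local Notation leb := (@lebesgue_measure R).

Definition gamma_integrand x t : R := t `^ (x - 1) * expR (- t).
(** The extended-real integral, for which positivity and finiteness are
statements to be proved; euler_integral is its real part. *)
Definition egamma x : \bar R :=
  (\int[leb]_(t in `]0%R, +oo[) (gamma_integrand x t)%:E)%E.

Lemma derive_expRN t : is_derive t 1 (fun t : R => expR (- t)) (- expR (- t)).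
Proof.
have := @derive_comp_fun _ expR (fun t => - t) t _ _ (is_derive_expR _)
  (deriveN_fun (is_derive_id _ _)).
by rewrite mulrN1.
Qed.

Lemma gamma_integrand_cont x t : 0 < t -> {for t, continuous (gamma_integrand x)}.
Proof.
move=> t0; apply: (@derive_continuous _ _ _ _).
exact: (deriveM_fun (derive_powR _ t0) (derive_expRN t)).
Qed.

Lemma gamma_integrand_ge0 x t : 0 <= gamma_integrand x t.
Proof. by rewrite mulr_ge0 ?powR_ge0 ?expR_ge0. Qed.

Lemma measurable_gamma_integrand x (D : set R) :
  measurable_fun D (gamma_integrand x).
Proof.
apply: measurable_funTS; apply: measurable_funM; first exact: measurable_powR.
by apply: (measurableT_comp (@measurable_expR R)); exact: measurable_funN.
Qed.

Let a_ (n : nat) : R := n.+2%:R^-1.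
Let b_ (n : nat) : R := n.+2%:R.

Lemma exhaust_ab n : a_ n < b_ n.
Proof.
rewrite /a_ /b_; apply: (@lt_trans _ _ 1); last by rewrite ltr1n.
by rewrite invf_lt1// ltr1n.
Qed.

Lemma exhaust_a m n : (m <= n)%N -> a_ n <= a_ m.
Proof. by move=> mn; rewrite /a_ lef_pV2 ?posrE ?ltr0n// ler_nat. Qed.

Lemma exhaust_b m n : (m <= n)%N -> b_ m <= b_ n.
Proof. by move=> mn; rewrite /b_ ler_nat. Qed.

Lemma exhaust_a_gt0 n : 0 < a_ n.
Proof. by rewrite /a_ invr_gt0. Qed.

Lemma exhaust_oy : \bigcup_n [set` `[a_ n, b_ n]] = `]0, +oo[%classic.
Proof.
apply/seteqP; split => [t [n _] /=|t /=]; rewrite !in_itv /=.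
  by move=> /andP[+ _]; rewrite andbT; apply: lt_le_trans; exact: exhaust_a_gt0.
rewrite andbT => t0; pose n := maxn (Num.truncn t) (Num.truncn t^-1).
have h (u : R) : 0 < u -> (Num.truncn u <= n)%N -> u <= b_ n.
  move=> u0 un; apply: (le_trans (ltW (truncnS_gt _))).
  by rewrite /b_ ler_nat ltnS leqW.
exists n => //=; rewrite in_itv /=; apply/andP; split; last first.
  by apply: h => //; exact: leq_maxl.
rewrite /a_ -[t]invrK lef_pV2 ?posrE ?invr_gt0//.
by apply: h; [rewrite invr_gt0|exact: leq_maxr].
Qed.

Lemma cvg_a_ : a_ @ \oo --> (0 : R).
Proof. by move: (@cvg_harmonic R); rewrite -cvg_shiftS. Qed.

(** Compare exp with the N-th term of its series, for some N above |x|. *)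
Lemma cvg_b_inf (x : R) : b_ n `^ x * expR (- b_ n) @[n --> \oo] --> (0 : R).
Proof.
pose N := (Num.truncn `|x|).+1.
(* b^N exp (- b) <= (N + 1)! / b, from the term of degree N + 1 of the series. *)
apply: (@squeeze_cvgr _ _ _ _ (cst 0) (fun n => N.+1`!%:R * a_ n)).
- near=> n; rewrite mulr_ge0 ?powR_ge0 ?expR_ge0//= expRN.
  have b0 : 0 < b_ n by rewrite /b_.
  have h := expR_ge1Dxn N (ltW b0).
  have h1 : b_ n `^ x <= b_ n ^+ N.
    rewrite -powR_mulrn ?(ltW b0)// ler_powR//; first by rewrite /b_ ler1n.
    by rewrite (le_trans (ler_norm _))// ltW// truncnS_gt.
  have {}h : b_ n ^+ N.+1 <= N.+1`!%:R * expR (b_ n).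
    rewrite -ler_pdivrMl ?ltr0n ?fact_gt0// mulrC.
    by apply: le_trans h; rewrite lerDr.
  rewrite ler_pdivrMr ?expR_gt0// (le_trans h1)//.
  rewrite /a_ -/(b_ n) mulrAC ler_pdivlMr// (le_trans _ h)//.
  by rewrite exprSr.
- exact: cvg_cst.
- rewrite -[X in _ --> X](mulr0 N.+1`!%:R); apply: cvgM; first exact: cvg_cst.
  exact: cvg_a_.
Unshelve. all: by end_near. Qed.

Lemma cvg_a_0 (x : R) : 0 < x -> a_ n `^ x * expR (- a_ n) @[n --> \oo] --> (0 : R).
Proof.
move=> x0; have h : t `^ x * expR (- t) @[t --> 0^'+] --> 0 * expR (- 0).
  by apply: cvgM; [exact: powR_cvg0|exact: right_limit (derive_expRN 0)].
rewrite mul0r in h; move/cvg_at_rightP : h; apply; split=> [n|].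
  exact: exhaust_a_gt0.
exact: cvg_a_.
Qed.

Lemma egamma_lim x : (\int[leb]_(t in `[a_ n, b_ n]) (gamma_integrand x t)%:E
  @[n --> \oo] --> egamma x)%E.
Proof.
rewrite /egamma -exhaust_oy; apply: ge0_nondecreasing_set_cvg_integral.
- move=> m n mn; apply/subsetPset => t /=; rewrite !in_itv /= => /andP[at_ tb].
  by rewrite (le_trans (exhaust_a mn))//= (le_trans tb)// exhaust_b.
- by move=> n; exact: measurable_itv.
- by move=> n; apply/measurable_EFinP; exact: measurable_gamma_integrand.
- by move=> n t _; rewrite lee_fin gamma_integrand_ge0.
Qed.

Lemma egamma1 : egamma 1 = 1%E.
Proof.
have pos n t : a_ n <= t <= b_ n -> 0 < t.
  by move=> /andP[+ _]; apply: lt_le_trans; exact: exhaust_a_gt0.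
have dF n t : a_ n <= t <= b_ n ->
    is_derive t 1 (fun t => - expR (- t)) (gamma_integrand 1 t).
  move=> _; have := deriveN_fun (derive_expRN t); rewrite opprK /gamma_integrand.
  by rewrite subrr powRr0 mul1r.
have := @FTC_exhaust _ (gamma_integrand 1) (fun t => - expR (- t)) a_ b_ exhaust_ab
  exhaust_a exhaust_b (fun n x _ => gamma_integrand_ge0 1 x) dF
  (fun n t h => gamma_integrand_cont (pos n t h)).
rewrite exhaust_oy => h; rewrite /egamma -(cvg_lim _ h)//; apply/cvg_lim => //.
apply: cvg_EFin; first exact: nearW.
rewrite (_ : _ \o _ = fun n => - expR (- b_ n) - - expR (- a_ n)) //.
have eb : expR (- b_ n) @[n --> \oo] --> (0 : R).
  rewrite [X in X @ _ --> _](_ : _ = fun n => b_ n `^ 0 * expR (- b_ n)).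
    exact: cvg_b_inf.
  by apply/funext => n; rewrite powRr0 mul1r.
have ea : expR (- a_ n) @[n --> \oo] --> (1 : R).
  have := right_limit (derive_expRN 0); rewrite oppr0 expR0.
  move=> /cvg_at_rightP; apply; split; [exact: exhaust_a_gt0|exact: cvg_a_].
rewrite (_ : 1 = - 0 - - 1 :> R); last by rewrite opprK oppr0 add0r.
by apply: cvgB; apply: cvgN.
Qed.

(** Integration by parts, with the antiderivative t^x exp (- t) that tends to 0 at
both ends. *)
Lemma egammaS x : 0 < x -> egamma (x + 1) = (x%:E * egamma x)%E.
Proof.
move=> x0; pose F t : R := t `^ x * expR (- t).
have pos n t : a_ n <= t <= b_ n -> 0 < t.
  by move=> /andP[+ _]; apply: lt_le_trans; exact: exhaust_a_gt0.
have int n y : leb.-integrable `[a_ n, b_ n] (EFin \o gamma_integrand y).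
  apply: continuous_compact_integrable; first exact: segment_compact.
  apply: continuous_in_subspaceT => t; rewrite inE /= in_itv /= => /pos.
  exact: gamma_integrand_cont.
have dF t : 0 < t -> is_derive t 1 F (x * gamma_integrand x t - gamma_integrand (x + 1) t).
  move=> t0; apply: (derive_eq (deriveM_fun (derive_powR x t0) (derive_expRN t))).
  by rewrite /gamma_integrand addrK; ring.
pose I y n : \bar R := (\int[leb]_(t in `[a_ n, b_ n]) (gamma_integrand y t)%:E)%E.
have K n : (x%:E * I x n = I (x + 1)%R n + (F (b_ n) - F (a_ n))%:E)%E.
  rewrite -(@FTC_closed _ _ F _ _ (exhaust_ab n) (fun t h => dF t (pos n t h))).
    under [X in (_ + X)%E]eq_integral do rewrite EFinB EFinM.
    rewrite integralB//; [|exact: integrableZl (int _ _)|exact: int].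
    rewrite integralZl//; last exact: int.
    rewrite [RHS]addeC -/(I x n) -/(I (x + 1) n) subeK//; exact: integrable_fin_num (int _ _).
  move=> t /pos t0; apply: cvgB; last exact: gamma_integrand_cont.
  by apply: cvgM; [exact: cvg_cst|exact: gamma_integrand_cont].
have cF : (F (b_ n) - F (a_ n))%:E @[n --> \oo] --> 0%:E.
  apply: cvg_EFin; first exact: nearW.
  rewrite -[X in _ --> X](subrr (0 : R)).
  by apply: cvgB; [exact: cvg_b_inf|exact: cvg_a_0].
have c1 : (x%:E * I x n)%E @[n --> \oo] --> (x%:E * egamma x)%E.
  by apply: cvgeZl => //; exact: egamma_lim.
have c2 : (x%:E * I x n)%E @[n --> \oo] --> egamma (x + 1).
  rewrite (_ : (fun n => _) = fun n => (I (x + 1)%R n + (F (b_ n) - F (a_ n))%:E)%E).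
    rewrite -[egamma _]adde0; apply: cvgeD => //; last exact: egamma_lim.
    by rewrite fin_num_adde_defl.
  by apply/funext => n; exact: K.
by rewrite -(cvg_lim _ c1)// -(cvg_lim _ c2).
Qed.

Lemma egamma_ge0 x : (0 <= egamma x)%E.
Proof. by apply: integral_ge0 => t _; rewrite lee_fin gamma_integrand_ge0. Qed.

(** The concave function u -> u^s lies below its tangent at 1. The proof applies
1 + z <= exp z to ln (u / v) and to ln (1 / v), weighted by s and 1 - s. *)
Lemma powR_le_tangent (u s : R) : 0 < u -> 0 <= s <= 1 -> u `^ s <= 1 - s + s * u.
Proof.
move=> u0 /andP[s0 s1]; set v := 1 - s + s * u.
have v0 : 0 < v by rewrite /v; nra.
rewrite -[leRHS]lnK ?posrE// /powR gt_eqF// ler_expR.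
have h1 := expR_ge1Dx (ln (u / v)); have h2 := expR_ge1Dx (ln (v^-1)).
rewrite lnK ?posrE ?divr_gt0// ln_div ?posrE// in h1.
rewrite lnK ?posrE ?invr_gt0// lnV ?posrE// in h2.
have h : s * (u / v) + (1 - s) * v^-1 = 1.
  by rewrite /v; field; rewrite gt_eqF.
have := ler_wpM2l s0 h1; have : 0 <= 1 - s by lra.
by move=> /ler_wpM2l /(_ _ _ h2); nra.
Qed.

(** The tangent bound for (t / x)^s, integrated against the density
t^(x - 1) exp (- t). This half of the log-convexity of Gamma is enough both for
finiteness and for asymptotics. *)
Lemma egamma_interp x s : 0 < x -> 0 <= s <= 1 ->
  (egamma (x + s) <= (x `^ s)%:E * egamma x)%E.
Proof.
move=> x0 s01; have /andP[s0 s1] := s01.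
have mg y : measurable_fun (`]0, +oo[ : set R) (fun t : R => (gamma_integrand y t)%:E).
  by apply/measurable_EFinP; exact: measurable_gamma_integrand.
have gp y t : (0 <= (gamma_integrand y t)%:E)%E by rewrite lee_fin gamma_integrand_ge0.
have eZ y k : 0 <= k ->
    (\int[leb]_(t in `]0%R, +oo[) (k%:E * (gamma_integrand y t)%:E) = k%:E * egamma y)%E.
  by move=> k0; rewrite ge0_integralZl//; exact: mg.
apply: (@le_trans _ _ (\int[leb]_(t in `]0%R, +oo[)
   ((x `^ s * (1 - s))%:E * (gamma_integrand x t)%:E +
    (x `^ s * (s / x))%:E * (gamma_integrand (x + 1) t)%:E))%E).
  apply: ge0_le_integral => //=.
  - exact: mg.
  - apply: emeasurable_funD; apply: measurable_funeM; exact: mg.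
  - move=> t; rewrite in_itv /= andbT => t0; rewrite -!EFinM -EFinD lee_fin.
    rewrite /gamma_integrand addrK.
    have -> : x + s - 1 = (x - 1) + s by ring.
    rewrite powRD ?(gt_eqF t0) ?implybT//.
    have tx0 : 0 < t / x by rewrite divr_gt0.
    have := powR_le_tangent tx0 s01.
    have -> : t `^ s = x `^ s * (t / x) `^ s.
      by rewrite -powRM ?ltW// mulrC divfK ?gt_eqF.
    rewrite -(powR_pred x t0).
    have := powR_gt0 (x - 1) t0; have := powR_gt0 s x0; have := expR_gt0 (- t).
    set E := expR _; set P := _ `^ (x - 1); set Q := x `^ s; set T := _ `^ s.
    set rhs := 1 - s + _ => E0 Q0 P0 h.
    have := ler_wpM2l (ltW (mulr_gt0 (mulr_gt0 E0 Q0) P0)) h.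
    rewrite [leLHS](_ : _ = P * (Q * T) * E); last by ring.
    move/le_trans; apply; rewrite /rhs le_eqVlt; apply/orP; left; apply/eqP.
    by field; rewrite gt_eqF.
rewrite ge0_integralD//=; [|move=> t _| |move=> t _|].
- rewrite !eZ; [|by rewrite !mulr_ge0 ?powR_ge0 ?invr_ge0// ltW|by rewrite mulr_ge0 ?powR_ge0 ?subr_ge0].
  rewrite egammaS//.
  rewrite muleA -EFinM -ge0_muleDl.
    by rewrite -EFinD -mulrA -mulrDr divfK ?gt_eqF// subrK mulr1.
  - by rewrite lee_fin mulr_ge0 ?powR_ge0// subr_ge0.
  - by rewrite lee_fin !mulr_ge0 ?powR_ge0 ?invr_ge0// ltW.
- by apply: mule_ge0; [rewrite lee_fin mulr_ge0 ?powR_ge0 ?subr_ge0|exact: gp].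
- by apply: measurable_funeM; exact: mg.
- by apply: mule_ge0; [rewrite lee_fin !mulr_ge0 ?powR_ge0 ?invr_ge0// ltW|exact: gp].
- by apply: measurable_funeM; exact: mg.
Qed.

(** egamma_interp moves from 1 up to [1, 2] for finiteness, and from [1, 2] up to
2 for positivity; the functional equation reaches all other arguments. *)
Lemma egamma_fin x : 0 < x -> (0 < egamma x < +oo)%E.
Proof.
have e2 : egamma 2 = 1%E by rewrite -[2](_ : 1 + 1 = _) // egammaS// egamma1 mule1.
have base s : 0 <= s <= 1 -> (0 < egamma (1 + s) < +oo)%E.
  move=> /andP[s0 s1]; apply/andP; split.
    have := @egamma_interp (1 + s) (1 - s); rewrite (_ : 1 + s + (1 - s) = 2); last by ring.
    rewrite e2 => h; have {h} : (1 <= ((1 + s) `^ (1 - s))%:E * egamma (1 + s))%E.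
      by apply: h; [lra|apply/andP; split; lra].
    rewrite lt0e egamma_ge0 andbT; apply: contraTneq => ->.
    by rewrite mule0 lee_fin ler10.
  apply: (le_lt_trans (@egamma_interp 1 s ltr01 _)); first by apply/andP.
  by rewrite egamma1 mule1 ltry.
have step y : 0 < y -> (0 < egamma (y + 1) < +oo)%E -> (0 < egamma y < +oo)%E.
  move=> y0; rewrite egammaS//; have := egamma_ge0 y.
  case: (egamma y) => [r| |] //=; first by rewrite -EFinM !lte_fin !lee_fin pmulr_rgt0// !ltry !andbT.
  by rewrite gt0_muley// ltxx andbF.
have step' y : 0 < y -> (0 < egamma y < +oo)%E -> (0 < egamma (y + 1) < +oo)%E.
  move=> y0; rewrite egammaS//; have := egamma_ge0 y.
  by case: (egamma y) => [r| |] //=; rewrite ?ltxx ?andbF// -EFinM !lte_fin !lee_fin pmulr_rgt0// !ltry !andbT.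
have up n s : 0 <= s <= 1 -> (0 < egamma (1 + s + n%:R) < +oo)%E.
  move=> s01; elim: n => [|n IH]; first by rewrite addr0 base.
  by rewrite -natr1 addrA; apply: step' => //; have := ler0n R n; lra.
move=> x0; apply: step => //; rewrite addrC.
pose s := x - (Num.truncn x)%:R.
have h := truncn_itv (ltW x0).
rewrite (_ : 1 + x = 1 + s + (Num.truncn x)%:R); last by rewrite /s; ring.
by apply: up; rewrite /s; move/andP: h; rewrite -natr1 => -[? ?]; lra.
Qed.

Lemma Gamma_euler x : 0 < x -> Gamma x = euler_integral x.
Proof. by move=> x0; rewrite /Gamma x0 addr0 big_ord0 divr1. Qed.

Lemma GammaE x : 0 < x -> egamma x = (Gamma x)%:E.
Proof.
move=> x0; rewrite Gamma_euler// /euler_integral /Rintegral fineK//.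
by have /andP[? ?] := egamma_fin x0; rewrite ge0_fin_numE ?ltW.
Qed.

Lemma Gamma_gt0 x : 0 < x -> 0 < Gamma x.
Proof. by move=> x0; have := egamma_fin x0; rewrite GammaE// lte_fin => /andP[]. Qed.

Lemma GammaS x : 0 < x -> Gamma (x + 1) = x * Gamma x.
Proof.
move=> x0; have := egammaS x0; rewrite !GammaE ?addr_gt0//.
by rewrite -EFinM => -[].
Qed.

Lemma Gamma_interp x s : 0 < x -> 0 <= s <= 1 ->
  Gamma (x + s) <= x `^ s * Gamma x.
Proof.
move=> x0 s01; have := egamma_interp x0 s01; move/andP: s01 => [s0 s1].
by rewrite !GammaE ?ltr_wpDr// -EFinM lee_fin.
Qed.

End gamma.

(** * Growth of the Gamma function and of Pochhammer symbols *)

Section gamma_asymptotics.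
Context {R : realType}.
Implicit Types (a b c x : R).

Lemma cvg_lim_eq T (F : set_system T) (f : T -> R) (l l' : R) :
  f @ F --> l -> l = l' -> f @ F --> l'.
Proof. by move=> h <-. Qed.

(** Gamma (x + N) compared with its expected size Gamma (1 + N) N^(x - 1), at
N = n + 1. *)
Definition gamma_ratio x (n : nat) : R :=
  Gamma (x + n.+1%:R) / (Gamma (1 + n.+1%:R) * n.+1%:R `^ (x - 1)).

Lemma gamma_ratio_gt0 x n : 0 < x -> 0 < gamma_ratio x n.
Proof.
by move=> x0; apply: divr_gt0; [|apply: mulr_gt0]; rewrite ?Gamma_gt0 ?powR_gt0// addr_gt0.
Qed.

Lemma gamma_ratioS x n : 0 < x ->
  gamma_ratio (x + 1) n = (x + n.+1%:R) / n.+1%:R * gamma_ratio x n.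
Proof.
move=> x0; rewrite /gamma_ratio (addrAC x 1) GammaS ?addr_gt0// addrK.
rewrite -(powR_pred x (ltr0Sn R n)).
have := Gamma_gt0 (addr_gt0 (@ltr01 R) (ltr0Sn R n)).
have := powR_gt0 (x - 1) (ltr0Sn R n); have := ltr0Sn R n.
set N : R := n.+1%:R; set G := Gamma (1 + _); set P := _ `^ _ => N0 P0 G0.
by field; rewrite !gt_eqF.
Qed.

Lemma cvg_natr_ratioS a b : (a + n.+1%:R) / (b + n.+1%:R) @[n --> \oo] --> (1 : R).
Proof. by have := @ratio_natr_cvg R a b; rewrite -cvg_shiftS. Qed.

(** For x in [1, 2] the interpolation inequality used upwards and downwards gives
matching bounds; integer shifts change gamma_ratio by a factor that tends to 1. *)
Lemma cvg_gamma_ratio x : 0 < x -> gamma_ratio x n @[n --> \oo] --> (1 : R).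
Proof.
have base s : 0 <= s <= 1 -> gamma_ratio (1 + s) n @[n --> \oo] --> (1 : R).
  move=> s01; have /andP[s0 s1] := s01.
  apply: (@squeeze_cvgr _ _ _ _ (fun n => (0 + n.+1%:R) / (2 + n.+1%:R))
    (fun n => (1 + n.+1%:R) / (0 + n.+1%:R))); [|exact: cvg_natr_ratioS..].
  apply: nearW => n; rewrite !add0r; set N : R := n.+1%:R.
  have N0 : 0 < N by rewrite /N.
  have N1 : 1 <= N by rewrite /N ler1n.
  have oN0 : 0 < 1 + N by lra.
  have G0 := Gamma_gt0 oN0.
  have P0 s' := powR_gt0 s' N0.
  rewrite /gamma_ratio -/N (addrC 1 s) addrK (addrAC s 1 N) -addrA (addrC s) (addrC N 1).
  (* Interpolation from 1 + N up to 1 + N + s, then from there up to 2 + N. *)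
  have up : Gamma (1 + N + s) <= (1 + N) `^ s * Gamma (1 + N).
    exact: Gamma_interp.
  have lo : (1 + N) * Gamma (1 + N) <= (1 + N + s) `^ (1 - s) * Gamma (1 + N + s).
    rewrite -GammaS// (_ : 1 + N + 1 = 1 + N + s + (1 - s)); last by ring.
    by apply: Gamma_interp; [lra|apply/andP; split; lra].
  apply/andP; split.
    have h1 : (1 + N + s) `^ (1 - s) <= (2 + N) `^ (1 - s).
      by apply: ge0_ler_powR; rewrite ?nnegrE; lra.
    have h2 : N `^ s <= (2 + N) `^ s by apply: ge0_ler_powR; rewrite ?nnegrE; lra.
    have e : (2 + N) `^ (1 - s) * (2 + N) `^ s = 2 + N.
      rewrite -powRD; last by rewrite (_ : 2 + N != 0) ?implybT// gt_eqF//; lra.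
      by rewrite subrK powRr1//; lra.
    have Gs0 : 0 < Gamma (1 + N + s) by apply: Gamma_gt0; lra.
    have h3 : N * Gamma (1 + N) <= (2 + N) `^ (1 - s) * Gamma (1 + N + s).
      apply: (le_trans (le_trans _ lo)); last by rewrite ler_wpM2r// ltW.
      by rewrite ler_wpM2r ?ltW//; lra.
    rewrite ler_pdivrMr; last by lra.
    rewrite mulrAC ler_pdivlMr; last exact: mulr_gt0.
    rewrite -{1}e mulrA; apply: (le_trans (ler_wpM2r _ h3)); first exact: powR_ge0.
    rewrite [leLHS](_ : _ = (2 + N) `^ (1 - s) * Gamma (1 + N + s) * N `^ s); last by ring.
    rewrite [leRHS](_ : _ = (2 + N) `^ (1 - s) * Gamma (1 + N + s) * (2 + N) `^ s); last by ring.
    by rewrite ler_wpM2l// mulr_ge0 ?powR_ge0// ltW.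
  rewrite ler_pdivrMr; last exact: mulr_gt0.
  apply: (le_trans up); rewrite mulrC [leRHS](_ : _ = Gamma (1 + N) * ((1 + N) / N * N `^ s)); last by ring.
  apply: ler_wpM2l; first exact: ltW.
  have r1 : 1 <= (1 + N) / N by rewrite ler_pdivlMr//; lra.
  have -> : (1 + N) `^ s = ((1 + N) / N) `^ s * N `^ s.
    by rewrite -powRM ?ltW ?divr_gt0// divfK ?gt_eqF.
  by apply: ler_wpM2r; [exact: powR_ge0|exact: ler1_powR].
have h n y : 0 <= y <= 1 -> gamma_ratio (y + 1 + n%:R) k @[k --> \oo] --> (1 : R).
  move=> y01; elim: n => [|n IH].
    by rewrite addr0 addrC; exact: base.
  rewrite -natr1 addrA.
  have yn0 : 0 < y + 1 + n%:R.
    by rewrite ltr_wpDr// ltr_wpDl//; move/andP: y01 => [].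
  rewrite (_ : (fun k => _) = (fun k => (y + 1 + n%:R + k.+1%:R) / (0 + k.+1%:R) *
     gamma_ratio (y + 1 + n%:R) k)).
    apply: (cvg_lim_eq (l := 1 * 1)); last by rewrite mulr1.
    by apply: cvgM => //; exact: cvg_natr_ratioS.
  by apply/funext => k; rewrite gamma_ratioS// add0r.
move=> x0; pose m := Num.truncn x.
have hm := truncn_itv (ltW x0).
have hx1 : gamma_ratio (x + 1) k @[k --> \oo] --> (1 : R).
  rewrite (_ : x + 1 = (x - m%:R) + 1 + m%:R); last by ring.
  apply: h; move/andP: hm; rewrite -natr1 -/m => -[? ?]; apply/andP; split; lra.
rewrite (_ : (fun k => _) = (fun k => (0 + k.+1%:R) / (x + k.+1%:R) *
   gamma_ratio (x + 1) k)).
  apply: (cvg_lim_eq (l := 1 * 1)); last by rewrite mulr1.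
  by apply: cvgM => //; exact: cvg_natr_ratioS.
apply/funext => k; rewrite gamma_ratioS// add0r.
by field; rewrite !gt_eqF// addr_gt0.
Qed.

Lemma pochhammer_Gamma x n : 0 < x -> pochhammer x n = Gamma (x + n%:R) / Gamma x.
Proof.
move=> x0; elim: n => [|n IH]; first by rewrite pochhammer0 addr0 divff// gt_eqF// Gamma_gt0.
rewrite pochhammerS IH -natr1 addrA GammaS ?ltr_wpDr//; ring.
Qed.

Lemma pochhammer_ratio x n : 0 < x -> pochhammer x n.+1 =
  gamma_ratio x n * n.+1%:R `^ (x - 1) * (Gamma (1 + n.+1%:R) / Gamma x).
Proof.
move=> x0; rewrite pochhammer_Gamma// /gamma_ratio.
have := Gamma_gt0 (addr_gt0 (@ltr01 R) (ltr0Sn R n)).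
have := powR_gt0 (x - 1) (ltr0Sn R n); have := Gamma_gt0 x0.
by move=> *; field; rewrite !gt_eqF.
Qed.

Lemma pochhammer1 n : pochhammer (1 : R) n = n`!%:R.
Proof.
elim: n => [|n IH]; first by rewrite pochhammer0.
by rewrite pochhammerS IH factS natrM nat1r mulrC.
Qed.

Lemma pochhammer_gt0 x n : 0 < x -> 0 < pochhammer x n.
Proof. by move=> x0; apply: prodr_gt0 => i _; rewrite ltr_wpDr. Qed.

(** The powers of n cancel because the parameters have equal sums above and
below. *)
Lemma cvg_pochhammer_balanced x a b : 0 < x -> 0 < a -> 0 < b ->
  pochhammer (x + a) n * pochhammer (x + b) n /
    (pochhammer x n * pochhammer (x + a + b) n) @[n --> \oo] -->
  Gamma x * Gamma (x + a + b) / (Gamma (x + a) * Gamma (x + b)).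
Proof.
move=> x0 a0 b0; rewrite -cvg_shiftS /=.
have xa0 : 0 < x + a by lra.
have xb0 : 0 < x + b by lra.
have xab0 : 0 < x + a + b by lra.
set L := Gamma x * _ / _.
rewrite (_ : (fun n => _) = (fun n => gamma_ratio (x + a) n * gamma_ratio (x + b) n /
   (gamma_ratio x n * gamma_ratio (x + a + b) n) * L)).
  apply: (cvg_lim_eq (l := 1 * 1 / (1 * 1) * L)); last by rewrite !mulr1 divr1 mul1r.
  apply: cvgM; last exact: cvg_cst.
  apply: cvgM; first by apply: cvgM; exact: cvg_gamma_ratio.
  apply: cvgV; first by rewrite mulr1 oner_neq0.
  by apply: cvgM; exact: cvg_gamma_ratio.
apply/funext => n; rewrite !pochhammer_ratio// /L.
set N : R := n.+1%:R; have N0 : 0 < N by rewrite /N.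
have e : N `^ (x + a - 1) * N `^ (x + b - 1) = N `^ (x - 1) * N `^ (x + a + b - 1).
  by rewrite -!powRD ?(gt_eqF N0) ?implybT//; congr (_ `^ _); ring.
have g y (y0 : 0 < y) := gamma_ratio_gt0 n y0.
have := powR_gt0 (x + a + b - 1) N0; have := powR_gt0 (x - 1) N0 => P1 P2.
transitivity ((N `^ (x + a - 1) * N `^ (x + b - 1)) / (N `^ (x - 1) * N `^ (x + a + b - 1)) *
  (gamma_ratio (x + a) n * gamma_ratio (x + b) n /
   (gamma_ratio x n * gamma_ratio (x + a + b) n) * L)).
  rewrite /L; field.
  by rewrite !gt_eqF ?g ?Gamma_gt0// addr_gt0.
by rewrite e divff ?mul1r// mulf_neq0// gt_eqF.
Qed.

(** The coefficient is of the size n^(a + b - c - 1). *)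
Lemma cvg_mul_hypcoef a b c : 0 < a -> 0 < b -> a + b < c ->
  n%:R * hypcoef a b c n @[n --> \oo] --> (0 : R).
Proof.
move=> a0 b0 abc; have c0 : 0 < c by lra.
rewrite -cvg_shiftS /=; set L := Gamma c * Gamma 1 / (Gamma a * Gamma b).
rewrite (_ : (fun n => _) = (fun n => gamma_ratio a n * gamma_ratio b n /
   (gamma_ratio c n * gamma_ratio 1 n) * (L * harmonic n `^ (c - a - b)))).
  apply: (cvg_lim_eq (l := 1 * 1 / (1 * 1) * (L * 0))); last by rewrite !mulr0.
  apply: cvgM.
    apply: cvgM; first by apply: cvgM; exact: cvg_gamma_ratio.
    apply: cvgV; first by rewrite mulr1 oner_neq0.
    by apply: cvgM; exact: cvg_gamma_ratio.
  apply: cvgM; first exact: cvg_cst.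
  have d0 : 0 < c - a - b by lra.
  have /cvg_at_rightP h := powR_cvg0 d0; apply: h; split; last exact: cvg_harmonic.
  by move=> n; rewrite /= invr_gt0.
apply/funext => n; rewrite /hypcoef -pochhammer1 !pochhammer_ratio// /L.
set N : R := n.+1%:R; have N0 : 0 < N by rewrite /N.
rewrite /harmonic /= -/N.
have e : N * (N `^ (a - 1) * N `^ (b - 1)) = N^-1 `^ (c - a - b) * (N `^ (c - 1) * N `^ (1 - 1)).
  rewrite -powR_inv1 ?ltW// -powRrM -[X in X * _]powRr1 ?ltW//.
  by rewrite -!powRD ?(gt_eqF N0) ?implybT//; congr (_ `^ _); ring.
have g y (y0 : 0 < y) := gamma_ratio_gt0 n y0.
have := powR_gt0 (c - 1) N0; have := powR_gt0 (1 - 1) N0 => P1 P2.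
transitivity (N * (N `^ (a - 1) * N `^ (b - 1)) / (N `^ (c - 1) * N `^ (1 - 1)) *
  (gamma_ratio a n * gamma_ratio b n /
   (gamma_ratio c n * gamma_ratio 1 n) * L)).
  rewrite /L; field.
  by rewrite !gt_eqF ?g ?Gamma_gt0// addr_gt0.
rewrite e mulfK ?mulf_neq0 ?gt_eqF// /L; ring.
Qed.

End gamma_asymptotics.

(** * Abel's theorem for nonnegative coefficients *)

Section abel.
Context {R : realType}.
Implicit Types (f : nat -> R).

Lemma psum_ge0_le_lim f (x : R) n : (forall k, 0 <= f k) -> 0 <= x ->
  cvgn (pseries f x) -> pseries f x n <= psum f x.
Proof.
move=> f0 x0 cf; apply: nondecreasing_cvgn_le => //.
apply/nondecreasing_seqP => m; rewrite /pseries /series /= big_nat_recr //=.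
by rewrite lerDl mulr_ge0 ?exprn_ge0.
Qed.

(** Nonnegativity makes the sum monotone in x, and each partial sum is continuous
at 1. *)
Lemma abel_nonneg f : (forall k, 0 <= f k) -> cvgn (series f) ->
  psum f (1 - x) @[x --> 0^'+] --> limn (series f).
Proof.
move=> f0 cf; set S := limn _.
have f1 : pseries f 1 = series f.
  apply/funext => n; rewrite /pseries /series /=.
  by apply: eq_bigr => i _; rewrite expr1n mulr1.
have cf1 : cvgn (pseries f 1) by rewrite f1.
have ndf : nondecreasing_seq (series f).
  by apply/nondecreasing_seqP => m; rewrite seriesSr lerDl.
have upper (x : R) : 0 < x < 1 -> psum f (1 - x) <= S.
  move=> /andP[x0 x1]; have cx : cvgn (pseries f (1 - x)).
    by apply: is_cvg_pseries_inside cf1 _; rewrite normr1 ger0_norm; lra.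
  rewrite /psum /S -f1; apply: ler_lim => //; apply: nearW => n.
  apply: ler_sum => i _; rewrite ler_wpM2l// expr1n exprn_ile1//; lra.
apply/cvgrPdist_lt => e e0.
have [N SN] : exists N, S - e / 2 < series f N.
  move/cvgrPdist_lt : (cf) => /(_ (e / 2)) [|N _ /(_ N (leqnn N))]; first by rewrite divr_gt0.
  by move=> h; exists N; move: h; rewrite -/S => /= /(le_lt_trans (ler_norm _)); lra.
have cpow i : (1 - x) ^+ i @[x --> (0:R)^'+] --> (1 : R).
  elim: i => [|i IH]; first exact: cvg_cst.
  apply: (cvg_lim_eq (l := (1 - 0) * 1)); last by rewrite subr0 mulr1.
  under eq_fun do rewrite exprS; apply: cvgM => //.
  exact: right_limit (derive_onem 0).
have cN : pseries f (1 - x) N @[x --> (0:R)^'+] --> series f N.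
  rewrite /pseries /series /=; elim: (N) => [|n IH].
    by under eq_fun do rewrite big_geq//; rewrite big_geq//; exact: cvg_cst.
  under eq_fun do rewrite big_nat_recr//=; rewrite big_nat_recr//=.
  apply: cvgD => //; apply: (cvg_lim_eq (l := f n * 1)); last by rewrite mulr1.
  by apply: cvgM => //; exact: cvg_cst.
near=> x.
have x01 : 0 < x < 1 by near: x; exact: right_unit.
have up := upper x x01.
have lo : pseries f (1 - x) N <= psum f (1 - x).
  apply: psum_ge0_le_lim => //; first by lra.
  by apply: is_cvg_pseries_inside cf1 _; rewrite normr1 ger0_norm; lra.
have : `|series f N - pseries f (1 - x) N| < e / 2.
  near: x; move/cvgrPdist_lt : cN; apply; by rewrite divr_gt0.
move=> hN; rewrite ger0_norm ?subr_ge0//.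
by have := ler_norm (series f N - pseries f (1 - x) N); lra.
Unshelve. all: by end_near. Qed.

End abel.

(** * Gauss's summation formula *)

Section gauss.
Context {R : realType}.
Implicit Types (a b c : R).

Lemma hypcoef_ge0 a b c k : 0 < a -> 0 < b -> 0 < c -> 0 <= hypcoef a b c k.
Proof.
move=> a0 b0 c0; rewrite divr_ge0 ?mulr_ge0// ltW// ?pochhammer_gt0//.
Qed.

(** The value of the series at the boundary point 1. *)
Definition hyp_one a b c : R := limn (series (hypcoef a b c)).

(** The factor on the right is bounded below by (c - a - b) / 2 for large n, which
bounds the series by a telescoping one. *)
Lemma hypcoef_telescope a b c n : 0 < c ->
  n%:R * hypcoef a b c n - n.+1%:R * hypcoef a b c n.+1 =
  hypcoef a b c n * ((n%:R * (c - a - b) - a * b) / (c + n%:R)).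
Proof.
move=> c0; have cn : c + n%:R != 0 by rewrite gt_eqF// ltr_wpDr.
apply: (mulIf cn); have := hypcoefS a b n (pos_nonpole c0) => E.
transitivity (n%:R * hypcoef a b c n * (c + n%:R) -
  hypcoef a b c n.+1 * ((c + n%:R) * n.+1%:R)); first by ring.
by rewrite E; field.
Qed.

Lemma hypcoef_succ_c a b c n : 0 < c ->
  hypcoef a b (c + 1) n * (c + n%:R) = c * hypcoef a b c n.
Proof.
move=> c0; rewrite /hypcoef.
have E : pochhammer c n * (c + n%:R) = c * pochhammer (c + 1) n.
  by rewrite -pochhammerS pochhammerSl.
have c1 : 0 < c + 1 by lra.
have p1 := pochhammer_gt0 n c0; have p2 := pochhammer_gt0 n c1.
have nf := @natfact_neq0 R n.
apply: (@mulIf _ (pochhammer c n * pochhammer (c + 1) n)).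
  by rewrite mulf_neq0// gt_eqF.
transitivity (pochhammer a n * pochhammer b n / n`!%:R * (pochhammer c n * (c + n%:R))).
  by field; rewrite nf gt_eqF.
by rewrite E; field; rewrite nf gt_eqF.
Qed.

Section gauss_sum.
Variables a b c : R.
Hypotheses (a0 : 0 < a) (b0 : 0 < b) (abc : a + b < c).

Let c0 : 0 < c. Proof. by move: a0 b0 abc; lra. Qed.

Lemma is_cvg_hyp_one : cvgn (series (hypcoef a b c)).
Proof.
pose d := c - a - b; have d0 : 0 < d by rewrite /d; move: abc; lra.
(* From K on, hypcoef is at most 2 / d times its telescoping difference. *)
pose K := (Num.truncn (2 * a * b / d + c)).+1.
have hK n : (K <= n)%N -> 2 * a * b / d + c <= n%:R.
  by move=> Kn; apply: (le_trans (ltW (truncnS_gt _))); rewrite ler_nat.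
have h n : hypcoef a b c (K + n) <= 2 / d *
    ((K + n)%:R * hypcoef a b c (K + n) - (K + n).+1%:R * hypcoef a b c (K + n).+1).
  rewrite hypcoef_telescope//; set N := (K + n)%N; have NK := hK N (leq_addr _ _).
  have cN : 0 < c + N%:R by rewrite ltr_wpDr.
  rewrite -/d mulrCA -[leLHS]mulr1 ler_wpM2l ?hypcoef_ge0//.
  rewrite mulrA ler_pdivlMr// mul1r.
  rewrite [leRHS](_ : _ = 2 * N%:R - 2 * a * b / d); last by field; rewrite gt_eqF.
  by lra.
have bnd n : series (hypcoef a b c) (K + n)%N <= series (hypcoef a b c) K +
   2 / d * (K%:R * hypcoef a b c K - (K + n)%:R * hypcoef a b c (K + n)).
  elim: n => [|n IH]; first by rewrite addn0 subrr mulr0 !addr0.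
  rewrite addnS seriesSr; apply: (le_trans (lerD IH (h n))).
  by rewrite -addrA -mulrDr addrA subrK.
have nd : nondecreasing_seq (series (hypcoef a b c)).
  by apply/nondecreasing_seqP => m; rewrite seriesSr lerDl hypcoef_ge0.
apply: nondecreasing_is_cvgn => //.
exists (series (hypcoef a b c) K + 2 / d * (K%:R * hypcoef a b c K)) => _ [n _ <-].
apply: (@le_trans _ _ (series (hypcoef a b c) (K + n)%N)).
  by apply: nd; exact: leq_addl.
apply: (le_trans (bnd n)); rewrite lerD2l; apply: ler_wpM2l; first by rewrite divr_ge0// ltW.
by rewrite gerBl mulr_ge0// hypcoef_ge0.
Qed.

End gauss_sum.

Lemma cvg_hyp_one a b c : 0 < a -> 0 < b -> a + b < c ->
  series (hypcoef a b c) @ \oo --> hyp_one a b c.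
Proof. by move=> a0 b0 abc; exact: is_cvg_hyp_one. Qed.

(** The same identity for partial sums holds up to a multiple of n times the n-th
coefficient, which tends to 0. *)
Lemma hyp_one_step a b c : 0 < a -> 0 < b -> a + b < c ->
  c * (c - a - b) * hyp_one a b c = (c - a) * (c - b) * hyp_one a b (c + 1).
Proof.
move=> a0 b0 abc; have c0 : 0 < c by lra.
have abc1 : a + b < c + 1 by lra.
have h1 := cvg_hyp_one a0 b0 abc; have h2 := cvg_hyp_one a0 b0 abc1.
have h3 := cvg_mul_hypcoef a0 b0 abc.
have e n : (c - a) * (c - b) * series (hypcoef a b (c + 1)) n =
    c * (c - a - b) * series (hypcoef a b c) n + c * (n%:R * hypcoef a b c n).
  elim: n => [|n IH]; first by rewrite /series /= !big_geq// !mulr0 mul0r mulr0 addr0.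
  rewrite !seriesSr [LHS]mulrDr IH; have := hypcoef_telescope a b n c0.
  have := hypcoef_succ_c a b n c0.
  have cn : c + n%:R != 0 by rewrite gt_eqF// ltr_wpDr.
  move=> E1 E2; have {}E1 : hypcoef a b (c + 1) n = c * hypcoef a b c n / (c + n%:R).
    by rewrite -E1 mulfK.
  have {}E2 : n.+1%:R * hypcoef a b c n.+1 = n%:R * hypcoef a b c n -
    hypcoef a b c n * ((n%:R * (c - a - b) - a * b) / (c + n%:R)) by rewrite -E2; ring.
  by rewrite E1 E2; field.
have hl : (c - a) * (c - b) * series (hypcoef a b (c + 1)) n @[n --> \oo] -->
    (c - a) * (c - b) * hyp_one a b (c + 1) by apply: cvgM => //; exact: cvg_cst.
have hr : c * (c - a - b) * series (hypcoef a b c) n + c * (n%:R * hypcoef a b c n)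
    @[n --> \oo] --> c * (c - a - b) * hyp_one a b c + c * 0.
  by apply: cvgD; apply: cvgM => //; exact: cvg_cst.
rewrite -(cvg_lim _ hl)//; under eq_fun do rewrite e.
by rewrite (cvg_lim _ hr)// mulr0 addr0.
Qed.

Lemma hyp_one_iter a b c n : 0 < a -> 0 < b -> a + b < c ->
  hyp_one a b c = pochhammer (c - a) n * pochhammer (c - b) n /
   (pochhammer (c - a - b) n * pochhammer c n) * hyp_one a b (c + n%:R).
Proof.
move=> a0 b0 abc; have c0 : 0 < c by lra.
elim: n => [|n IH].
  by rewrite !pochhammer0 !mulr1 divr1 mul1r addr0.
rewrite {}IH !pochhammerS -natr1 addrA.
have cn : 0 < c + n%:R by rewrite ltr_wpDr.
have dn : 0 < c - a - b + n%:R by rewrite ltr_wpDr//; lra.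
have := @hyp_one_step a b (c + n%:R) a0 b0.
have abcn : a + b < c + n%:R by apply: lt_le_trans abc _; rewrite lerDl.
move=> /(_ abcn) E.
have {}E : hyp_one a b (c + n%:R) = (c + n%:R - a) * (c + n%:R - b) *
   hyp_one a b (c + n%:R + 1) / ((c + n%:R) * (c - a - b + n%:R)).
  rewrite -E; field; rewrite !gt_eqF//.
have p0 : 0 < pochhammer c n by rewrite pochhammer_gt0.
have p1 : 0 < pochhammer (c - a - b) n by rewrite pochhammer_gt0//; lra.
by rewrite E; field; rewrite !gt_eqF.
Qed.

Lemma hyp_one_ge1 a b c : 0 < a -> 0 < b -> a + b < c -> 1 <= hyp_one a b c.
Proof.
move=> a0 b0 abc; have c0 : 0 < c by lra.
have h := cvg_hyp_one a0 b0 abc.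
have -> : 1 = series (hypcoef a b c) 1 by rewrite /series /= big_nat1 hypcoef0.
apply: nondecreasing_cvgn_le; last by apply/cvg_ex; exists (hyp_one a b c).
by apply/nondecreasing_seqP => m; rewrite seriesSr lerDl hypcoef_ge0.
Qed.

(** From the first term on, raising c by n multiplies every term by at most
c / (c + n). *)
Lemma hyp_one_le a b c n : 0 < a -> 0 < b -> a + b < c ->
  hyp_one a b (c + n%:R) <= 1 + c / (c + n%:R) * (hyp_one a b c - 1).
Proof.
move=> a0 b0 abc; have c0 : 0 < c by lra.
have cn : 0 < c + n%:R by rewrite ltr_wpDr.
have abcn : a + b < c + n%:R by apply: lt_le_trans abc _; rewrite lerDl.
have h1 := cvg_hyp_one a0 b0 abc; have h2 := cvg_hyp_one a0 b0 abcn.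
have hr : 1 + c / (c + n%:R) * (series (hypcoef a b c) k - 1) @[k --> \oo] -->
   1 + c / (c + n%:R) * (hyp_one a b c - 1).
  apply: cvgD; first exact: cvg_cst.
  apply: cvgM; first exact: cvg_cst.
  by apply: cvgB => //; exact: cvg_cst.
rewrite -(cvg_lim _ hr)// {1}/hyp_one; apply: ler_lim.
- by apply/cvg_ex; eexists; exact: h2.
- by apply/cvg_ex; eexists; exact: hr.
exists 1%N => // -[//|k] _ /=; elim: k => [|k IH].
  by rewrite /series /= !big_nat1 !hypcoef0 subrr mulr0 addr0.
rewrite seriesSr [in leRHS]seriesSr.
suff : hypcoef a b (c + n%:R) k.+1 <= c / (c + n%:R) * hypcoef a b c k.+1 by lra.
rewrite /hypcoef !(pochhammerSl (c + _)) !(pochhammerSl c).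
have p1 : 0 < pochhammer (c + 1) k by apply: pochhammer_gt0; lra.
have p2 : 0 < pochhammer (c + n%:R + 1) k by apply: pochhammer_gt0; lra.
have p12 : pochhammer (c + 1) k <= pochhammer (c + n%:R + 1) k.
  apply: ler_prod => i _; rewrite addr_ge0 ?lerD2r ?lerDl//=; lra.
set P := pochhammer a _ * _; have P0 : 0 < P by rewrite mulr_gt0// pochhammer_gt0.
have f0 : 0 < (k.+1)`!%:R :> R by rewrite ltr0n fact_gt0.
rewrite [leLHS](_ : _ = P / (c + n%:R) / k.+1`!%:R * (pochhammer (c + n%:R + 1) k)^-1);
  last by field; rewrite !gt_eqF.
rewrite [leRHS](_ : _ = P / (c + n%:R) / k.+1`!%:R * (pochhammer (c + 1) k)^-1);
  last by field; rewrite !gt_eqF.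
apply: ler_wpM2l; last by rewrite lef_pV2.
by apply: divr_ge0; [apply: divr_ge0|]; exact: ltW.
Qed.

(** Shift c to infinity by hyp_one_step: the series tends to 1 and the product of
the factors met on the way tends to the Gamma quotient. *)
Theorem gauss_sum a b c : 0 < a -> 0 < b -> a + b < c ->
  hyp_one a b c = Gamma c * Gamma (c - a - b) / (Gamma (c - a) * Gamma (c - b)).
Proof.
move=> a0 b0 abc; have c0 : 0 < c by lra.
have x0 : 0 < c - a - b by lra.
have := cvg_pochhammer_balanced x0 b0 a0.
rewrite subrK (_ : c - a - b + a = c - b); last by ring.
rewrite (_ : c - a = c - a - b + b) ?subrK; last by ring.
move=> h.
have hT : hyp_one a b (c + n%:R) @[n --> \oo] --> (1 : R).
  rewrite -cvg_shiftS /=.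
  apply: (@squeeze_cvgr _ _ _ _ (cst 1) (fun n => 1 + c * harmonic n * (hyp_one a b c - 1))).
  - apply: nearW => n; apply/andP; split.
      by apply: hyp_one_ge1 => //; apply: lt_le_trans abc _; rewrite lerDl.
    apply: (le_trans (hyp_one_le _ a0 b0 abc)); rewrite lerD2l ler_wpM2r//.
      by rewrite subr_ge0 hyp_one_ge1.
    rewrite /harmonic /= ler_wpM2l ?(ltW c0)// lef_pV2 ?posrE ?addr_gt0//.
    by rewrite lerDr ltW.
  - exact: cvg_cst.
  - apply: (cvg_lim_eq (l := 1 + c * 0 * (hyp_one a b c - 1))).
      apply: cvgD; first exact: cvg_cst.
      apply: cvgM; last exact: cvg_cst.
      by apply: cvgM; [exact: cvg_cst|exact: cvg_harmonic].
    by rewrite mulr0 mul0r addr0.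
have hh : (pochhammer (c - a) n * pochhammer (c - b) n /
  (pochhammer (c - a - b) n * pochhammer c n)) * hyp_one a b (c + n%:R)
  @[n --> \oo] --> Gamma (c - a - b) * Gamma c / (Gamma (c - a) * Gamma (c - b)) * 1.
  exact: cvgM.
rewrite mulr1 in hh.
rewrite (mulrC (Gamma c)) -(cvg_lim _ hh)//; apply/esym/cvg_lim => //.
apply: cvg_near_cst; apply: nearW => n /=.
rewrite (hyp_one_iter n a0 b0 abc); congr (_ * _).
Qed.

Lemma cvg_hyp_right a b c : 0 < a -> 0 < b -> a + b < c ->
  hyp2F1 a b c (1 - x) @[x --> 0^'+] --> hyp_one a b c.
Proof.
move=> a0 b0 abc; have c0 : 0 < c by lra.
rewrite hyp2F1E; apply: abel_nonneg; last exact: is_cvg_hyp_one.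
by move=> k; exact: hypcoef_ge0.
Qed.

End gauss.

(** * The Gamma function on (-1, 0) *)

Section gamma_negative.
Context {R : realType}.

(** At the pole 0 both sides are 0. On (-1, 0) the continuation of Gamma takes
a single step. *)
Lemma Gamma_inv_rec (x : R) : -1 < x -> (Gamma x)^-1 = x * (Gamma (x + 1))^-1.
Proof.
move=> x1; have [x0|x0|<-] := ltgtP 0 x.
- by rewrite GammaS//; have := Gamma_gt0 x0 => ?; field; rewrite !gt_eqF.
- have e : Num.truncn (- x) = 0%N.
    by apply/eqP; rewrite truncn_eq; [apply/andP; split; lra|lra].
  rewrite {1}/Gamma ltNge (ltW x0) /= e big_ord1 /= addr0 invf_div Gamma_euler//; lra.
- by have := @Gamma_pole R 0; rewrite oppr0 => ->; rewrite invr0 mul0r.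
Qed.

End gamma_negative.

(** * Symmetries of the hypergeometric equation *)

Section solutions.
Context {R : realType}.
Implicit Types (a b c x : R) (g y : R -> R).

Lemma cvg_right_eq (f g : R -> R) (l : R) :
  (forall x, 0 < x < 1 -> f x = g x) -> f x @[x --> 0^'+] --> l ->
  g x @[x --> 0^'+] --> l.
Proof.
move=> fg; apply: cvg_trans; apply: near_eq_cvg; near=> x.
by apply: fg; near: x; exact: right_unit.
Unshelve. all: by end_near. Qed.

Lemma norm_lt1 x : 0 < x < 1 -> `|x| < 1.
Proof. by move=> /andP[x0 x1]; rewrite gtr0_norm. Qed.

Lemma hyp_sol_2F1 a b c : nonpole c -> hyp_sol a b c (hyp2F1 a b c) (hyp' a b c).
Proof.
move=> cn; exists (hyp'' a b c) => x /norm_lt1 x1.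
by split; [exact: is_derive_hyp|exact: is_derive_hyp'|exact: hyp_ode].
Qed.

(** The substitution x -> 1 - x exchanges the singular points 0 and 1. *)
Lemma hyp_sol_onem a b c y y' : hyp_sol a b c y y' ->
  hyp_sol a b (a + b + 1 - c) (fun x => y (1 - x)) (fun x => - y' (1 - x)).
Proof.
move=> [y'' hy]; exists (fun x => y'' (1 - x)) => x /andP[x0 x1].
have /hy[dy dy' o] : 0 < 1 - x < 1 by apply/andP; split; lra.
split.
- by apply: (derive_eq (derive_comp_fun (g := fun z => 1 - z) dy (derive_onem x))); ring.
- by apply: (derive_eq (deriveN_fun (derive_comp_fun (g := fun z => 1 - z) dy' (derive_onem x)))); ring.
- by rewrite -[RHS]o; ring.
Qed.

(** The factor x^(1 - c) exchanges the two exponents at 0. *)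
Lemma hyp_sol_powR a b c g g' :
  hyp_sol (a - c + 1) (b - c + 1) (2 - c) g g' ->
  hyp_sol a b c (fun x => x `^ (1 - c) * g x)
    (fun x => x `^ (- c) * ((1 - c) * g x + x * g' x)).
Proof.
move=> [g'' hg]; exists (fun x => x `^ (- c - 1) *
  (- c * ((1 - c) * g x + x * g' x) + x * ((2 - c) * g' x + x * g'' x))) => x x01.
have [dg dg' o] := hg x x01; have /andP[x0 x1] := x01.
have p1 := powR_pred (1 - c) x0; have p2 := powR_pred (- c) x0.
rewrite (_ : 1 - c - 1 = - c) in p1; last by ring.
split.
- apply: (derive_eq (deriveM_fun (derive_powR (1 - c) x0) dg)).
  rewrite -p1 (_ : 1 - c - 1 = - c); last by ring.
  by ring.
- apply: (derive_eq (deriveM_fun (derive_powR (- c) x0)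
    (deriveD_fun (deriveZ_fun (1 - c) dg) (deriveM_fun (is_derive_id x 1) dg')))).
  by rewrite -p2; ring.
- rewrite -p1 -p2; set X := x `^ _; rewrite -[RHS](mulr0 (X * x ^+ 2)) -o; ring.
Qed.

(** The factor (1 - x)^(c - a - b) exchanges the two exponents at 1. *)
Lemma hyp_sol_euler a b c g g' : hyp_sol (c - a) (c - b) c g g' ->
  hyp_sol a b c (fun x => (1 - x) `^ (c - a - b) * g x)
    (fun x => (1 - x) `^ (c - a - b - 1) * ((1 - x) * g' x - (c - a - b) * g x)).
Proof.
set e := c - a - b; move=> [g'' hg]; exists (fun x => (1 - x) `^ (e - 1 - 1) *
  (- (e - 1) * ((1 - x) * g' x - e * g x) +
   (1 - x) * ((1 - x) * g'' x - g' x - e * g' x))) => x x01.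
have [dg dg' o] := hg x x01; have /andP[x0 x1] := x01.
have ox0 : 0 < 1 - x by lra.
have p1 := powR_pred e ox0; have p2 := powR_pred (e - 1) ox0.
split.
- apply: (derive_eq (deriveM_fun (derive_powR_onem e x1) dg)).
  by rewrite -p1; ring.
- apply: (derive_eq (deriveM_fun (derive_powR_onem (e - 1) x1)
    (deriveB_fun (deriveM_fun (derive_onem x) dg') (deriveZ_fun e dg)))).
  by rewrite -p2; ring.
- rewrite -p1 -p2; set X := (1 - x) `^ _.
  by rewrite -[RHS](mulr0 (X * (1 - x) ^+ 2)) -o /e; ring.
Qed.

Lemma cvg_hyp_0 a b c : nonpole c -> hyp2F1 a b c x @[x --> 0^'+] --> (1 : R).
Proof.
move=> cn; rewrite -(hyp_at0 a b c).
by apply: right_limit (is_derive_hyp _ _ cn _); rewrite normr0.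
Qed.

Lemma cvg_hyp'_0 a b c : nonpole c -> hyp' a b c x @[x --> 0^'+] --> hyp' a b c 0.
Proof. by move=> cn; apply: right_limit (is_derive_hyp' _ _ cn _); rewrite normr0. Qed.

Lemma cvg_powR_mul a (f : R -> R) (l : R) : 0 < a -> f x @[x --> 0^'+] --> l ->
  x `^ a * f x @[x --> 0^'+] --> (0 : R).
Proof.
move=> a0 fl; apply: (cvg_lim_eq (l := 0 * l)); last by rewrite mul0r.
by apply: cvgM => //; exact: powR_cvg0.
Qed.

Lemma hyp_ge1 a b c x : 0 < a -> 0 < b -> 0 < c -> 0 < x < 1 -> 1 <= hyp2F1 a b c x.
Proof.
move=> a0 b0 c0 x01; have /andP[x0 _] := x01.
have -> : 1 = pseries (hypcoef a b c) x 1.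
  by rewrite /pseries /series /= big_nat1 hypcoef0 expr0 mulr1.
apply: psum_ge0_le_lim; [by move=> k; exact: hypcoef_ge0|exact: ltW|].
by apply: unit_cvg_hypcoef (norm_lt1 x01); exact: pos_nonpole.
Qed.

Lemma onem_powR_cvg1 (e : R) : (1 - x) `^ e @[x --> (0 : R)^'+] --> (1 : R).
Proof.
have := right_limit (derive_powR_onem e (@ltr01 R)).
by rewrite subr0 powR1.
Qed.

(** Both sides are solutions regular at 0 with the value 1 there. *)
Theorem euler_transformation a b c x : 0 < a -> 0 < b -> 0 < c -> 0 < x < 1 ->
  (1 - x) `^ (c - a - b) * hyp2F1 (c - a) (c - b) c x = hyp2F1 a b c x.
Proof.
move=> a0 b0 c0 x01; have cn := pos_nonpole c0; set e := c - a - b.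
have h := hyp_sol_unique (hyp_sol_euler (hyp_sol_2F1 (c - a) (c - b) cn))
   (hyp_sol_2F1 a b cn) (l := 1) (lu := 1).
rewrite (h _ _ _ _ _ _ x x01) ?divr1 ?mul1r//.
- apply: (cvg_lim_eq (l := 1 * 1)); last by rewrite mulr1.
  by apply: cvgM; [exact: onem_powR_cvg1|exact: cvg_hyp_0].
- apply: cvg_powR_mul => //; apply: cvgM; first exact: onem_powR_cvg1.
  apply: cvgB.
    by apply: cvgM; [exact: right_limit (derive_onem 0)|exact: cvg_hyp'_0].
  by apply: cvgM; [exact: cvg_cst|exact: cvg_hyp_0].
- exact: cvg_hyp_0.
- by apply: cvg_powR_mul => //; exact: cvg_hyp'_0.
- by move=> z z01; rewrite gt_eqF// (lt_le_trans ltr01)// hyp_ge1.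
Qed.

End solutions.

(** * The connection formula between 0 and 1 *)

Section connection.
Context {R : realType}.
Variables (a b h : R).
Hypotheses (a0 : 0 < a) (b0 : 0 < b) (h01 : 0 < h < 1).

Local Notation c := (a + b + 1 - h).

Let h0 : 0 < h. Proof. by case/andP: h01. Qed.
Let h1 : h < 1. Proof. by case/andP: h01. Qed.
Let c0 : 0 < c. Proof. by move: a0 b0 h1; lra. Qed.

(** Up to a factor the derivative is a 2F1 with c + 1 < (a + 1) + (b + 1), which
diverges at 1; Euler's transformation extracts the power of x and leaves a
series to which Gauss's formula applies. *)
Lemma cvg_hyp'_right :
  x `^ h * hyp' a b c (1 - x) @[x --> 0^'+] --> Gamma c * Gamma h / (Gamma a * Gamma b).
Proof.
have c10 : 0 < c + 1 by move: c0; lra.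
have ca0 : 0 < b + 1 - h by move: b0 h1; lra.
have cb0 : 0 < a + 1 - h by move: a0 h1; lra.
have cab : (b + 1 - h) + (a + 1 - h) < c + 1 by move: h0; lra.
have := @cvg_hyp_right R _ _ _ ca0 cb0 cab.
rewrite gauss_sum//.
rewrite (_ : c + 1 - (b + 1 - h) - (a + 1 - h) = h); last by ring.
rewrite (_ : c + 1 - (b + 1 - h) = a + 1); last by ring.
rewrite (_ : c + 1 - (a + 1 - h) = b + 1); last by ring.
rewrite !GammaS// => lim.
apply: (cvg_lim_eq (l := a * b / c * (c * Gamma c * Gamma h / (a * Gamma a * (b * Gamma b))))); last first.
  by field; rewrite !gt_eqF// Gamma_gt0.
apply: (@cvg_right_eq _ (fun x => a * b / c * hyp2F1 (b + 1 - h) (a + 1 - h) (c + 1) (1 - x))).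
  move=> x x01.
  have /andP[x0 x1] := x01.
  have ox01 : 0 < 1 - x < 1 by apply/andP; split; lra.
  rewrite [in RHS]hyp'E ?norm_lt1//; last exact: pos_nonpole.
  rewrite -(@euler_transformation _ (a + 1))//; [|by move: a0; lra|by move: b0; lra].
  rewrite (_ : c + 1 - (a + 1) - (b + 1) = - h); last by ring.
  rewrite (_ : c + 1 - (a + 1) = b + 1 - h); last by ring.
  rewrite (_ : c + 1 - (b + 1) = a + 1 - h); last by ring.
  rewrite (_ : 1 - (1 - x) = x); last by ring.
  rewrite [RHS](_ : _ = (x `^ h * x `^ (- h)) * (a * b / c * hyp2F1 (b + 1 - h) (a + 1 - h) (c + 1) (1 - x))); last by ring.
  by rewrite powRN divff ?mul1r// gt_eqF// powR_gt0.
by apply: cvgM => //; exact: cvg_cst.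
Qed.

Let F1 := Gamma c * Gamma (1 - h) / (Gamma (b + 1 - h) * Gamma (a + 1 - h)).
Let L := Gamma c * Gamma h / (Gamma a * Gamma b).

(** As a function of x, the left-hand side solves the hypergeometric equation with
parameters a, b, h. Its coefficients in the basis of local solutions at 0 are
given by Gauss's formula for 2F1 and for its derivative. *)
Theorem hyp_connection x : 0 < x < 1 ->
  hyp2F1 a b c (1 - x) = F1 * hyp2F1 a b h x -
   L / (1 - h) * (x `^ (1 - h) * hyp2F1 (a - h + 1) (b - h + 1) (2 - h) x).
Proof.
move=> x01.
have cn := pos_nonpole c0; have hn := pos_nonpole h0.
have h2n : nonpole (2 - h) by apply: pos_nonpole; move: h1; lra.
have oh : 0 < 1 - h by move: h1; lra.
have sy := hyp_sol_onem (hyp_sol_2F1 a b cn).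
rewrite (_ : a + b + 1 - c = h) in sy; last by ring.
have su := hyp_sol_2F1 a b hn.
have sv := hyp_sol_powR (hyp_sol_2F1 (a - h + 1) (b - h + 1) h2n).
have h1' : h != 1 by rewrite lt_eqF.
have := @hyp_sol_connection _ _ _ _ _ _ _ _ _ _ F1 (- L) h1' sy su sv.
move=> ->//.
- by rewrite mulNr mulNr.
- have abc : a + b < c by move: oh; lra.
  have := @cvg_hyp_right R _ _ _ a0 b0 abc; rewrite gauss_sum//.
  rewrite (_ : c - a - b = 1 - h); last by ring.
  rewrite (_ : c - a = b + 1 - h); last by ring.
  by rewrite (_ : c - b = a + 1 - h); last by ring.
- apply: (@cvg_right_eq _ (fun z => - (z `^ h * hyp' a b c (1 - z)))).
    by move=> z _; rewrite mulrN.
  by apply: cvgN; exact: cvg_hyp'_right.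
- exact: cvg_hyp_0.
- by apply: cvg_powR_mul => //; exact: cvg_hyp'_0.
- by apply: cvg_powR_mul => //; exact: cvg_hyp_0.
- apply: (cvg_lim_eq (l := (1 - h) * 1 + 0 * hyp' (a - h + 1) (b - h + 1) (2 - h) 0)); last by ring.
  apply: (@cvg_right_eq _ (fun z => (1 - h) * hyp2F1 (a - h + 1) (b - h + 1) (2 - h) z +
     z * hyp' (a - h + 1) (b - h + 1) (2 - h) z)).
    move=> z /andP[z0 _]; rewrite mulrA powRN divff ?mul1r// gt_eqF// powR_gt0//.
  apply: cvgD; apply: cvgM.
  - exact: cvg_cst.
  - exact: cvg_hyp_0.
  - exact: (@right_limit R id 0 1 (is_derive_id _ _)).
  - exact: cvg_hyp'_0.
Qed.

End connection.

(** * Two contiguous relations *)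

Section contiguous.
Context {R : realType}.
Variables (a b h n : R).
Hypotheses (h01 : 0 < h < 1) (nE : n * h = a * b).

Let h0 : 0 < h. Proof. by case/andP: h01. Qed.
Let h1 : h < 1. Proof. by case/andP: h01. Qed.

(** Compare coefficients. The constant term vanishes because n h = a b. *)
Lemma contiguous_regular x : `|x| < 1 ->
  n * hyp2F1 a b h x - (1 - x) * hyp' a b h x =
  n * (a - h) * (b - h) / (h * (h + 1)) * (x * hyp2F1 (a + 1) (b + 1) (h + 2) x).
Proof.
move=> x1; have hn := pos_nonpole h0.
have h2n : nonpole (h + 2) by apply: pos_nonpole; move: h0; lra.
set K := n * _ * _ / _.
have c0 := cvg_psum (unit_cvg_hypcoef (a := a) (b := b) hn) x1.
have c1 := cvg_psum (unit_cvg_diffs (a := a) (b := b) hn) x1.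
have c2 := cvg_psum_shift (cvg_psum (unit_cvg_hypcoef (a := a + 1) (b := b + 1) h2n) x1).
have := cvg_psumD (cvg_psumD (cvg_psumZ n c0) (cvg_psumZ (- K) c2))
  (cvg_psumD (cvg_psumZ (-1) c1) (cvg_psum_shift c1)).
rewrite (_ : (fun i : nat => _) = (fun=> 0)); last first.
  apply/funext => -[|k]; rewrite /= /pseries_diffs.
    rewrite hypcoef0; have := hypcoefS a b 0 hn; rewrite hypcoef0 !addr0 !mulr1 => E.
    apply: (mulIf (lt0r_neq0 h0)); rewrite mul0r.
    transitivity (n * h - hypcoef a b h 1 * h); first by ring.
    by rewrite nE E; ring.
  have E1 : hypcoef a b h k.+1 * (h * (h + 1) * k.+1%:R) =
            a * b * (h + k.+1%:R) * hypcoef (a + 1) (b + 1) (h + 2) k.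
    rewrite /hypcoef !(pochhammerSl a) !(pochhammerSl b) factS natrM.
    have E : pochhammer h k.+1 * (h + k.+1%:R) = h * ((h + 1) * pochhammer (h + 2) k).
      rewrite -pochhammerS pochhammerSl pochhammerSl.
      by rewrite (_ : h + 1 + 1 = h + 2)//; ring.
    have p1 := pochhammer_neq0 k.+1 hn; have p2 := pochhammer_neq0 k h2n.
    have nf := @natfact_neq0 R k; have k0 : k.+1%:R != 0 :> R by rewrite pnatr_eq0.
    apply: (@mulIf _ (pochhammer h k.+1)) => //.
    rewrite [RHS](_ : _ = a * b * pochhammer (a + 1) k * pochhammer (b + 1) k /
      (pochhammer (h + 2) k * k`!%:R) * (pochhammer h k.+1 * (h + k.+1%:R))).
      by rewrite E; field; do ?[apply/andP; split].
    by field; do ?[apply/andP; split].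
  have E2 := hypcoefS a b k.+1 hn.
  have hk : h + k.+1%:R != 0 by exact: hn.
  have k0 : k.+1%:R != 0 :> R by rewrite pnatr_eq0.
  have hh : h * (h + 1) != 0 by rewrite mulf_neq0 ?gt_eqF//; move: h0; lra.
  move: E1 E2; set f1 := hypcoef a b h k.+1; set f2 := hypcoef a b h k.+2.
  set G := hypcoef _ _ (h + 2) k => E1 E2.
  have {}E1 : f1 = a * b * (h + k.+1%:R) * G / (h * (h + 1) * k.+1%:R).
    by rewrite -E1 mulfK// mulf_neq0.
  have {}E2 : k.+2%:R * f2 = (a + k.+1%:R) * (b + k.+1%:R) * f1 / (h + k.+1%:R).
    by apply: (mulIf hk); rewrite divfK// -E2; ring.
  rewrite E2 E1 /K (_ : n = a * b / h); last by rewrite -nE mulfK// gt_eqF.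
  rewrite -!natr1 in k0 hk *.
  by field; move: hh; rewrite mulf_eq0 => /norP[? ?]; do ?[apply/andP; split].
move=> H; have := psum0 x; rewrite /psum (cvg_lim _ H)// -/(psum _ x) -/(psum _ x).
rewrite !hyp2F1E /hyp' => E; apply/eqP; rewrite -subr_eq0 -[X in _ == X]E.
by apply/eqP; ring.
Qed.

(** Compare coefficients. The inner bracket is the derivative of x^(1 - h) g (x),
for g = 2F1 (a - h + 1, b - h + 1; 2 - h; x), with the power x^(- h) removed. *)
Lemma contiguous_singular x : `|x| < 1 ->
  n * x * hyp2F1 (a - h + 1) (b - h + 1) (2 - h) x -
  (1 - x) * ((1 - h) * hyp2F1 (a - h + 1) (b - h + 1) (2 - h) x +
             x * hyp' (a - h + 1) (b - h + 1) (2 - h) x) =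
  - (1 - h) * hyp2F1 (a - h) (b - h) (- h) x.
Proof.
move=> x1.
have mhn : nonpole (- h).
  case=> [|k]; first by rewrite addr0 oppr_eq0 gt_eqF.
  by rewrite gt_eqF// -natr1; have := ler0n R k; move: h1; lra.
have h2n : nonpole (2 - h) by apply: pos_nonpole; move: h1; lra.
set a' := a - h; set b' := b - h.
have c0 := cvg_psum (unit_cvg_hypcoef (a := a' + 1) (b := b' + 1) h2n) x1.
have c1 := cvg_psum (unit_cvg_diffs (a := a' + 1) (b := b' + 1) h2n) x1.
have s0 := cvg_psum_shift c0; have s1 := cvg_psum_shift c1; have ss1 := cvg_psum_shift s1.
have c2 := cvg_psum (unit_cvg_hypcoef (a := a') (b := b') mhn) x1.
have := cvg_psumD (cvg_psumD (cvg_psumZ (n + (1 - h)) s0) (cvg_psumZ (1 - h) c2))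
  (cvg_psumD (cvg_psumZ (- (1 - h)) c0) (cvg_psumD (cvg_psumZ (-1) s1) ss1)).
rewrite (_ : (fun i : nat => _) = (fun=> 0)); last first.
  apply/funext => -[|k]; rewrite /= /pseries_diffs; first by rewrite !hypcoef0; ring.
  rewrite (_ : shift _ k = k%:R * hypcoef (a' + 1) (b' + 1) (2 - h) k); last first.
    by case: k => [|k] //=; rewrite mul0r.
  have oh : 1 - h != 0 by rewrite gt_eqF//; move: h1; lra.
  have nh : h != 0 by rewrite gt_eqF.
  have k0 : k.+1%:R != 0 :> R by rewrite pnatr_eq0.
  have E1 : hypcoef a' b' (- h) k.+1 * (- h * (1 - h) * k.+1%:R) =
            a' * b' * (1 - h + k%:R) * hypcoef (a' + 1) (b' + 1) (2 - h) k.
    rewrite /hypcoef !(pochhammerSl a') !(pochhammerSl b') factS natrM.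
    have E : pochhammer (- h) k.+1 * (1 - h + k%:R) = - h * ((1 - h) * pochhammer (2 - h) k).
      rewrite pochhammerSl (_ : - h + 1 = 1 - h); last by ring.
      by rewrite -mulrA -pochhammerS pochhammerSl (_ : 1 - h + 1 = 2 - h)//; ring.
    have p1 := pochhammer_neq0 k.+1 mhn; have p2 := pochhammer_neq0 k h2n.
    have nf := @natfact_neq0 R k.
    apply: (@mulIf _ (pochhammer (- h) k.+1)) => //.
    rewrite [RHS](_ : _ = a' * b' * pochhammer (a' + 1) k * pochhammer (b' + 1) k /
      (pochhammer (2 - h) k * k`!%:R) * (pochhammer (- h) k.+1 * (1 - h + k%:R))).
      by rewrite E; field; do ?[apply/andP; split].
    by field; do ?[apply/andP; split].
  have E2 := hypcoefS (a' + 1) (b' + 1) k h2n.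
  have hk := h2n k.
  move: E1 E2; set g1 := hypcoef _ _ (2 - h) k; set g2 := hypcoef _ _ (2 - h) k.+1.
  set p := hypcoef _ _ (- h) k.+1 => E1 E2.
  have {}E1 : p = a' * b' * (1 - h + k%:R) * g1 / (- h * (1 - h) * k.+1%:R).
    by rewrite -E1 mulfK// !mulf_neq0// oppr_eq0.
  have {}E2 : g2 = (a' + 1 + k%:R) * (b' + 1 + k%:R) * g1 / ((2 - h + k%:R) * k.+1%:R).
    by rewrite -E2; field; apply/andP.
  rewrite E2 E1 /a' /b' (_ : n = a * b / h); last by rewrite -nE mulfK.
  rewrite -!natr1 in k0 *.
  by field; do ?[apply/andP; split].
move=> H; have := psum0 x; rewrite /psum (cvg_lim _ H)// -/(psum _ x) -/(psum _ x).
rewrite !hyp2F1E /hyp' => E; apply/eqP; rewrite -subr_eq0 -[X in _ == X]E.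
by apply/eqP; ring.
Qed.

End contiguous.

(** * The survival function and its derivative *)

Section survival.
Context {R : realType}.
Variables (a b h : R).
Hypotheses (a0 : 0 < a) (b0 : 0 < b) (h01 : 0 < h < 1).

Local Notation c := (a + b + 1 - h).
Local Notation n := (a * b / h).

Let h0 : 0 < h. Proof. by case/andP: h01. Qed.
Let h1 : h < 1. Proof. by case/andP: h01. Qed.
Let c0 : 0 < c. Proof. by move: a0 b0 h1; lra. Qed.
Let n0 : 0 < n. Proof. by rewrite divr_gt0// mulr_gt0. Qed.
Let cn : nonpole c. Proof. exact: pos_nonpole. Qed.

(** The value 2F1 (a, b; a + b + 1 - h; 1) according to gauss_sum. *)
Definition gauss_value : R :=
  Gamma c * Gamma (1 - h) / (Gamma (b + 1 - h) * Gamma (a + 1 - h)).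
Definition survival (x : R) : R :=
  (1 - x) `^ n * hyp2F1 a b c (1 - x) / gauss_value.
Definition survival_density (x : R) : R :=
  (1 - x) `^ (n - 1) *
  (n * hyp2F1 a b c (1 - x) + (1 - x) * hyp' a b c (1 - x)) / gauss_value.

Lemma gauss_value_gt0 : 0 < gauss_value.
Proof.
by apply: divr_gt0; apply: mulr_gt0; apply: Gamma_gt0; move: a0 b0 h0 h1; lra.
Qed.

Lemma cvg_hyp_gauss : hyp2F1 a b c (1 - x) @[x --> 0^'+] --> gauss_value.
Proof.
have abc : a + b < c by move: h1; lra.
have := @cvg_hyp_right R _ _ _ a0 b0 abc; rewrite gauss_sum// /gauss_value.
rewrite (_ : c - a - b = 1 - h); last by ring.
rewrite (_ : c - a = b + 1 - h); last by ring.
by rewrite (_ : c - b = a + 1 - h); last by ring.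
Qed.

Lemma cvg_survival_0 : survival x @[x --> 0^'+] --> (1 : R).
Proof.
have g0 := lt0r_neq0 gauss_value_gt0.
apply: (cvg_lim_eq (l := 1 * gauss_value / gauss_value)); last first.
  by rewrite mul1r divff.
apply: cvgM; last exact: cvg_cst.
by apply: cvgM; [exact: onem_powR_cvg1|exact: cvg_hyp_gauss].
Qed.

Lemma cvg_survival_1 : survival (1 - x) @[x --> 0^'+] --> (0 : R).
Proof.
apply: (@cvg_right_eq _ (fun x => x `^ n * hyp2F1 a b c x / gauss_value)).
  by move=> x _; rewrite /survival (_ : 1 - (1 - x) = x)//; ring.
apply: (cvg_lim_eq (l := 0 / gauss_value)); last by rewrite mul0r.
apply: cvgM; last exact: cvg_cst.
by apply: cvg_powR_mul; [exact: n0|exact: cvg_hyp_0].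
Qed.

Let onem01 (x : R) : 0 < x < 1 -> 0 < 1 - x < 1.
Proof. by move=> /andP[? ?]; apply/andP; split; lra. Qed.

Let derive_F (x : R) : 0 < x < 1 ->
  is_derive x 1 (fun z : R => hyp2F1 a b c (1 - z)) (- hyp' a b c (1 - x)).
Proof.
move=> /onem01/norm_lt1 x1.
apply: (derive_eq (derive_comp_fun (g := fun z => 1 - z)
  (is_derive_hyp _ _ cn x1) (derive_onem x))); ring.
Qed.

Let derive_F' (x : R) : 0 < x < 1 ->
  is_derive x 1 (fun z : R => hyp' a b c (1 - z)) (- hyp'' a b c (1 - x)).
Proof.
move=> /onem01/norm_lt1 x1.
apply: (derive_eq (derive_comp_fun (g := fun z => 1 - z)
  (is_derive_hyp' _ _ cn x1) (derive_onem x))); ring.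
Qed.

Lemma derive_survival (x : R) : 0 < x < 1 ->
  is_derive x 1 survival (- survival_density x).
Proof.
move=> x01; have /andP[x0 x1] := x01.
have p : (1 - x) * (1 - x) `^ (n - 1) = (1 - x) `^ n.
  by apply: powR_pred; rewrite subr_gt0.
apply: (derive_eq (deriveM_fun (deriveM_fun (derive_powR_onem n x1) (derive_F x01))
  (is_derive_cst (gauss_value^-1) x 1))).
by rewrite /survival_density -p /cst; ring.
Qed.

Lemma survival_density_ge0 (x : R) : 0 < x < 1 -> 0 <= survival_density x.
Proof.
move=> x01; have o01 := onem01 x01; have /andP[ox0 ox1] := o01.
rewrite /survival_density divr_ge0 ?(ltW gauss_value_gt0)//.
rewrite mulr_ge0 ?powR_ge0// addr_ge0//.
  by rewrite mulr_ge0 ?(ltW n0)// (le_trans ler01)// hyp_ge1.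
rewrite hyp'E ?norm_lt1// !mulr_ge0 ?(ltW ox0) ?(ltW a0) ?(ltW b0) ?invr_ge0 ?(ltW c0)//.
apply: (le_trans ler01); apply: hyp_ge1 => //; exact: addr_gt0.
Qed.

Lemma survival_density_continuous (x : R) : 0 < x < 1 ->
  {for x, continuous survival_density}.
Proof.
move=> x01; have /andP[x0 x1] := x01.
exact: (derive_continuous (deriveM_fun (deriveM_fun (derive_powR_onem (n - 1) x1)
  (deriveD_fun (deriveZ_fun n (derive_F x01))
    (deriveM_fun (derive_onem x) (derive_F' x01))))
  (is_derive_cst (gauss_value^-1) x 1))).
Qed.

Let L := Gamma c * Gamma h / (Gamma a * Gamma b).

(** The derivative of the connection formula. *)
Lemma hyp'_connection (x : R) : 0 < x < 1 ->
  - hyp' a b c (1 - x) = gauss_value * hyp' a b h x -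
   L / (1 - h) * ((1 - h) * x `^ (- h) * hyp2F1 (a - h + 1) (b - h + 1) (2 - h) x
     + x `^ (1 - h) * hyp' (a - h + 1) (b - h + 1) (2 - h) x).
Proof.
move=> x01; have /andP[x0 x1] := x01; have xn := norm_lt1 x01.
have hn := pos_nonpole h0.
have h2n : nonpole (2 - h) by apply: pos_nonpole; move: h1; lra.
have D1 := derive_F x01.
have D2 := deriveB_fun (deriveZ_fun gauss_value (is_derive_hyp a b hn xn))
  (deriveZ_fun (L / (1 - h)) (deriveM_fun (derive_powR (1 - h) x0)
   (is_derive_hyp (a - h + 1) (b - h + 1) h2n xn))).
have E : {near x, (fun z : R => hyp2F1 a b c (1 - z)) =1
  (fun z => gauss_value * hyp2F1 a b h z -
   L / (1 - h) * (z `^ (1 - h) * hyp2F1 (a - h + 1) (b - h + 1) (2 - h) z))}.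
  near=> z; apply: (hyp_connection a0 b0 h01).
  by apply/andP; split; near: z; [exact: lt_nbhsr|exact: lt_nbhsl].
have D3 := near_eq_is_derive E D1.
rewrite -[LHS](@derive_val _ _ _ _ _ _ _ D3) (@derive_val _ _ _ _ _ _ _ D2).
by rewrite (_ : 1 - h - 1 = - h)//; ring.
Unshelve. all: by end_near. Qed.

(** The derivative of the connection formula brings in both local solutions at 0
and their derivatives; each pair reduces to one function by a contiguous
relation. *)
Theorem survival_densityE (x : R) : 0 < x < 1 -> survival_density x =
  (1 - x) `^ (n - 1) *
  (n * (a - h) * (b - h) / (h * (h + 1)) *
     (x * hyp2F1 (a + 1) (b + 1) (h + 2) x) +
   L / gauss_value * (x `^ (- h) * hyp2F1 (a - h) (b - h) (- h) x)).
Proof.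
move=> x01; have /andP[x0 x1] := x01; have xn := norm_lt1 x01.
have nE : n * h = a * b by rewrite divfK// gt_eqF.
have g0 := lt0r_neq0 gauss_value_gt0.
have oh : 1 - h != 0 by rewrite gt_eqF//; move: h1; lra.
have C1 := contiguous_regular h01 nE xn; have C2 := contiguous_singular h01 nE xn.
have F := hyp_connection a0 b0 h01 x01; have F' := hyp'_connection x01.
have p : x `^ (1 - h) = x * x `^ (- h).
  by rewrite -(powR_pred (1 - h) x0) (_ : 1 - h - 1 = - h)//; ring.
rewrite /survival_density F -[hyp' a b c _]opprK F' -/gauss_value -/L -C1 p.
have -> : hyp2F1 (a - h) (b - h) (- h) x = - (n * x * hyp2F1 (a - h + 1) (b - h + 1) (2 - h) x -
  (1 - x) * ((1 - h) * hyp2F1 (a - h + 1) (b - h + 1) (2 - h) x +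
             x * hyp' (a - h + 1) (b - h + 1) (2 - h) x)) / (1 - h).
  by rewrite C2; field.
move: g0; set g := gauss_value => g0; move: F F' C1 C2 p => _ _ _ _ _.
set l := L; set N := n.
by field; apply/andP.
Qed.

End survival.

(** * Lebesgue measure on tuples *)

Section tuple_measure.
Context {R : realType}.
Local Notation leb := (@lebesgue_measure R).

Definition box n (A : 'I_n -> set R) : set (n.-tuple R) :=
  [set x | forall i, A i (tnth x i)].

Lemma measurable_box n (A : 'I_n -> set R) :
  (forall i, measurable (A i)) -> measurable (box A).
Proof.
move=> mA; rewrite (_ : box A = \bigcap_(i in [set: 'I_n])
    ((fun x : n.-tuple R => tnth x i) @^-1` A i)).
  apply: fin_bigcap_measurable => [|i _]; first exact: finite_finset.
  by rewrite -[X in measurable X]setTI; exact: measurable_tnth.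
by apply/seteqP; split=> x /= Ax i; [move=> _|]; exact: Ax.
Qed.

(** Boxes generate the product sigma-algebra and are closed under
intersection. *)
Lemma lebesgue_tuple_unique n (nu : {measure set (n.-tuple R) -> \bar R}) :
  (forall A : 'I_n -> set R, (forall i, measurable (A i)) ->
     nu (box A) = (\prod_(i < n) leb (A i))%E) ->
  forall B, measurable B -> lebesgue_tuple n B = nu B.
Proof.
move=> nuE.
pose G := [set box A | A in [set A : 'I_n -> set R | forall i, measurable (A i)]].
pose g (k : nat) : set (n.-tuple R) := box (fun _ => `[- k%:R, k%:R]%classic).
apply: (@measure_unique _ R _ G g).
- rewrite eqEsubset; split.
    apply: smallest_sub; first exact: smallest_sigma_algebra.
    rewrite -bigcup_seq => _ [i _] [Y mY <-]; apply: sub_sigma_algebra.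
    exists (fun j => if j == i then Y else setT) => [j /=|].
      by case: ifP.
    apply/seteqP; split => x /=; first by move=> /(_ i); rewrite eqxx.
    by move=> [_ xY] j; case: eqP => [->|].
  apply: smallest_sub; first exact: sigma_algebra_measurable.
  by move=> _ [A mA <-]; exact: measurable_box.
- move=> _ _ [A mA <-] [B mB <-]; exists (fun i => A i `&` B i) => [i|].
    exact: measurableI.
  apply/seteqP; split => x /=; first by move=> h; split => i; have [] := h i.
  by move=> [Ax Bx] i.
- by move=> k; exists (fun _ => `[- k%:R, k%:R]%classic).
- apply/seteqP; split=> // x _.
  pose k := \max_(i < n) (Num.truncn `|tnth x i|).+1.
  exists k => // i /=; rewrite in_itv /= -ler_norml.
  apply: (le_trans (ltW (truncnS_gt _))); rewrite ler_nat.
  exact: (leq_bigmax i).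
- by move=> _ [A mA <-]; rewrite nuE// -lebesgue_tuple_box.
- move=> k; have E := @lebesgue_tuple_box R n (fun _ => `[- k%:R, k%:R]%classic) (fun _ => measurable_itv _).
  rewrite [X in (X < _)%E]E.
  suff /andP[_ ->//] : (0 <= \prod_(i < n) leb (`[- k%:R, k%:R]%classic)%R < +oo)%E.
  apply: (big_ind (fun y : \bar R => (0 <= y < +oo)%E)) => [|x y|i _].
  + by rewrite ltry lee_fin ler01.
  + move=> /andP[x0 xo] /andP[y0 yo]; rewrite mule_ge0//=.
    by rewrite lte_mul_pinfty// ge0_fin_numE.
  + rewrite measure_ge0 /= lebesgue_measure_itv /=.
    by case: ifP => _; rewrite -?EFinB ltry.
Qed.

Definition permute_tuple n (s : {perm 'I_n}) (x : n.-tuple R) : n.-tuple R :=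
  [tuple tnth x (s i) | i < n].

Lemma tnth_permute n (s : {perm 'I_n}) (x : n.-tuple R) i :
  tnth (permute_tuple s x) i = tnth x (s i).
Proof. by rewrite tnth_mktuple. Qed.

Lemma measurable_permute n (s : {perm 'I_n}) : measurable_fun setT (permute_tuple s).
Proof.
apply/measurable_fun_tnthP => i; rewrite (_ : _ \o _ = fun x => tnth x (s i)).
  exact: measurable_tnth.
by apply/funext => x; rewrite /= tnth_permute.
Qed.

Lemma lebesgue_tuple_permute n (s : {perm 'I_n}) B : measurable B ->
  lebesgue_tuple n (permute_tuple s @^-1` B) = lebesgue_tuple n B.
Proof.
move=> mB; have mp := measurable_permute s.
suff : lebesgue_tuple n B = pushforward (lebesgue_tuple n) (permute_tuple s) B by move->.
apply: lebesgue_tuple_unique => // A mA; rewrite /= /pushforward.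
rewrite [X in lebesgue_tuple n X](_ : _ = [set x | forall i, A ((s^-1)%g i) (tnth x i)]).
  rewrite (lebesgue_tuple_box (A := fun i => A ((s^-1)%g i)))//; apply/esym.
  by rewrite (reindex_inj (@perm_inj _ (s^-1)%g)).
apply/seteqP; split => x /= h i; rewrite ?tnth_permute.
  by have := h ((s^-1)%g i); rewrite tnth_permute permKV.
by have := h (s i); rewrite permK.
Qed.

(** With this symmetry, an integration by parts in the first coordinate is enough
for all coordinates. *)
Lemma integral_permute n (s : {perm 'I_n}) (D : set (n.-tuple R))
    (f : n.-tuple R -> R) : measurable D -> permute_tuple s @^-1` D = D ->
  measurable_fun D f -> (lebesgue_tuple n).-integrable D (EFin \o (f \o permute_tuple s)) ->
  (\int[lebesgue_tuple n]_(x in D) (f (permute_tuple s x))%:E =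
   \int[lebesgue_tuple n]_(x in D) (f x)%:E)%E.
Proof.
move=> mD DD mf intf; have mp := measurable_permute s.
pose g := f \_ D.
have mg : measurable_fun setT g by exact/(measurable_restrictT _ _).1.
transitivity (\int[lebesgue_tuple n]_(x in permute_tuple s @^-1` D) ((EFin \o g) \o permute_tuple s) x)%E.
  rewrite DD; apply: eq_integral => x; rewrite -{1}DD inE /= => xD.
  by rewrite /g patchE mem_set.
rewrite -(integral_pushforward mp)//=.
- rewrite (eq_measure_integral (lebesgue_tuple n)); last first.
    by move=> A mA _; exact: lebesgue_tuple_permute.
  by apply: eq_integral => x xD; rewrite /g patchE xD.
- exact/measurable_EFinP.
- rewrite DD; apply: eq_integrable intf => // x; rewrite -{1}DD inE /= => xD.
  by rewrite /g patchE mem_set.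
Qed.

Definition affine_tuple n (s : R) (x : n.-tuple R) : n.-tuple R :=
  [tuple 1 - s * tnth x i | i < n].

Lemma tnth_affine n s (x : n.-tuple R) i :
  tnth (affine_tuple s x) i = 1 - s * tnth x i.
Proof. by rewrite tnth_mktuple. Qed.

Lemma measurable_affine1 (s : R) : measurable_fun setT (fun x : R => 1 - s * x).
Proof. by apply: measurable_funB => //; apply: measurable_funM. Qed.

Lemma measurable_affine n (s : R) : measurable_fun setT (@affine_tuple n s).
Proof.
apply/measurable_fun_tnthP => i.
rewrite (_ : _ \o _ = (fun x : R => 1 - s * x) \o (fun x => tnth x i)).
  apply: measurableT_comp; first exact: measurable_affine1.
  exact: measurable_tnth.
by apply/funext => x; rewrite /= tnth_affine.
Qed.

Lemma lebesgue_affine1 (s : R) (A : set R) : 0 < s -> measurable A ->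
  (s%:E * leb ((fun x => 1 - s * x)%R @^-1` A) = leb A)%E.
Proof.
move=> s0 mA; have mp := measurable_affine1 s; apply/esym.
suff : leb A = pushforward (mscale (NngNum (ltW s0)) leb) (fun x : R => (1 - s * x : measurableTypeR R)) A by move->.
apply: lebesgue_measure_unique => //= _ [[u v] _ <-] /=; rewrite /= /pushforward /mscale /=.
rewrite [X in (_ * leb X)%E](_ : _ = `[(1 - v) / s, (1 - u) / s[%classic).
  rewrite !lebesgue_measure_itv /= !lte_fin ltr_pM2r ?invr_gt0// ltrD2l ltrN2.
  case: ifP => // _; last by rewrite mule0.
  by rewrite -!EFinB -EFinM; congr (_%:E); field; rewrite gt_eqF.
apply/seteqP; split => x /=; rewrite !in_itv /= => /andP[h1 h2]; apply/andP.
  by rewrite ler_pdivrMr// ltr_pdivlMr//; split; rewrite mulrC; lra.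
by move: h1 h2; rewrite ler_pdivrMr// ltr_pdivlMr// (mulrC x); split; lra.
Qed.

Lemma lebesgue_tuple_affine n (s : R) B : 0 < s -> measurable B ->
  ((s ^+ n)%:E * lebesgue_tuple n (affine_tuple s @^-1` B) = lebesgue_tuple n B)%E.
Proof.
move=> s0 mB; have mp := @measurable_affine n s; apply/esym.
suff : lebesgue_tuple n B = pushforward
    (mscale (NngNum (exprn_ge0 n (ltW s0))) (lebesgue_tuple n)) (@affine_tuple n s) B by move->.
apply: lebesgue_tuple_unique => //= A mA; rewrite /= /pushforward /mscale /=.
rewrite [X in lebesgue_tuple n X](_ : _ = [set x | forall i, ((fun x => 1 - s * x) @^-1` A i) (tnth x i)]).
  rewrite (lebesgue_tuple_box (A := fun i => (fun x => 1 - s * x) @^-1` A i)); last first.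
    by move=> i; rewrite -[X in measurable X]setTI; exact: measurable_affine1.
  rewrite [RHS](eq_bigr (fun i => (s%:E * leb ((fun x => 1 - s * x)%R @^-1` A i))%E)); last first.
    by move=> i _; rewrite lebesgue_affine1.
  rewrite big_split /= prodEFin prodr_const card_ord //.
by apply/seteqP; split => x /= h i; have := h i; rewrite tnth_affine.
Qed.

Lemma ge0_integral_affine n (s : R) (D : set (n.-tuple R)) (f : n.-tuple R -> \bar R) :
  0 < s -> measurable D -> measurable_fun D f -> (forall x, D x -> (0 <= f x)%E) ->
  (\int[lebesgue_tuple n]_(x in D) f x =
   (s ^+ n)%:E * \int[lebesgue_tuple n]_(x in affine_tuple s @^-1` D) f (affine_tuple s x))%E.
Proof.
move=> s0 mD mf f0; have mp := @measurable_affine n s.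
have mfD : measurable (affine_tuple s @^-1` D).
  by rewrite -[X in measurable X]setTI; exact: mp.
have mfa : measurable_fun (affine_tuple s @^-1` D) (f \o affine_tuple s).
  by apply: (measurable_comp mD) => //; [move=> _ [x Dx <-]|exact: measurable_funTS].
rewrite -(ge0_integral_mscale _ mfD (NngNum (exprn_ge0 n (ltW s0))))//; last first.
  by move=> x; exact: f0.
rewrite -(ge0_integral_pushforward mp)//; last by move=> x; rewrite inE; exact: f0.
by apply: eq_measure_integral => A mA _; apply/esym/lebesgue_tuple_affine.
Qed.

Lemma integral_cons n (f : n.+1.-tuple R -> \bar R) :
  (lebesgue_tuple n.+1).-integrable setT f ->
  (\int[lebesgue_tuple n.+1]_x f x =
   \int[lebesgue_tuple n]_y \int[leb]_x f (@Defs.cons_tuple R n (x, y)))%E.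
Proof.
move=> intf; have mc := @measurable_cons_tuple R n.
have mf := measurable_int _ intf.
transitivity (\int[pushforward (leb \x lebesgue_tuple n)%E (@Defs.cons_tuple R n)]_x f x)%E.
  exact: eq_measure_integral.
have intf' : (leb \x lebesgue_tuple n)%E.-integrable setT (f \o @Defs.cons_tuple R n).
  apply/integrableP; split; first exact: (measurableT_comp mf mc).
  have /integrableP[_] := intf.
  rewrite (eq_measure_integral (pushforward (leb \x lebesgue_tuple n)%E (@Defs.cons_tuple R n)))//.
  rewrite ge0_integral_pushforward//; exact: measurableT_comp.
rewrite integral_pushforward//.
by rewrite preimage_setT -integral21_prod_meas1.
Qed.

Lemma ge0_integral_cons n (f : n.+1.-tuple R -> \bar R) :
  measurable_fun setT f -> (forall x, (0 <= f x)%E) ->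
  (\int[lebesgue_tuple n.+1]_x f x =
   \int[lebesgue_tuple n]_y \int[leb]_x f (@Defs.cons_tuple R n (x, y)))%E.
Proof.
move=> mf f0; have mc := @measurable_cons_tuple R n.
transitivity (\int[pushforward (leb \x lebesgue_tuple n)%E (@Defs.cons_tuple R n)]_x f x)%E.
  exact: eq_measure_integral.
rewrite ge0_integral_pushforward// preimage_setT fubini_tonelli2//.
  exact: (measurableT_comp mf mc).
by move=> p; exact: f0.
Qed.

Definition unit_itv : set R := `]0, 1[%classic.

Definition open_cube n : set (n.-tuple R) := box (fun _ => unit_itv).

Arguments open_cube n : clear implicits.

Lemma measurable_open_cube n : measurable (open_cube n).
Proof. by apply: measurable_box => i; exact: measurable_itv. Qed.

Lemma open_cube_cons n (x : R) (y : n.-tuple R) :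
  open_cube n.+1 (Defs.cons_tuple (x, y)) <-> unit_itv x /\ open_cube n y.
Proof.
split=> [h|[hx hy] i].
  split; first exact: (h ord0).
  by move=> i; have := h (lift ord0 i); rewrite tnthS.
by case: (unliftP ord0 i) => [j ->|->]; rewrite ?tnthS.
Qed.

(** Fubini, integrating over the first coordinate before the others. *)
Lemma integral_cube_eq0 n (f : n.+1.-tuple R -> R) :
  (lebesgue_tuple n.+1).-integrable (open_cube n.+1) (EFin \o f) ->
  (forall y, open_cube n y ->
     \int[leb]_(x in unit_itv) (f (Defs.cons_tuple (x, y)))%:E = 0)%E ->
  (\int[lebesgue_tuple n.+1]_(x in open_cube n.+1) (f x)%:E = 0)%E.
Proof.
move=> intf f0; rewrite integral_mkcond integral_cons; last first.
  by rewrite -integrable_mkcond//; exact: measurable_open_cube.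
apply: integral0_eq => y _.
have [cy|ncy] := pselect (open_cube n y).
  rewrite -[RHS](f0 y cy) [RHS]integral_mkcond; apply: eq_integral => x _.
  rewrite !patchE; case: ifPn => [|/negP] h.
    by rewrite mem_set//; move: h; rewrite inE => /open_cube_cons[].
  by rewrite memNset// => hx; apply: h; apply/mem_set/open_cube_cons.
apply: integral0_eq => x _; rewrite patchE memNset//.
by move=> /open_cube_cons[].
Qed.

Lemma integral_prod_fin n (g : R -> R) : measurable_fun setT g ->
  (forall x, 0 <= g x) -> (\int[leb]_x (g x)%:E < +oo)%E ->
  (\int[lebesgue_tuple n]_x (\prod_(i < n) g (tnth x i))%:E < +oo)%E.
Proof.
move=> mg g0 gfin; elim: n => [|n IH].
  under eq_integral do rewrite big_ord0.
  rewrite integral_cst//= mul1e. by rewrite diracT ltry.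
have mprod k : measurable_fun setT (fun x : k.-tuple R => \prod_(i < k) g (tnth x i)).
  apply: measurable_prod => i _.
  by apply: (measurableT_comp mg); exact: measurable_tnth.
have p0 k (x : k.-tuple R) : (0 <= (\prod_(i < k) g (tnth x i))%:E)%E.
  by rewrite lee_fin prodr_ge0.
have mE k : measurable_fun setT (fun x : k.-tuple R => (\prod_(i < k) g (tnth x i))%:E).
  by apply/measurable_EFinP; exact: mprod.
rewrite (ge0_integral_cons (mE n.+1) (p0 n.+1)).
set I := (\int[leb]_x (g x)%:E)%E in gfin.
have I0 : (0 <= I)%E by apply: integral_ge0 => x _; rewrite lee_fin.
rewrite (eq_integral (fun y => (I * (\prod_(i < n) g (tnth y i))%:E)%E)); last first.
  move=> y _; set P := (\prod_(i < n) _)%:E.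
  have -> : (I * P = \int[leb]_x ((g x)%:E * P))%E.
    rewrite ge0_integralZr//; [exact/measurable_EFinP|by move=> x _; rewrite lee_fin|].
    by rewrite lee_fin prodr_ge0.
  apply: eq_integral => x _; rewrite big_ord_recl -EFinM; congr (_ * _)%:E.
  by apply: eq_bigr => i _; rewrite tnthS.
rewrite ge0_integralZl//; last exact: mE.
by rewrite lte_mul_pinfty// ge0_fin_numE.
Qed.

Lemma integrable_prod_cube n (g : R -> R) : measurable_fun unit_itv g ->
  (forall x, unit_itv x -> 0 <= g x) -> (\int[leb]_(x in unit_itv) (g x)%:E < +oo)%E ->
  (lebesgue_tuple n).-integrable (open_cube n)
    (EFin \o (fun x => \prod_(i < n) g (tnth x i))).
Proof.
move=> mg g0 gfin; pose G := g \_ unit_itv.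
have mu : measurable unit_itv by exact: measurable_itv.
have mG : measurable_fun setT G by exact/(measurable_restrictT _ _).1.
have G0 x : 0 <= G x by rewrite /G patchE; case: ifPn => //; rewrite inE; exact: g0.
have GE x : open_cube n x -> \prod_(i < n) G (tnth x i) = \prod_(i < n) g (tnth x i).
  by move=> cx; apply: eq_bigr => i _; rewrite /G patchE mem_set//; exact: cx.
apply: (eq_integrable _ (fun x => (\prod_(i < n) G (tnth x i))%:E)).
- exact: measurable_open_cube.
- by move=> x; rewrite inE /= => /GE ->.
apply: (@integrableS _ _ _ _ setT) => //; first exact: measurable_open_cube.
apply/integrableP; split.
  apply/measurable_EFinP; apply: measurable_prod => i _.
  by apply: (measurableT_comp mG); exact: measurable_tnth.
rewrite (eq_integral (fun x => (\prod_(i < n) G (tnth x i))%:E)).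
  apply: integral_prod_fin => //; move: gfin; rewrite integral_mkcond.
  set J := integral _ _ _; suff -> : J = (\int[leb]_x (G x)%:E)%E by [].
  by apply: eq_integral => x _; rewrite /G !patchE; case: ifP.
by move=> x _; rewrite gee0_abs// lee_fin prodr_ge0.
Qed.

End tuple_measure.
Arguments open_cube {R} n _.

(** * Differentiability of finite sums and of compositions *)

Section derive_more.
Context {R : realType}.
Implicit Types (x : R) (f : R -> R).

Lemma derive_sum_fun (I : Type) (s : seq I) (P : pred I) (f : I -> R -> R)
    (df : I -> R) x : (forall i, P i -> is_derive x 1 (f i) (df i)) ->
  is_derive x 1 (fun y => \sum_(i <- s | P i) f i y) (\sum_(i <- s | P i) df i).
Proof.
move=> h; elim: s => [|i s IH].
  rewrite big_nil (_ : (fun y => _) = cst 0); first exact: is_derive_cst.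
  by apply/funext => y; rewrite big_nil.
rewrite big_cons (_ : (fun y => _) = fun y => if P i then
    f i y + \sum_(i <- s | P i) f i y else \sum_(i <- s | P i) f i y); last first.
  by apply/funext => y; rewrite big_cons.
by case: ifPn => // Pi; apply: deriveD_fun => //; exact: h.
Qed.

Lemma derive_ln x : 0 < x -> is_derive x 1 (@ln R) x^-1.
Proof. exact: is_derive1_ln. Qed.

Lemma derive_ln_comp f x df : is_derive x 1 f df -> 0 < f x ->
  is_derive x 1 (fun y => ln (f y)) (df / f x).
Proof.
move=> hf f0; apply: (derive_eq (derive_comp_fun (derive_ln f0) hf)).
by rewrite mulrC.
Qed.

Lemma derive_inv_comp f x df : is_derive x 1 f df -> f x != 0 ->
  is_derive x 1 (fun y => (f y)^-1) (- (f x)^-2 * df).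
Proof. by move=> hf f0; exact: (is_deriveV f0 hf). Qed.

Lemma derive_expR_comp f x df : is_derive x 1 f df ->
  is_derive x 1 (fun y => expR (f y)) (expR (f x) * df).
Proof. by move=> hf; exact: (derive_comp_fun (is_derive_expR _) hf). Qed.

Definition has_derive f x := exists d, is_derive x 1 f d.

Lemma has_deriveD f g x : has_derive f x -> has_derive g x -> has_derive (fun y => f y + g y) x.
Proof. by move=> [a ha] [b hb]; eexists; exact: deriveD_fun ha hb. Qed.
Lemma has_deriveB f g x : has_derive f x -> has_derive g x -> has_derive (fun y => f y - g y) x.
Proof. by move=> [a ha] [b hb]; eexists; exact: deriveB_fun ha hb. Qed.
Lemma has_deriveM f g x : has_derive f x -> has_derive g x -> has_derive (fun y => f y * g y) x.
Proof. by move=> [a ha] [b hb]; eexists; exact: deriveM_fun ha hb. Qed.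
Lemma has_derive_cst (k : R) x : has_derive (fun=> k) x.
Proof. by exists 0; exact: is_derive_cst. Qed.
Lemma has_derive_id x : has_derive id x.
Proof. by exists 1; exact: is_derive_id. Qed.
Lemma has_deriveX f x n : has_derive f x -> has_derive (fun y => f y ^+ n) x.
Proof.
move=> hf; elim: n => [|n IH]; first exact: has_derive_cst.
rewrite (_ : (fun y => _) = fun y => f y * f y ^+ n); first exact: has_deriveM.
by apply/funext => y; rewrite exprS.
Qed.
Lemma has_derive_sum (I : Type) (s : seq I) (P : pred I) (f : I -> R -> R) x :
  (forall i, P i -> has_derive (f i) x) -> has_derive (fun y => \sum_(i <- s | P i) f i y) x.
Proof.
move=> h; elim: s => [|i s IH].
  by rewrite (_ : (fun y => _) = cst 0);
    [exact: has_derive_cst|apply/funext => y; rewrite big_nil].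
rewrite (_ : (fun y => _) = fun y => if P i then
    f i y + \sum_(i <- s | P i) f i y else \sum_(i <- s | P i) f i y); last first.
  by apply/funext => y; rewrite big_cons.
by case Pi : (P i) => //; apply: has_deriveD => //; exact: h.
Qed.
Lemma has_deriveV f x : has_derive f x -> f x != 0 -> has_derive (fun y => (f y)^-1) x.
Proof. by move=> [a ha] f0; eexists; exact: derive_inv_comp ha f0. Qed.
Lemma has_derive_ln f x : has_derive f x -> 0 < f x -> has_derive (fun y => ln (f y)) x.
Proof. by move=> [a ha] f0; eexists; exact: derive_ln_comp ha f0. Qed.
Lemma has_derive_expR f x : has_derive f x -> has_derive (fun y => expR (f y)) x.
Proof. by move=> [a ha]; eexists; exact: derive_expR_comp ha. Qed.
Lemma has_derive_continuous f x : has_derive f x -> {for x, continuous f}.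
Proof. by move=> [d hd]; exact: derive_continuous hd. Qed.

End derive_more.

(** * The vector field and the regularized weight *)

Section ibp.
Context {R : realType}.
Variables (h q t : R).
Hypotheses (h0 : 0 < h) (q1 : -1 < q) (t1 : `|t| < 1).
Local Notation leb := (@lebesgue_measure R).

Definition resolvent (y : R) : R := (1 - t * y)^-1.
(** The field vanishes at 0 and 1, so that no boundary term appears. The
denominator is what makes the resulting identity close on the tail integral and
its first two derivatives. *)
Definition vfield (y : R) : R := y * (1 - y) * resolvent y.
Definition vfield' (y : R) : R := (1 - 2 * y) * resolvent y + t * y * (1 - y) * resolvent y ^+ 2.
(** The divided difference of vfield; see vfield_sub. *)
Definition vfield_quot (x y : R) : R := (1 - x - y + t * x * y) * resolvent x * resolvent y.

Let d := 1 - `|t|.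
Lemma onem_norm_gt0 : 0 < d. Proof. by rewrite subr_gt0. Qed.

Lemma onemt_ge (y : R) : 0 <= y <= 1 -> d <= 1 - t * y.
Proof.
move=> /andP[y0 y1]; rewrite /d lerD2l lerN2.
apply: (le_trans (ler_norm _)); rewrite normrM (ger0_norm y0).
by rewrite ler_piMr.
Qed.

Lemma onemt_gt0 (y : R) : 0 <= y <= 1 -> 0 < 1 - t * y.
Proof. by move=> /onemt_ge; apply: lt_le_trans; exact: onem_norm_gt0. Qed.

Lemma derive_vfield (y : R) : 0 <= y <= 1 -> is_derive y 1 vfield (vfield' y).
Proof.
move=> y01; have p := onemt_gt0 y01; have p' : 1 - t * y != 0 by rewrite gt_eqF.
have dl : is_derive y 1 (fun z => 1 - t * z) (- t).
  apply: (derive_eq (deriveB_fun (is_derive_cst (1 : R) y 1) (deriveZ_fun t (is_derive_id y 1)))).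
  by ring.
apply: (derive_eq (deriveM_fun (deriveM_fun (is_derive_id y 1) (derive_onem y))
   (derive_inv_comp dl p'))).
by rewrite /vfield' /resolvent; field.
Qed.

Lemma vfield_sub (x y : R) : 0 <= x <= 1 -> 0 <= y <= 1 ->
  vfield x - vfield y = (x - y) * vfield_quot x y.
Proof.
move=> /onemt_gt0 px /onemt_gt0 py; rewrite /vfield /vfield_quot /resolvent; field.
by rewrite !gt_eqF.
Qed.

Section dimension.
Variable n : nat.
Implicit Types (y : n.-tuple R) (e : R) (i j : 'I_n).

(** The logarithm of the weight, with y_i replaced by y_i + e and |y_i - y_j| by
the square root of (y_i - y_j)^2 + e. For e > 0 it is smooth up to the boundary of
the cube. *)
Definition reg_exponent e y : R :=
  q * (\sum_(i < n) ln (tnth y i + e)) +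
  h / 2 * (\sum_(i < n) \sum_(j < n | j != i) ln ((tnth y i - tnth y j) ^+ 2 + e)) -
  h * (\sum_(i < n) ln (1 - t * tnth y i)).

Definition reg_weight e y : R := expR (reg_exponent e y).

(** The partial derivative of vfield (y_i) times the weight along y_i, divided by
the weight. *)
Definition score e i y : R := vfield' (tnth y i) + vfield (tnth y i) *
  (q / (tnth y i + e) + h * t * resolvent (tnth y i) +
   2 * h * \sum_(j < n | j != i)
     (tnth y i - tnth y j) / ((tnth y i - tnth y j) ^+ 2 + e)).

(** The divergence, after the interaction terms have been symmetrized. *)
Definition score_total e y : R :=
  \sum_(i < n) (vfield' (tnth y i) + vfield (tnth y i) *
    (q / (tnth y i + e) + h * t * resolvent (tnth y i))) +
  h * \sum_(i < n) \sum_(j < n | j != i) vfield_quot (tnth y i) (tnth y j) *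
     ((tnth y i - tnth y j) ^+ 2 / ((tnth y i - tnth y j) ^+ 2 + e)).

Lemma open_cubeW y i : open_cube n y -> 0 <= tnth y i <= 1.
Proof. by move=> /(_ i); rewrite /unit_itv /= in_itv /= => /andP[? ?]; rewrite !ltW. Qed.

(** In the double sum the terms (i, j) and (j, i) have opposite fractions, so that
vfield (y_i) can be replaced by half of vfield (y_i) - vfield (y_j). The difference
cancels the singular denominator. *)
Lemma score_sum e y : open_cube n y ->
  \sum_(i < n) score e i y = score_total e y.
Proof.
move=> cy; rewrite /score_total /score mulr_sumr -big_split /=.
pose a i j := (tnth y i - tnth y j) / ((tnth y i - tnth y j) ^+ 2 + e).
have E : \sum_(i < n) \sum_(j < n | j != i) 2 * (vfield (tnth y i) * a i j) =
  \sum_(i < n) \sum_(j < n | j != i) vfield_quot (tnth y i) (tnth y j) *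
     ((tnth y i - tnth y j) ^+ 2 / ((tnth y i - tnth y j) ^+ 2 + e)).
  transitivity (\sum_(i < n) \sum_(j < n | j != i)
     (vfield (tnth y i) * a i j + vfield (tnth y j) * a j i)).
    have sw : \sum_(i < n) \sum_(j < n | j != i) vfield (tnth y i) * a i j =
       \sum_(i < n) \sum_(j < n | j != i) vfield (tnth y j) * a j i.
      rewrite (exchange_big_dep predT) //=; apply: eq_bigr => i _.
      by apply: eq_bigl => j; rewrite eq_sym.
    rewrite -[RHS](_ : \sum_(i < n) (\sum_(j < n | j != i) vfield (tnth y i) * a i j +
       \sum_(j < n | j != i) vfield (tnth y j) * a j i) = _); last first.
      by apply: eq_bigr => i _; rewrite big_split.
    rewrite big_split /= -sw -big_split /=; apply: eq_bigr => i _.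
    by rewrite -mulr_sumr mulrDl !mul1r.
  apply: eq_bigr => i _; apply: eq_bigr => j _.
  have -> : a j i = - a i j.
    by rewrite /a -(opprB (tnth y i)) sqrrN mulNr.
  rewrite mulrN -mulrBl vfield_sub; [|exact: open_cubeW..].
  by rewrite /a expr2; ring.
transitivity (\sum_(i < n) ((vfield' (tnth y i) + vfield (tnth y i) *
    (q / (tnth y i + e) + h * t * resolvent (tnth y i))) +
    h * \sum_(j < n | j != i) 2 * (vfield (tnth y i) * a i j))).
  apply: eq_bigr => i _; rewrite -mulr_sumr -mulr_sumr -/(a i _); ring.
by rewrite !big_split /= -!mulr_sumr E.
Qed.

(** All coordinates play the same role, so that ibp_coordinate reduces to the
first coordinate. *)
Lemma reg_exponent_permute e (s : {perm 'I_n}) y : reg_exponent e (permute_tuple s y) = reg_exponent e y.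
Proof.
rewrite /reg_exponent; congr (q * _ + h / 2 * _ - h * _).
- rewrite [RHS](reindex_inj (@perm_inj _ s)).
  by apply: eq_bigr => i _; rewrite tnth_permute.
- rewrite [RHS](reindex_inj (@perm_inj _ s)); apply: eq_bigr => i _.
  rewrite [RHS](reindex_inj (@perm_inj _ s)); apply: eq_big => j.
    by rewrite (inj_eq perm_inj).
  by rewrite !tnth_permute.
- rewrite [RHS](reindex_inj (@perm_inj _ s)).
  by apply: eq_bigr => i _; rewrite tnth_permute.
Qed.

Lemma score_permute e i (s : {perm 'I_n}) y :
  score e i (permute_tuple s y) = score e (s i) y.
Proof.
rewrite /score !tnth_permute; congr (_ + _ * (_ + _ * _)).
rewrite [RHS](reindex_inj (@perm_inj _ s)); apply: eq_big => j.
  by rewrite (inj_eq perm_inj).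
by rewrite !tnth_permute.
Qed.

Lemma open_cube_permute (s : {perm 'I_n}) :
  permute_tuple s @^-1` open_cube n = open_cube n :> set (n.-tuple R).
Proof.
apply/seteqP; split => y /= cy i; last by rewrite tnth_permute; exact: cy.
by have := cy ((s^-1)%g i); rewrite tnth_permute permKV.
Qed.

End dimension.

Section first_coordinate.
Variables (n : nat) (y : n.-tuple R) (e : R).
Hypotheses (cy : open_cube n y) (e0 : 0 < e).

Let c (i : 'I_n.+1) (x : R) : R := tnth (Defs.cons_tuple (x, y)) i.
Let delta (i : 'I_n.+1) : R := (i == ord0)%:R.

Lemma derive_coord i (x : R) : is_derive x 1 (c i) (delta i).
Proof.
rewrite /delta; case: (unliftP ord0 i) => [j ->|->] /=.
  rewrite (_ : c _ = cst (tnth y j)).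
    exact: (derive_eq (is_derive_cst (tnth y j) x 1)).
  by apply/funext => z; rewrite /c tnthS.
by rewrite (_ : c _ = id)//; exact: is_derive_id.
Qed.

Lemma coord_itv i (x : R) : 0 <= x <= 1 -> 0 <= c i x <= 1.
Proof.
move=> x01; rewrite /c; case: (unliftP ord0 i) => [j ->|->//].
by rewrite tnthS; exact: open_cubeW.
Qed.

Lemma has_derive_coord i (x : R) : has_derive (c i) x.
Proof. by eexists; exact: derive_coord. Qed.

Lemma sum_delta (f : 'I_n.+1 -> R) : \sum_(i < n.+1) f i * delta i = f ord0.
Proof.
rewrite (bigD1 ord0)//= /delta eqxx mulr1 big1 ?addr0// => i /negbTE ->.
by rewrite mulr0.
Qed.

(** Each unordered pair containing the first index is met twice, with opposite
signs of both factors. *)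
Lemma sum_delta2 (a : 'I_n.+1 -> 'I_n.+1 -> R) : (forall i j, a j i = - a i j) ->
  \sum_(i < n.+1) \sum_(j < n.+1 | j != i) a i j * (delta i - delta j) =
  2 * \sum_(j < n.+1 | j != ord0) a ord0 j.
Proof.
move=> asym.
transitivity (\sum_(i < n.+1) ((\sum_(j < n.+1 | j != i) a i j) * delta i) -
   \sum_(i < n.+1) \sum_(j < n.+1 | j != i) a i j * delta j).
  rewrite -sumrB; apply: eq_bigr => i _; rewrite mulr_suml -sumrB.
  by apply: eq_bigr => j _; rewrite mulrBr.
rewrite sum_delta (exchange_big_dep predT) //=.
under [X in _ - X]eq_bigr do rewrite -mulr_suml.
rewrite sum_delta mulrDl !mul1r; congr (_ + _); rewrite -sumrN.
by apply: eq_big => i; [rewrite eq_sym|rewrite asym opprK].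
Qed.

Lemma derive_reg_exponent (x : R) : 0 <= x <= 1 ->
  is_derive x 1 (fun x => reg_exponent e (Defs.cons_tuple (x, y)))
   (q / (x + e) + h * t * resolvent x + 2 * h * \sum_(j < n.+1 | j != ord0)
     (c ord0 x - c j x) / ((c ord0 x - c j x) ^+ 2 + e)).
Proof.
move=> x01; have ci i := coord_itv i x01.
have p1 i : 0 < c i x + e by have /andP[? _] := ci i; rewrite ltr_wpDl.
have p2 i j : 0 < (c i x - c j x) ^+ 2 + e by rewrite ltr_wpDl ?sqr_ge0.
have p3 i : 0 < 1 - t * c i x by exact: onemt_gt0.
have dl i : is_derive x 1 (fun z => ln (c i z + e)) (delta i / (c i x + e)).
  apply: derive_ln_comp => //.
  by apply: (derive_eq (deriveD_fun (derive_coord i x) (is_derive_cst e x 1))); rewrite addr0.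
have dl2 i j : is_derive x 1 (fun z => ln ((c i z - c j z) ^+ 2 + e))
   (2 * (c i x - c j x) * (delta i - delta j) / ((c i x - c j x) ^+ 2 + e)).
  apply: (derive_ln_comp (f := fun z => (c i z - c j z) ^+ 2 + e)) => //.
  have db := deriveB_fun (derive_coord i x) (derive_coord j x).
  apply: (derive_eq (deriveD_fun (deriveM_fun db db) (is_derive_cst e x 1))).
  by ring.
have dl3 i : is_derive x 1 (fun z => ln (1 - t * c i z)) (- t * delta i / (1 - t * c i x)).
  apply: derive_ln_comp => //.
  apply: (derive_eq (deriveB_fun (is_derive_cst (1 : R) x 1) (deriveZ_fun t (derive_coord i x)))).
  by ring.
apply: (derive_eq (deriveB_fun (deriveD_fun
  (deriveZ_fun q (derive_sum_fun (index_enum _) (P := predT) (fun i _ => dl i)))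
  (deriveZ_fun (h / 2) (derive_sum_fun (index_enum _) (P := predT)
    (fun i _ => derive_sum_fun (index_enum _) (P := fun j => j != i) (fun j _ => dl2 i j)))))
  (deriveZ_fun h (derive_sum_fun (index_enum _) (P := predT) (fun i _ => dl3 i))))).
have -> : \sum_i delta i / (c i x + e) = (x + e)^-1.
  by under eq_bigr do rewrite mulrC; rewrite (sum_delta (fun i => (c i x + e)^-1)).
have -> : \sum_i - t * delta i / (1 - t * c i x) = - t * resolvent x.
  under eq_bigr do rewrite mulrAC.
  by rewrite (sum_delta (fun i => - t / (1 - t * c i x))).
pose a i j := 2 * ((c i x - c j x) / ((c i x - c j x) ^+ 2 + e)).
have asym i j : a j i = - a i j.
  by rewrite /a -(opprB (c i x)) sqrrN mulNr mulrN.
rewrite (eq_bigr (fun i => \sum_(j < n.+1 | j != i) a i j * (delta i - delta j))); last first.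
  by move=> i _; apply: eq_bigr => j _; rewrite /a; ring.
rewrite sum_delta2// /a -mulr_sumr; field.
by rewrite gt_eqF// (p1 ord0).
Qed.

(** The integrand is the derivative of the weight times vfield, which vanishes at
0 and 1. *)
Lemma integral_first :
  (\int[leb]_(x in unit_itv) (reg_weight e (Defs.cons_tuple (x, y)) *
     score e ord0 (Defs.cons_tuple (x, y)))%:E = 0)%E.
Proof.
pose F (x : R) := reg_weight e (Defs.cons_tuple (x, y)) * vfield x.
pose f (x : R) := reg_weight e (Defs.cons_tuple (x, y)) * score e ord0 (Defs.cons_tuple (x, y)).
have dF (x : R) : 0 <= x <= 1 -> is_derive x 1 F (f x).
  move=> x01; apply: (derive_eq (deriveM_fun (derive_expR_comp (derive_reg_exponent x01)) (derive_vfield x01))).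
  have c0 : tnth (Defs.cons_tuple (x, y)) ord0 = x by [].
  by rewrite /f /score /reg_weight /c c0; ring.
have cf (x : R) : 0 <= x <= 1 -> {for x, continuous f}.
  move=> x01; apply: has_derive_continuous; have ci i := coord_itv i x01.
  have p1 i : c i x + e != 0 by have /andP[? _] := ci i; rewrite gt_eqF// ltr_wpDl.
  have p2 i j : (c i x - c j x) ^+ 2 + e != 0 by rewrite gt_eqF// ltr_wpDl ?sqr_ge0.
  have p3 i : 1 - t * c i x != 0 by rewrite gt_eqF// onemt_gt0.
  have sl i : has_derive (fun z => 1 - t * c i z) x.
    by apply: has_deriveB; [exact: has_derive_cst|apply: has_deriveM; [exact: has_derive_cst|exact: has_derive_coord]].
  have sr i : has_derive (fun z => resolvent (c i z)) x by exact: has_deriveV.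
  have so i : has_derive (fun z => 1 - c i z) x.
    by apply: has_deriveB; [exact: has_derive_cst|exact: has_derive_coord].
  have sd j : has_derive (fun z => c ord0 z - c j z) x by apply: has_deriveB; exact: has_derive_coord.
  apply: has_deriveM.
    by apply: has_derive_expR; eexists; exact: derive_reg_exponent.
  apply: has_deriveD.
    apply: has_deriveD.
      apply: has_deriveM; last exact: (sr ord0).
      apply: (@has_deriveB _ (fun=> 1) (fun z => 2 * c ord0 z)); first exact: has_derive_cst.
      by apply: has_deriveM; [exact: has_derive_cst|exact: has_derive_coord].
    apply: has_deriveM; last exact: (has_deriveX _ (sr ord0)).
    apply: has_deriveM; last exact: (so ord0).
    by apply: has_deriveM; [exact: has_derive_cst|exact: has_derive_coord].
  apply: has_deriveM.
    apply: has_deriveM; last exact: (sr ord0).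
    by apply: has_deriveM; [exact: has_derive_coord|exact: (so ord0)].
  apply: has_deriveD.
    apply: has_deriveD.
      apply: has_deriveM; first exact: has_derive_cst.
      apply: (@has_deriveV _ (fun z => c ord0 z + e)); last exact: p1.
      by apply: has_deriveD; [exact: has_derive_coord|exact: has_derive_cst].
    by apply: has_deriveM; [exact: has_derive_cst|exact: (sr ord0)].
  apply: has_deriveM; first exact: has_derive_cst.
  apply: has_derive_sum => j _; apply: has_deriveM; first exact: sd.
  apply: (@has_deriveV _ (fun z => (c ord0 z - c j z) ^+ 2 + e)); last exact: p2.
  by apply: has_deriveD; [apply: has_deriveX; exact: sd|exact: has_derive_cst].
have := FTC_closed (@ltr01 R) dF cf.
rewrite /F /vfield !(mul0r, mulr0, subrr) => E; rewrite -[RHS]E.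
have mf : measurable_fun (`[0, 1]%classic : set R) (EFin \o f).
  apply/measurable_EFinP; apply: subspace_continuous_measurable_fun => //.
  by apply: continuous_in_subspaceT => x; rewrite inE /= in_itv /=; exact: cf.
have sub (i : interval R) : [set` i] `<=` (`[0, 1]%classic : set R) -> measurable_fun [set` i] (EFin \o f).
  by move=> si; apply: measurable_funS mf.
rewrite /unit_itv (@integral_itv_obnd_cbnd _ _ _ (EFin \o f)); last first.
  by apply: sub => x /=; rewrite !in_itv /= => /andP[? ?]; rewrite !ltW.
rewrite (@integral_itv_bndo_bndc _ _ _ (EFin \o f))//.
by apply: sub => x /=; rewrite !in_itv /= => /andP[-> ?]; rewrite ltW.
Qed.

End first_coordinate.

End ibp.

(** * Measurability of the inverse *)

Section measurability.
Context {R : realType} d (T : measurableType d).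
Implicit Types (f g : T -> R) (D : set T).

(** Real inversion is not continuous at 0; writing 1 / f as f times a power of
f^2 settles the zeros, because both sides are 0 there. *)
Lemma measurable_fun_inv D f : measurable_fun D f ->
  measurable_fun D (fun x => (f x)^-1).
Proof.
move=> mf; rewrite (_ : (fun x => _) = (fun x => f x * (f x ^+ 2) `^ (-1))).
  apply: measurable_funM => //.
  by apply: (measurableT_comp (measurable_powR _)); exact: measurable_funX.
apply/funext => x; have [->|fx0] := eqVneq (f x) 0; first by rewrite mul0r invr0.
by rewrite powR_inv1 ?sqr_ge0// expr2 invfM mulrA divff ?mul1r.
Qed.

End measurability.

(** * Integrability of a power near 0 *)

Section integral_powR.
Context {R : realType}.

Lemma integral_powR_lt (q : R) : -1 < q ->
  (\int[lebesgue_measure]_(x in unit_itv) (x `^ q)%:E < +oo)%E.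
Proof.
move=> q1; pose a_ (n : nat) : R := n.+2%:R^-1; have q0 : 0 < q + 1 by lra.
have a0 n : 0 < a_ n by rewrite /a_ invr_gt0.
have ca : a_ @ \oo --> (0 : R) by move: (@cvg_harmonic R); rewrite -cvg_shiftS.
have ab n : a_ n < 1 by rewrite /a_ invf_lt1// ltr1n.
have da m n : (m <= n)%N -> a_ n <= a_ m.
  by move=> mn; rewrite /a_ lef_pV2 ?posrE ?ltr0n// ler_nat.
have pos n x : a_ n <= x <= 1 -> 0 < x by move=> /andP[+ _]; exact: lt_le_trans.
have dF n x : a_ n <= x <= 1 -> is_derive x 1 (fun z => (q + 1)^-1 * z `^ (q + 1)) (x `^ q).
  move=> /pos x0; apply: (derive_eq (deriveZ_fun _ (derive_powR (q + 1) x0))).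
  by rewrite addrK mulKf// gt_eqF.
have cf n x : a_ n <= x <= 1 -> {for x, continuous (fun z => z `^ q)}.
  by move=> /pos x0; exact: derive_continuous (derive_powR q x0).
have lim := @FTC_exhaust _ (fun z => z `^ q) _ a_ (fun=> 1) ab da (fun _ _ _ => lexx _)
  (fun n x _ => powR_ge0 x q) dF cf.
have lim' : ((q + 1)^-1 * 1 `^ (q + 1) - (q + 1)^-1 * a_ n `^ (q + 1))%:E @[n --> \oo]
    --> ((q + 1)^-1 * 1 `^ (q + 1) - (q + 1)^-1 * 0)%:E.
  apply: cvg_EFin; first exact: nearW.
  apply: cvgB; first exact: cvg_cst.
  apply: cvgM; first exact: cvg_cst.
  have /cvg_at_rightP h := powR_cvg0 q0; by apply: h; split.
have fin : (\int[lebesgue_measure]_(x in \bigcup_n [set` `[a_ n, 1%R]]) (x `^ q)%:E < +oo)%E.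
  by rewrite -(cvg_lim _ lim)// (cvg_lim _ lim')// ltry.
apply: le_lt_trans fin; apply: ge0_subset_integral.
- exact: measurable_itv.
- by apply: bigcup_measurable => n _; exact: measurable_itv.
- by apply/measurable_EFinP; apply: measurable_funTS; exact: measurable_powR.
- by move=> x _; rewrite lee_fin powR_ge0.
- move=> x /=; rewrite /unit_itv /= in_itv /= => /andP[x0 x1].
  have /cvgrPdist_lt/(_ x x0)[N _ /(_ N (leqnn N))] := ca.
  rewrite /= sub0r normrN gtr0_norm// => aN; exists N => //=.
  by rewrite in_itv /= !ltW.
Qed.

End integral_powR.

(** * Bounds uniform in the regularization parameter *)

Section bounds.
Context {R : realType}.
Variables (h q t : R).
Hypotheses (h0 : 0 < h) (q1 : -1 < q) (t1 : `|t| < 1).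
Variable n : nat.
Implicit Types (y : n.-tuple R) (e : R) (i j : 'I_n).
Local Notation reg_exponent := (reg_exponent h q t).
Local Notation reg_weight := (reg_weight h q t).
Local Notation score := (score h q t).
Local Notation score_total := (score_total h q t).
Local Notation resolvent := (resolvent t).
Local Notation vfield := (vfield t).
Local Notation vfield' := (vfield' t).
Local Notation vfield_quot := (vfield_quot t).
Local Notation mu := (lebesgue_tuple n).

Let b : R := (1 - `|t|)^-1.
Let b0 : 0 < b. Proof. by rewrite /b invr_gt0 subr_gt0. Qed.

Lemma resolvent_bound (x : R) : 0 <= x <= 1 -> 0 <= resolvent x <= b.
Proof.
move=> x01; have p := onemt_gt0 t1 x01; have g := onemt_ge t x01.
rewrite /resolvent invr_ge0 ltW//= lef_pV2// posrE subr_gt0 //.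
Qed.

Lemma norm_resolvent (x : R) : 0 <= x <= 1 -> `|resolvent x| <= b.
Proof. by move=> /resolvent_bound/andP[? ?]; rewrite ger0_norm. Qed.

Lemma norm_le1 (x : R) : 0 <= x <= 1 -> `|x| <= 1.
Proof. by move=> /andP[x0 x1]; rewrite ger0_norm. Qed.

Lemma norm_vfield (x : R) : 0 <= x <= 1 -> `|vfield x| <= b.
Proof.
move=> x01; rewrite /vfield !normrM -[leRHS]mul1r ler_pM ?mulr_ge0 ?norm_resolvent//.
rewrite -[leRHS]mul1r ler_pM ?norm_le1//; move/andP: x01 => [? ?].
by apply/andP; split; lra.
Qed.

Lemma norm_vfield' (x : R) : 0 <= x <= 1 -> `|vfield' x| <= b + b ^+ 2.
Proof.
move=> x01; have hx := norm_resolvent x01; have /andP[? ?] := x01.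
apply: (le_trans (ler_normD _ _)); apply: lerD.
  rewrite normrM -[leRHS]mul1r ler_pM//.
  by rewrite ler_norml; apply/andP; split; lra.
rewrite normrM normrX -[leRHS]mul1r ler_pM//; last first.
  by apply: lerXn2r; rewrite ?nnegrE// ltW.
rewrite !normrM -[leRHS]mul1r ler_pM ?mulr_ge0//.
  by rewrite -[leRHS]mul1r; apply: ler_pM => //; [exact: ltW|exact: norm_le1].
by rewrite norm_le1//; apply/andP; split; lra.
Qed.

Lemma norm_vfield_resolvent (x : R) : 0 <= x <= 1 -> `|vfield x * (h * t * resolvent x)| <= h * b ^+ 2.
Proof.
move=> x01; rewrite normrM (normrM (h * t)) (normrM h) (gtr0_norm h0).
rewrite [leRHS](_ : _ = b * (h * 1 * b)); last by rewrite expr2; ring.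
apply: ler_pM; [exact: normr_ge0|by rewrite !mulr_ge0 ?(ltW h0)|exact: norm_vfield|].
apply: ler_pM; [by rewrite mulr_ge0 ?(ltW h0)|exact: normr_ge0| |exact: norm_resolvent].
by apply: ler_wpM2l; rewrite ltW.
Qed.

Lemma norm_vfield_div (x e : R) : 0 <= x <= 1 -> 0 <= e -> 0 < x + e ->
  `|vfield x * (q / (x + e))| <= `|q| * b.
Proof.
move=> x01 e0 xe; have /andP[x0 x1] := x01.
rewrite (_ : _ * _ = q * ((x / (x + e)) * (1 - x) * resolvent x)); last first.
  by rewrite /vfield; field; rewrite gt_eqF.
rewrite normrM ler_wpM2l// !normrM -[leRHS]mul1r ler_pM ?mulr_ge0 ?norm_resolvent//.
rewrite -normrM ger0_norm ?mulr_ge0 ?invr_ge0 ?subr_ge0 ?(ltW xe)//.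
rewrite -[leRHS]mul1r; apply: ler_pM; rewrite ?subr_ge0 ?mulr_ge0 ?invr_ge0 ?(ltW xe)//.
  by rewrite ler_pdivrMr// mul1r lerDl.
by rewrite ger0_norm ?gerBl ?subr_ge0.
Qed.

Lemma norm_vfield_quot (x z : R) : 0 <= x <= 1 -> 0 <= z <= 1 -> `|vfield_quot x z| <= 2 * b ^+ 2.
Proof.
move=> x01 z01; have /andP[x0 x1] := x01; have /andP[z0 z1] := z01.
rewrite /vfield_quot !normrM expr2 mulrA ler_pM ?mulr_ge0 ?norm_resolvent// ler_pM ?norm_resolvent//.
have txz : `|t * x * z| <= 1.
  rewrite !normrM -[leRHS]mul1r; apply: ler_pM; rewrite ?mulr_ge0 ?norm_le1//.
  by rewrite -[leRHS]mul1r; apply: ler_pM => //; [exact: ltW|exact: norm_le1].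
by move: txz; rewrite !ler_norml => /andP[? ?]; apply/andP; split; lra.
Qed.

Let base : R := b + b ^+ 2 + (`|q| * b + h * b ^+ 2).

Lemma norm_base (x e : R) : 0 <= x <= 1 -> 0 <= e -> 0 < x + e ->
  `|vfield' x + vfield x * (q / (x + e) + h * t * resolvent x)| <= base.
Proof.
move=> x01 e0 xe; rewrite mulrDr; apply: (le_trans (ler_normD _ _)).
apply: lerD; first exact: norm_vfield'.
apply: (le_trans (ler_normD _ _)); apply: lerD; first exact: norm_vfield_div.
exact: norm_vfield_resolvent.
Qed.

Lemma ler_norm_sum_const (f : 'I_n -> R) (P : pred 'I_n) (k : R) : 0 <= k ->
  (forall i, `|f i| <= k) -> `|\sum_(i < n | P i) f i| <= n%:R * k.
Proof.
move=> k0 fk; apply: (le_trans (ler_norm_sum _ _ _)).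
apply: (@le_trans _ _ (\sum_(i < n) k)); last by rewrite sumr_const card_ord mulr_natl.
by rewrite big_mkcond; apply: ler_sum => i _; case: ifP.
Qed.

Definition score_total_bound : R := n%:R * base + h * (n%:R * (n%:R * (2 * b ^+ 2))).

Lemma base_ge0 : 0 <= base.
Proof. by rewrite /base !addr_ge0 ?mulr_ge0 ?sqr_ge0 ?(ltW b0) ?(ltW h0). Qed.

Lemma open_cube_gt0 y i : open_cube n y -> 0 < tnth y i.
Proof. by move=> /(_ i); rewrite /unit_itv /= in_itv /= => /andP[]. Qed.

Lemma norm_score_total y e : open_cube n y -> 0 < e -> `|score_total e y| <= score_total_bound.
Proof.
move=> cy e0; apply: (le_trans (ler_normD _ _)); apply: lerD.
  apply: ler_norm_sum_const; first exact: base_ge0.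
  move=> i; apply: norm_base; [exact: open_cubeW|exact: ltW|].
  by rewrite ltr_wpDl// ltW// open_cube_gt0.
rewrite normrM (gtr0_norm h0); apply: ler_wpM2l; first exact: ltW.
have qb : 0 <= 2 * b ^+ 2 by rewrite mulr_ge0 ?sqr_ge0.
apply: ler_norm_sum_const => [|i]; first by rewrite mulr_ge0.
apply: ler_norm_sum_const => // j.
rewrite normrM -[leRHS]mulr1 ler_pM ?norm_vfield_quot//; [exact: open_cubeW..|].
set D := (_ - _) ^+ 2; have D0 : 0 <= D by exact: sqr_ge0.
by rewrite ger0_norm ?divr_ge0 ?addr_ge0 ?(ltW e0)// ler_pdivrMr ?mul1r ?lerDl ?ltr_wpDl// ltW.
Qed.

Definition score_bound e : R := base + b * (2 * h * (n%:R * (2 / e))).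

Lemma norm_score y i e : open_cube n y -> 0 < e -> `|score e i y| <= score_bound e.
Proof.
move=> cy e0; rewrite /score mulrDr addrA; apply: (le_trans (ler_normD _ _)).
apply: lerD.
  apply: norm_base; [exact: open_cubeW|exact: ltW|].
  by rewrite ltr_wpDl// ltW// open_cube_gt0.
rewrite normrM ler_pM ?norm_vfield//; first exact: open_cubeW.
rewrite normrM ger0_norm ?mulr_ge0 ?(ltW h0)//; apply: ler_wpM2l.
  by rewrite mulr_ge0// ltW.
apply: ler_norm_sum_const => [|j]; first by rewrite divr_ge0// ltW.
rewrite normrM ler_pM//.
  have /andP[? ?] := open_cubeW i cy; have /andP[? ?] := open_cubeW j cy.
  by rewrite ler_norml; apply/andP; split; lra.
rewrite ger0_norm ?invr_ge0 ?addr_ge0 ?sqr_ge0 ?(ltW e0)//.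
by rewrite lef_pV2 ?posrE// ?lerDr ?sqr_ge0// ltr_wpDl ?sqr_ge0.
Qed.

(** Bounds (x + e)^q for all e in [0, 1]: by the value at e = 0 for q < 0, and by
2^q for q >= 0. *)
Definition dom1 (x : R) : R := x `^ q + 2 `^ q.
Definition dom y : R := \prod_(i < n) dom1 (tnth y i).

Lemma powR_dom (x e : R) : 0 < x < 1 -> 0 <= e <= 1 -> (x + e) `^ q <= dom1 x.
Proof.
move=> /andP[x0 x1] /andP[e0 e1]; rewrite /dom1.
have xe0 : 0 < x + e by lra.
(* Increasing power: x + e <= 2. Decreasing power: x + e >= x. *)
have [q0|q0] := leP 0 q.
  apply: (@le_trans _ _ (2 `^ q)); last by rewrite lerDr powR_ge0.
  by apply: ge0_ler_powR; rewrite ?nnegrE; lra.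
apply: (@le_trans _ _ (x `^ q)); last by rewrite lerDl powR_ge0.
have h' : x `^ (- q) <= (x + e) `^ (- q) by apply: ge0_ler_powR; rewrite ?nnegrE; lra.
by move: h'; rewrite !powRN lef_pV2 ?posrE ?powR_gt0.
Qed.

Definition pair_sum e y : R :=
  \sum_(i < n) \sum_(j < n | j != i) ln ((tnth y i - tnth y j) ^+ 2 + e).

Lemma ln2_ge0 : 0 <= ln (2 : R).
Proof. by rewrite ln_ge0// ler1n. Qed.

Lemma ln_pair y i j e : open_cube n y -> 0 < e <= 1 ->
  ln ((tnth y i - tnth y j) ^+ 2 + e) <= ln 2.
Proof.
move=> cy /andP[e0 e1].
have /andP[? ?] := open_cubeW i cy; have /andP[? ?] := open_cubeW j cy.
set D := _ ^+ 2; have D0 : 0 <= D by exact: sqr_ge0.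
have D1 : D <= 1 by rewrite /D; nra.
rewrite ler_ln ?posrE; lra.
Qed.

Lemma pair_sum_le y e : open_cube n y -> 0 < e <= 1 ->
  pair_sum e y <= n%:R * (n%:R * ln 2).
Proof.
move=> cy e01; have k (r : R) : n%:R * r = \sum_(i < n) r.
  by rewrite sumr_const card_ord mulr_natl.
rewrite (k (_ * _)); apply: ler_sum => i _; rewrite k big_mkcond.
by apply: ler_sum => j _; case: ifP => _; rewrite ?ln2_ge0// ln_pair.
Qed.

Lemma pair_sum_le_coincident y e i0 j0 : open_cube n y -> 0 < e <= 1 ->
  i0 != j0 -> tnth y i0 = tnth y j0 ->
  pair_sum e y <= n%:R * (n%:R * ln 2) + ln e.
Proof.
move=> cy e01 ij0 yij.
have k (r : R) : n%:R * r = \sum_(i < n) r.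
  by rewrite sumr_const card_ord mulr_natl.
rewrite /pair_sum (bigD1 i0)//= (bigD1 j0)/=; last by rewrite eq_sym.
rewrite yij subrr expr0n /= add0r -addrA addrC lerD2r.
rewrite (k (_ * _)) [leRHS](bigD1 i0)//=; apply: lerD.
  rewrite k big_mkcond; apply: ler_sum => j _.
  by case: ifP => _; rewrite ?ln2_ge0// -yij ln_pair.
apply: ler_sum => i _; rewrite k big_mkcond.
by apply: ler_sum => j _; case: ifP => _; rewrite ?ln2_ge0// ln_pair.
Qed.

Lemma reg_weight_split y e : open_cube n y -> 0 < e ->
  reg_weight e y = (\prod_(i < n) (tnth y i + e) `^ q) *
    (expR (h / 2 * pair_sum e y) * expR (- (h * \sum_(i < n) ln (1 - t * tnth y i)))).
Proof.
move=> cy e0; rewrite /reg_weight /reg_weight /reg_exponent /reg_exponent -/(pair_sum e y).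
rewrite !expRD mulrA; congr (_ * _ * _).
rewrite mulr_sumr expR_sum; apply: eq_bigr => i _.
by rewrite /powR gt_eqF// addr_gt0// open_cube_gt0.
Qed.

Definition onem_bound : R := expR (- (h * (n%:R * ln (1 - `|t|)))).

Lemma onem_boundP y : open_cube n y ->
  expR (- (h * \sum_(i < n) ln (1 - t * tnth y i))) <= onem_bound.
Proof.
move=> cy; rewrite ler_expR lerN2 ler_wpM2l ?(ltW h0)//.
rewrite [leLHS](_ : _ = \sum_(i < n) ln (1 - `|t|)); last first.
  by rewrite sumr_const card_ord mulr_natl.
apply: ler_sum => i _; rewrite ler_ln ?posrE ?subr_gt0//.
  exact/onemt_ge/open_cubeW.
by rewrite -subr_gt0; apply: onemt_gt0 => //; exact: open_cubeW.
Qed.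

Definition reg_bound : R := expR (h / 2 * (n%:R * (n%:R * ln 2))) * onem_bound.

Lemma dom_prod y e : open_cube n y -> 0 < e <= 1 ->
  0 <= \prod_(i < n) (tnth y i + e) `^ q <= dom y.
Proof.
move=> cy /andP[e0 e1]; rewrite prodr_ge0 => [|i _]; last exact: powR_ge0.
apply: ler_prod => i _; rewrite powR_ge0 powR_dom ?(ltW e0)//.
by have := cy i; rewrite /unit_itv /= in_itv.
Qed.

Lemma reg_weight_le y e : open_cube n y -> 0 < e <= 1 ->
  reg_weight e y <= dom y * reg_bound.
Proof.
move=> cy e01; have /andP[e0 e1] := e01; rewrite reg_weight_split//.
have /andP[p0 p1] := dom_prod cy e01.
apply: ler_pM; [exact: p0|by rewrite mulr_ge0 ?expR_ge0|exact: p1|].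
apply: ler_pM; rewrite ?expR_ge0//; last exact: onem_boundP.
by rewrite ler_expR ler_wpM2l ?divr_ge0 ?(ltW h0)// pair_sum_le.
Qed.

(** On a diagonal the pair (i0, j0) contributes the factor e^(h / 2), which forces
the limit 0. *)
Lemma reg_weight_le_coincident y e i0 j0 : open_cube n y -> 0 < e <= 1 ->
  i0 != j0 -> tnth y i0 = tnth y j0 ->
  reg_weight e y <= dom y * reg_bound * e `^ (h / 2).
Proof.
move=> cy e01 ij yij; have /andP[e0 e1] := e01; rewrite reg_weight_split//.
have /andP[p0 p1] := dom_prod cy e01; rewrite -[leRHS]mulrA.
apply: ler_pM; [exact: p0|by rewrite mulr_ge0 ?expR_ge0|exact: p1|].
rewrite /reg_bound [leRHS]mulrAC; apply: ler_pM; rewrite ?expR_ge0//; last exact: onem_boundP.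
rewrite /powR gt_eqF// -expRD -mulrDr ler_expR ler_wpM2l ?divr_ge0 ?(ltW h0)//.
exact: pair_sum_le_coincident ij yij.
Qed.

Lemma integrable_dom : mu.-integrable (open_cube n) (EFin \o dom).
Proof.
have mp : measurable_fun setT (fun x : R => x `^ q) by exact: measurable_powR.
apply: integrable_prod_cube => [|x _|]; first by apply: measurable_funTS; exact: measurable_funD.
  by rewrite addr_ge0 ?powR_ge0.
have -> : (\int[lebesgue_measure]_(x in unit_itv) (dom1 x)%:E =
    \int[lebesgue_measure]_(x in unit_itv) (x `^ q)%:E +
    \int[lebesgue_measure]_(x in unit_itv) (2 `^ q)%:E)%E.
  rewrite -ge0_integralD//=; [exact: measurable_itv|
    by move=> x _; rewrite lee_fin powR_ge0|].
  by apply/measurable_EFinP; exact: measurable_funTS.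
rewrite lte_add_pinfty//; first exact: integral_powR_lt.
rewrite integral_cst//=; last exact: measurable_itv.
by rewrite lebesgue_measure_itv /= lte_fin ltr01 -EFinB -EFinM ltry.
Qed.

Lemma measurable_reg_weight e : measurable_fun setT (reg_weight e : n.-tuple R -> R).
Proof.
have mt i : measurable_fun setT (fun y : n.-tuple R => tnth y i) by exact: measurable_tnth.
have ml (f : n.-tuple R -> R) : measurable_fun setT f -> measurable_fun setT (fun y => ln (f y)).
  by apply: measurableT_comp; exact: measurable_ln.
apply: (measurableT_comp (@measurable_expR R)); apply: measurable_funB.
  apply: measurable_funD; apply: measurable_funM => //.
    by apply: measurable_sum => i; apply: ml; exact: measurable_funD.
  apply: measurable_sum => i; under eq_fun do rewrite big_mkcond.
  apply: measurable_sum => j; case: (j != i) => //; apply: ml; apply: measurable_funD => //.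
  by apply: measurable_funX; exact: measurable_funB.
apply: measurable_funM => //; apply: measurable_sum => i; apply: ml.
by apply: measurable_funB => //; exact: measurable_funM.
Qed.

Lemma measurable_tnthT i : measurable_fun setT (fun y : n.-tuple R => tnth y i).
Proof. exact: measurable_tnth. Qed.

Lemma measurable_resolvent (f : n.-tuple R -> R) : measurable_fun setT f ->
  measurable_fun setT (fun y => resolvent (f y)).
Proof.
move=> mf; apply: measurable_fun_inv; apply: measurable_funB => //.
exact: measurable_funM.
Qed.

Lemma measurable_vfield (f : n.-tuple R -> R) : measurable_fun setT f ->
  measurable_fun setT (fun y => vfield (f y)).
Proof.
move=> mf; apply: measurable_funM; last exact: measurable_resolvent.
by apply: measurable_funM => //; exact: measurable_funB.
Qed.

Lemma measurable_vfield' (f : n.-tuple R -> R) : measurable_fun setT f ->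
  measurable_fun setT (fun y => vfield' (f y)).
Proof.
move=> mf; apply: measurable_funD; apply: measurable_funM.
- by apply: measurable_funB => //; exact: measurable_funM.
- exact: measurable_resolvent.
- apply: measurable_funM; last exact: measurable_funB.
  exact: measurable_funM.
- by apply: measurable_funX; exact: measurable_resolvent.
Qed.

Lemma measurable_vfield_quot (f g : n.-tuple R -> R) : measurable_fun setT f ->
  measurable_fun setT g -> measurable_fun setT (fun y => vfield_quot (f y) (g y)).
Proof.
move=> mf mg; apply: measurable_funM; last exact: measurable_resolvent.
apply: measurable_funM; last exact: measurable_resolvent.
apply: measurable_funD; last by apply: measurable_funM => //; exact: measurable_funM.
by apply: measurable_funB => //; exact: measurable_funB.
Qed.

Lemma measurable_base i e : measurable_fun setT (fun y : n.-tuple R =>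
  vfield' (tnth y i) + vfield (tnth y i) * (q / (tnth y i + e) + h * t * resolvent (tnth y i))).
Proof.
have mt := measurable_tnthT i.
apply: measurable_funD; first exact: measurable_vfield'.
apply: measurable_funM; first exact: measurable_vfield.
apply: measurable_funD; last by apply: measurable_funM => //; exact: measurable_resolvent.
by apply: measurable_funM => //; apply: measurable_fun_inv; exact: measurable_funD.
Qed.

Lemma measurable_diff i j : measurable_fun setT (fun y : n.-tuple R => tnth y i - tnth y j).
Proof. by apply: measurable_funB; exact: measurable_tnthT. Qed.

Lemma measurable_score i e : measurable_fun setT (score e i : n.-tuple R -> R).
Proof.
rewrite (_ : (score e i : n.-tuple R -> R) = fun y : n.-tuple R =>
  vfield' (tnth y i) + vfield (tnth y i) * (q / (tnth y i + e) + h * t * resolvent (tnth y i)) +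
  vfield (tnth y i) * (2 * h * \sum_(j < n | j != i)
     (tnth y i - tnth y j) / ((tnth y i - tnth y j) ^+ 2 + e))); last first.
  by apply/funext => y; rewrite /score; ring.
apply: measurable_funD; first exact: measurable_base.
apply: measurable_funM; first by apply: measurable_vfield; exact: measurable_tnthT.
apply: measurable_funM => //; under eq_fun do rewrite big_mkcond.
apply: measurable_sum => j; case: (j != i) => //.
apply: measurable_funM; first exact: measurable_diff.
by apply: measurable_fun_inv; apply: measurable_funD => //;
  apply: measurable_funX; exact: measurable_diff.
Qed.

Lemma measurable_score_total e : measurable_fun setT (score_total e : n.-tuple R -> R).
Proof.
apply: measurable_funD; first by apply: measurable_sum => i; exact: measurable_base.
apply: measurable_funM => //; apply: measurable_sum => i.
under eq_fun do rewrite big_mkcond; apply: measurable_sum => j; case: (j != i) => //.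
apply: measurable_funM; first by apply: measurable_vfield_quot; exact: measurable_tnthT.
apply: measurable_funM; first by apply: measurable_funX; exact: measurable_diff.
by apply: measurable_fun_inv; apply: measurable_funD => //;
  apply: measurable_funX; exact: measurable_diff.
Qed.

Lemma dom_ge0 y : 0 <= dom y.
Proof. by apply: prodr_ge0 => i _; rewrite addr_ge0 ?powR_ge0. Qed.

Lemma reg_bound_ge0 : 0 <= reg_bound.
Proof. by rewrite mulr_ge0 ?expR_ge0. Qed.

Lemma integrable_reg_weight_mul e (f : n.-tuple R -> R) (k : R) : 0 < e <= 1 ->
  measurable_fun setT f -> (forall y, open_cube n y -> `|f y| <= k) ->
  mu.-integrable (open_cube n) (EFin \o (fun y => reg_weight e y * f y)).
Proof.
move=> e01 mf fk; have mc := @measurable_open_cube R n.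
apply: (@le_integrable _ _ _ _ _ mc _ (EFin \o (fun y => reg_bound * k * dom y))).
- apply/measurable_EFinP; apply: measurable_funTS; apply: measurable_funM => //.
  exact: measurable_reg_weight.
- move=> y cy /=; rewrite lee_fin (normrM (reg_weight e y)) (normrM (reg_bound * k)) (normrM reg_bound).
  rewrite (ger0_norm (dom_ge0 y)) (ger0_norm reg_bound_ge0).
  rewrite [leRHS](_ : _ = dom y * reg_bound * `|k|); last by ring.
  apply: ler_pM => //; last exact: le_trans (fk y cy) (ler_norm _).
  by rewrite ger0_norm ?expR_ge0//; exact: reg_weight_le.
- apply: (eq_integrable _ (fun y => ((reg_bound * k)%:E * (dom y)%:E)%E)) => //.
  exact: integrableZl integrable_dom.
Qed.

End bounds.

(** * Integration by parts on the cube *)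

Section regularization_limit.
Context {R : realType}.
Variables (h q t : R).
Hypotheses (h0 : 0 < h) (q1 : -1 < q) (t1 : `|t| < 1).

Section pointwise.
Variable n : nat.
Implicit Types (y : n.-tuple R) (e : R) (i j : 'I_n).
Local Notation mu := (lebesgue_tuple n).

(** Each unordered pair occurs twice in the double product, so that
|y_i - y_j| has the exponent 2 h. *)
Definition base_weight y : R :=
  \prod_(i < n) tnth y i `^ q *
  \prod_(i < n) \prod_(j < n | j != i) `|tnth y i - tnth y j| `^ h.

(** The product of the (1 - t y_i)^(- h). *)
Definition onem_factor y : R := expR (- (h * \sum_(i < n) ln (1 - t * tnth y i))).

(** The value of score_total at e = 0 off the diagonals, and a finite expression on
them. *)
Definition score_total0 y : R :=
  \sum_(i < n) (vfield' t (tnth y i) + vfield t (tnth y i) *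
    (q / tnth y i + h * t * resolvent t (tnth y i))) +
  h * \sum_(i < n) \sum_(j < n | j != i) vfield_quot t (tnth y i) (tnth y j).

Lemma reg_weight0 y : open_cube n y -> (forall i j, j != i -> tnth y i != tnth y j) ->
  reg_weight h q t 0 y = base_weight y * onem_factor y.
Proof.
move=> cy dy; rewrite /reg_weight /reg_exponent !expRD /base_weight /onem_factor; congr (_ * _ * _).
  rewrite mulr_sumr expR_sum; apply: eq_bigr => i _.
  by rewrite addr0 /powR gt_eqF// open_cube_gt0.
rewrite mulr_sumr expR_sum; apply: eq_bigr => i _.
rewrite mulr_sumr expR_sum; apply: eq_bigr => j ji.
have d0 : 0 < `|tnth y i - tnth y j| by rewrite normr_gt0 subr_eq0 dy.
rewrite addr0 -(real_normK (num_real _)) lnXn// /powR gt_eqF//.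
by congr expR; rewrite -mulr_natr; field.
Qed.

Lemma score_total_0 y : (forall i j, j != i -> tnth y i != tnth y j) ->
  score_total h q t 0 y = score_total0 y.
Proof.
move=> dy; rewrite /score_total /score_total0; congr (_ + h * _).
  by apply: eq_bigr => i _; rewrite addr0.
apply: eq_bigr => i _; apply: eq_bigr => j ji.
by rewrite addr0 divff ?mulr1// expf_neq0// subr_eq0 dy.
Qed.

Lemma has_derive_shift (k : R) : has_derive (fun e => k + e) (0 : R).
Proof. by apply: has_deriveD; [exact: has_derive_cst|exact: has_derive_id]. Qed.

Lemma harmonic_itv k : 0 < (harmonic k : R) <= 1.
Proof. by rewrite /harmonic /= invr_gt0 ltr0n /= invf_le1// ler1n. Qed.

(** Off the diagonals everything is differentiable in e at 0. On a diagonal the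
limit weight is 0 and score_total stays bounded, while the regularized weight is
O (e^(h / 2)). *)
Lemma cvg_regularized y : open_cube n y ->
  reg_weight h q t (harmonic k) y * score_total h q t (harmonic k) y @[k --> \oo] -->
  base_weight y * onem_factor y * score_total0 y.
Proof.
move=> cy.
have [dy|] := pselect (forall i j, j != i -> tnth y i != tnth y j).
  rewrite -reg_weight0// -score_total_0//.
  have d0 i j : j != i -> 0 < (tnth y i - tnth y j) ^+ 2.
    by move=> ji; rewrite lt0r sqr_ge0 andbT expf_neq0// subr_eq0 dy.
  have d0' i j : j != i -> (tnth y i - tnth y j) ^+ 2 + 0 != 0.
    by move=> ji; rewrite addr0 gt_eqF// d0.
  have p0 i : 0 < tnth y i + 0 by rewrite addr0 open_cube_gt0.
  have s : has_derive (fun e => reg_weight h q t e y * score_total h q t e y) 0.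
    apply: has_deriveM.
      apply: has_derive_expR; apply: has_deriveB; last exact: has_derive_cst.
      apply: has_deriveD; apply: has_deriveM; do ?exact: has_derive_cst.
        apply: has_derive_sum => i _; apply: (@has_derive_ln _ (fun e => tnth y i + e)) => //.
        exact: has_derive_shift.
      apply: has_derive_sum => i _; apply: has_derive_sum => j ji.
      apply: (@has_derive_ln _ (fun e => (tnth y i - tnth y j) ^+ 2 + e)); first exact: has_derive_shift.
      by rewrite addr0 d0.
    apply: has_deriveD.
      apply: has_derive_sum => i _; apply: has_deriveD; first exact: has_derive_cst.
      apply: has_deriveM; first exact: has_derive_cst.
      apply: has_deriveD; last exact: has_derive_cst.
      apply: has_deriveM; first exact: has_derive_cst.
      by apply: (@has_deriveV _ (fun e => tnth y i + e)); [exact: has_derive_shift|rewrite gt_eqF].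
    apply: has_deriveM; first exact: has_derive_cst.
    apply: has_derive_sum => i _; apply: has_derive_sum => j ji.
    apply: has_deriveM; first exact: has_derive_cst.
    apply: has_deriveM; first exact: has_derive_cst.
    by apply: (@has_deriveV _ (fun e => (tnth y i - tnth y j) ^+ 2 + e)); [exact: has_derive_shift|exact: d0'].
  exact: (cvg_comp _ _ (@cvg_harmonic R) (has_derive_continuous s)).
move=> /existsNP[i /existsNP[j /not_implyP[ji /negP]]]; rewrite negbK => /eqP yij.
have -> : base_weight y = 0.
  apply/eqP; rewrite mulf_eq0; apply/orP; right; apply/prodf_eq0; exists i => //.
  by apply/prodf_eq0; exists j => //; rewrite yij subrr normr0 powR0// gt_eqF.
rewrite !mul0r; pose K := dom q y * reg_bound h t n * score_total_bound h q t n.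
have h20 : 0 < h / 2 by rewrite divr_gt0.
have lim0 : K * harmonic k `^ (h / 2) @[k --> \oo] --> (0 : R).
  apply: (cvg_lim_eq (l := K * 0)); last by rewrite mulr0.
  apply: cvgM; first exact: cvg_cst.
  have /cvg_at_rightP hp := powR_cvg0 h20; apply: hp; split; last exact: cvg_harmonic.
  by move=> k; have /andP[] := harmonic_itv k.
apply: (@squeeze_cvgr _ _ _ _ (fun k => - (K * harmonic k `^ (h / 2)))
  (fun k => K * harmonic k `^ (h / 2))) => //; last first.
  by apply: (cvg_lim_eq (l := - 0)); [exact: cvgN|rewrite oppr0].
apply: nearW => k; rewrite -ler_norml normrM; have e01 := harmonic_itv k.
have /andP[e0 e1] := e01.
rewrite [leRHS](_ : _ = dom q y * reg_bound h t n * harmonic k `^ (h / 2) * score_total_bound h q t n);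
  last by rewrite /K; ring.
apply: ler_pM => //; last exact: norm_score_total.
rewrite ger0_norm ?expR_ge0//.
have ij : i != j by rewrite eq_sym.
exact: (@reg_weight_le_coincident _ h q t h0 t1 _ _ _ _ _ cy e01 ij yij).
Qed.

Lemma measurable_base_weight : measurable_fun setT (base_weight : n.-tuple R -> R).
Proof.
have mt i : measurable_fun setT (fun y : n.-tuple R => tnth y i) by exact: measurable_tnth.
apply: measurable_funM.
  apply: measurable_prod => i _; apply: (measurableT_comp (measurable_powR _)); exact: mt.
apply: measurable_prod => i _; under eq_fun do rewrite big_mkcond.
apply: measurable_prod => j _; case: (j != i) => //.
apply: (measurableT_comp (measurable_powR _)).
apply: (measurableT_comp (@normr_measurable R setT)); exact: measurable_funB.
Qed.

Lemma measurable_onem_factor : measurable_fun setT (onem_factor : n.-tuple R -> R).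
Proof.
apply: (measurableT_comp (@measurable_expR R)); apply: measurable_funN.
apply: measurable_funM => //; apply: measurable_sum => i.
apply: (measurableT_comp (@measurable_ln R)); apply: measurable_funB => //.
by apply: measurable_funM => //; exact: measurable_tnth.
Qed.

Lemma measurable_score_total0 : measurable_fun setT (score_total0 : n.-tuple R -> R).
Proof.
rewrite (_ : score_total0 = fun y => \sum_(i < n) (vfield' t (tnth y i) + vfield t (tnth y i) *
    (q / (tnth y i + 0) + h * t * resolvent t (tnth y i))) +
  h * \sum_(i < n) \sum_(j < n | j != i) vfield_quot t (tnth y i) (tnth y j)); last first.
  by apply/funext => y; rewrite /score_total0; under [in RHS]eq_bigr do rewrite addr0.
apply: measurable_funD; first by apply: measurable_sum => i; exact: measurable_base.
apply: measurable_funM => //; apply: measurable_sum => i.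
under eq_fun do rewrite big_mkcond; apply: measurable_sum => j; case: (j != i) => //.
by apply: measurable_vfield_quot; exact: measurable_tnth.
Qed.

End pointwise.

Local Notation mu n := (lebesgue_tuple n).

(** The transposition of the indices 0 and i carries the statement for the first
coordinate to the coordinate i. *)
Lemma ibp_coordinate n (i : 'I_n.+1) (e : R) : 0 < e <= 1 ->
  (\int[mu n.+1]_(y in open_cube n.+1) (reg_weight h q t e y * score h q t e i y)%:E = 0)%E.
Proof.
move=> e01; have /andP[e0 e1] := e01.
pose f (y : n.+1.-tuple R) := reg_weight h q t e y * score h q t e ord0 y.
have int j : (mu n.+1).-integrable (open_cube n.+1)
    (EFin \o (fun y => reg_weight h q t e y * score h q t e j y)).
  apply: (integrable_reg_weight_mul h0 q1 t1 e01 (measurable_score _ _ _ _ _)) => y cy.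
  exact: norm_score.
have f0 : (\int[mu n.+1]_(y in open_cube n.+1) (f y)%:E = 0)%E.
  by apply: integral_cube_eq0 => [|y cy]; [exact: int|exact: integral_first].
have fE y : f (permute_tuple (tperm ord0 i) y) = reg_weight h q t e y * score h q t e i y.
  by rewrite /f /reg_weight reg_exponent_permute score_permute tpermL.
rewrite -[RHS]f0 -[RHS](integral_permute (s := tperm ord0 i)).
- by apply: eq_integral => y _; rewrite fE.
- exact: measurable_open_cube.
- exact: open_cube_permute.
- apply: measurable_funTS; apply: measurable_funM; first exact: measurable_reg_weight.
  exact: measurable_score.
- apply: eq_integrable (int i) => [|y _]; first exact: measurable_open_cube.
  by rewrite /= fE.
Qed.

Lemma ibp_score_total n (e : R) : 0 < e <= 1 ->
  (\int[mu n.+1]_(y in open_cube n.+1) (reg_weight h q t e y * score_total h q t e y)%:E = 0)%E.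
Proof.
move=> e01; have /andP[e0 e1] := e01.
have mc := @measurable_open_cube R n.+1.
rewrite (eq_integral (fun y => (\sum_(i < n.+1)
   (reg_weight h q t e y * score h q t e i y)%:E)%E)); last first.
  move=> y; rewrite inE => cy; rewrite sumEFin -mulr_sumr score_sum//.
rewrite integral_sum//.
  by rewrite big1// => i _; exact: ibp_coordinate.
move=> i; apply: (integrable_reg_weight_mul h0 q1 t1 e01 (measurable_score _ _ _ _ _)) => y cy.
exact: norm_score.
Qed.

(** The symmetrized divergence is bounded uniformly in e, although the separate
scores are not; this is what lets dominated convergence apply. *)
Theorem ibp_limit n :
  (mu n.+1).-integrable (open_cube n.+1)
    (EFin \o (fun y => base_weight y * onem_factor y * score_total0 y)) /\
  (\int[mu n.+1]_(y in open_cube n.+1) (base_weight y * onem_factor y * score_total0 y)%:E = 0)%E.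
Proof.
have mc := @measurable_open_cube R n.+1.
have [] := @dominated_convergence _ _ R (mu n.+1) _ mc
  (fun k y => (reg_weight h q t (harmonic k) y * score_total h q t (harmonic k) y)%:E)
  (fun y => (base_weight y * onem_factor y * score_total0 y)%:E)
  (fun y => (dom q y * reg_bound h t n.+1 * score_total_bound h q t n.+1)%:E).
- move=> k; apply/measurable_EFinP; apply: measurable_funTS.
  by apply: measurable_funM; [exact: measurable_reg_weight|exact: measurable_score_total].
- apply/measurable_EFinP; apply: measurable_funTS; apply: measurable_funM.
    by apply: measurable_funM; [exact: measurable_base_weight|exact: measurable_onem_factor].
  exact: measurable_score_total0.
- apply: aeW => y cy; apply: cvg_EFin; first exact: nearW.
  exact: cvg_regularized.
- apply: (eq_integrable _ (fun y => ((reg_bound h t n.+1 * score_total_bound h q t n.+1)%:E * (dom q y)%:E)%E)) => //.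
    by move=> y _; rewrite -EFinM; congr (_%:E); ring.
  exact: integrableZl (integrable_dom _ _).
- apply: aeW => y k cy; rewrite lee_fin normrM; have e01 := @harmonic_itv k.
  have /andP[e0 e1] := e01.
  apply: ler_pM => //; last exact: norm_score_total.
  by rewrite ger0_norm ?expR_ge0//; exact: reg_weight_le.
move=> int _ lim; split => //.
rewrite -(cvg_lim _ lim)//; apply/cvg_lim => //; apply: cvg_near_cst.
by apply: nearW => k; exact: ibp_score_total (harmonic_itv k).
Qed.

End regularization_limit.

(** * The differential equation of the tail integral *)

Section average.
Context {R : realType}.
Variables (h q : R) (n : nat).
Hypotheses (h0 : 0 < h) (q1 : -1 < q).
Local Notation m := n.+1.
Local Notation mu := (lebesgue_tuple n.+1).
Local Notation cube := (open_cube n.+1).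
Implicit Types (t : R) (y : m.-tuple R).

Definition ratio t (x : R) : R := x * resolvent t x.
Definition ratio_sum t y : R := \sum_(i < m) ratio t (tnth y i).
Definition ratio_sqsum t y : R := \sum_(i < m) ratio t (tnth y i) ^+ 2.

(** The primes are derivatives in t. *)
Definition tail_weight t y : R := base_weight h q y * onem_factor h t y.
Definition tail_weight' t y : R := tail_weight t y * (h * ratio_sum t y).
Definition tail_weight'' t y : R := tail_weight t y * (h ^+ 2 * ratio_sum t y ^+ 2 + h * ratio_sqsum t y).

Definition tail_int t : R := \int[mu]_(y in cube) tail_weight t y.
Definition tail_int' t : R := \int[mu]_(y in cube) tail_weight' t y.
Definition tail_int'' t : R := \int[mu]_(y in cube) tail_weight'' t y.

(** With r_i = y_i / (1 - t y_i) one has y_i = r_i / (1 + t r_i) and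
1 / (1 - t y_i) = 1 + t r_i, which makes every term a polynomial in the r_i. The
combination h p^2 + p_2 of the two power sums is the one in tail_weight''. *)
Lemma score_total0E t y : `|t| < 1 -> cube y -> score_total0 h q t y =
  m%:R * (1 + q + h * (m%:R - 1)) +
  (h * t - (2 + q + 2 * h * (m%:R - 1)) * (1 - t)) * ratio_sum t y
  - t * (1 - t) * (h * ratio_sum t y ^+ 2 + ratio_sqsum t y).
Proof.
move=> t1 cy.
have yi i : tnth y i != 0 by rewrite gt_eqF// open_cube_gt0.
have ri i : 1 - t * tnth y i != 0 by rewrite gt_eqF// onemt_gt0//; exact: open_cubeW.
have cst (k : R) : \sum_(i < m) k = m%:R * k by rewrite sumr_const card_ord mulr_natl.
have lin (a b c : R) : \sum_(i < m) (a + b * ratio t (tnth y i) +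
    c * ratio t (tnth y i) ^+ 2) = m%:R * a + b * ratio_sum t y + c * ratio_sqsum t y.
  by rewrite !big_split /= cst -!mulr_sumr.
have -> : score_total0 h q t y = \sum_(i < m) ((1 + q) +
    (h * t - (2 + q) * (1 - t)) * ratio t (tnth y i) +
    (- (h * t * (1 - t)) - t * (1 - t)) * ratio t (tnth y i) ^+ 2) +
  h * \sum_(i < m) ((m%:R - (1 - t) * ratio_sum t y - 1) +
    (2 * (1 - t) - (1 - t) * m%:R - t * (1 - t) * ratio_sum t y) * ratio t (tnth y i) +
    t * (1 - t) * ratio t (tnth y i) ^+ 2); last by rewrite !lin; ring.
rewrite /score_total0; congr (_ + h * _); apply: eq_bigr => i _.
  by rewrite /ratio /vfield' /vfield /resolvent; field; rewrite ri yi.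
pose f j := 1 + (- (1 - t)) * ratio t (tnth y i) +
  (- (1 - t) - t * (1 - t) * ratio t (tnth y i)) * ratio t (tnth y j).
rewrite (eq_bigr f); last first.
  by move=> j _; rewrite /f /ratio /vfield_quot /resolvent; field; rewrite !ri.
have -> : \sum_(j < m | j != i) f j = \sum_j f j - f i.
  by rewrite [in RHS](bigD1 i)//= addrAC subrr add0r.
by rewrite /f big_split /= cst -mulr_sumr -/(ratio_sum t y); ring.
Qed.

Lemma ratio_norm t rho (x : R) : `|t| <= rho -> rho < 1 -> 0 <= x <= 1 ->
  0 <= ratio t x <= (1 - rho)^-1.
Proof.
move=> trho rho1 x01; have /andP[x0 x1] := x01.
have t1 : `|t| < 1 by apply: le_lt_trans trho rho1.
have /andP[r0 r1] := resolvent_bound t1 x01.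
rewrite mulr_ge0//= (le_trans (ler_piMl r0 x1))// (le_trans r1)//.
by rewrite lef_pV2 ?posrE ?subr_gt0// lerD2l lerN2.
Qed.

Lemma derive_ratio t (x : R) : `|t| < 1 -> 0 <= x <= 1 ->
  is_derive t 1 (fun t => ratio t x) (ratio t x ^+ 2).
Proof.
move=> t1 x01; have r0 : 1 - t * x != 0 by rewrite gt_eqF// onemt_gt0.
have dl : is_derive t 1 (fun t => 1 - t * x) (- x).
  apply: (derive_eq (deriveB_fun (is_derive_cst (1 : R) t 1)
    (deriveM_fun (is_derive_id t 1) (is_derive_cst x t 1)))).
  by rewrite /=; ring.
apply: (derive_eq (deriveZ_fun x (derive_inv_comp dl r0))).
by rewrite /ratio /resolvent; field.
Qed.

Lemma derive_ratio_sum t y : `|t| < 1 -> cube y -> is_derive t 1 (ratio_sum ^~ y) (ratio_sqsum t y).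
Proof.
move=> t1 cy; apply: derive_sum_fun => i _; apply: derive_ratio => //.
exact: open_cubeW.
Qed.

Lemma derive_onem_factor t y : `|t| < 1 -> cube y ->
  is_derive t 1 (fun t => onem_factor h t y) (onem_factor h t y * (h * ratio_sum t y)).
Proof.
move=> t1 cy; have dl i : is_derive t 1 (fun t => ln (1 - t * tnth y i)) (- ratio t (tnth y i)).
  have r0 : 0 < 1 - t * tnth y i by apply: onemt_gt0 => //; exact: open_cubeW.
  apply: (derive_eq (derive_ln_comp (f := fun t => 1 - t * tnth y i) (deriveB_fun (is_derive_cst (1 : R) t 1)
    (deriveM_fun (is_derive_id t 1) (is_derive_cst (tnth y i) t 1))) r0)).
  by rewrite /ratio /resolvent /=; field; rewrite gt_eqF.
apply: (derive_eq (derive_expR_comp (deriveN_fun (deriveZ_fun h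
  (derive_sum_fun (index_enum _) (P := predT) (fun i _ => dl i)))))).
by rewrite sumrN -/(ratio_sum t y) /onem_factor; ring.
Qed.

Lemma derive_tail_weight t y : `|t| < 1 -> cube y -> is_derive t 1 (tail_weight ^~ y) (tail_weight' t y).
Proof.
move=> t1 cy; apply: (derive_eq (deriveZ_fun (base_weight h q y) (derive_onem_factor t1 cy))).
by rewrite /tail_weight' /tail_weight; ring.
Qed.

Lemma derive_tail_weight' t y : `|t| < 1 -> cube y -> is_derive t 1 (tail_weight' ^~ y) (tail_weight'' t y).
Proof.
move=> t1 cy; apply: (derive_eq (deriveM_fun (derive_tail_weight t1 cy)
  (deriveZ_fun h (derive_ratio_sum t1 cy)))).
by rewrite /tail_weight'' /tail_weight'; ring.
Qed.

Lemma base_weight_ge0 y : 0 <= base_weight h q y.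
Proof.
apply: mulr_ge0; apply: prodr_ge0 => i _; first exact: powR_ge0.
by apply: prodr_ge0 => j _; exact: powR_ge0.
Qed.

Lemma base_weight_le y : cube y -> base_weight h q y <= dom q y.
Proof.
move=> cy; rewrite -[leRHS]mulr1; apply: ler_pM.
- by apply: prodr_ge0 => i _; exact: powR_ge0.
- by apply: prodr_ge0 => i _; apply: prodr_ge0 => j _; exact: powR_ge0.
- by apply: ler_prod => i _; rewrite powR_ge0 /dom1 lerDl powR_ge0.
- suff /andP[] : 0 <= \prod_(i < m) \prod_(j < m | j != i)
      `|tnth y i - tnth y j| `^ h <= 1 by [].
  have mul01 (u v : R) : 0 <= u <= 1 -> 0 <= v <= 1 -> 0 <= u * v <= 1.
    by move=> /andP[? ?] /andP[? ?]; rewrite mulr_ge0//= mulr_ile1.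
  apply: (big_ind (fun x => 0 <= x <= 1)) => // [|i _]; first by rewrite ler01 lexx.
  apply: (big_ind (fun x => 0 <= x <= 1)) => // [|j _]; first by rewrite ler01 lexx.
  rewrite powR_ge0 /=.
  rewrite -(powRr0 `|tnth y i - tnth y j|); have [->|d0] := eqVneq (tnth y i - tnth y j) 0.
    by rewrite normr0 powRr0 powR0 ?gt_eqF.
  apply: ger_powR; last exact: ltW.
  rewrite normr_gt0 d0 /= ler_norml.
  have /andP[? ?] := open_cubeW i cy; have /andP[? ?] := open_cubeW j cy.
  by apply/andP; split; lra.
Qed.

Section domination.
Variable rho : R.
Hypotheses (rho0 : 0 < rho) (rho1 : rho < 1).
Let B : R := (1 - rho)^-1.
Let oB : R := onem_bound h rho m.
Let B_ge0 : 0 <= B. Proof. by rewrite /B invr_ge0 subr_ge0 ltW. Qed.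

Lemma onem_factor_le t y : `|t| <= rho -> cube y -> 0 <= onem_factor h t y <= oB.
Proof.
move=> trho cy; rewrite expR_ge0 /=.
have t1 : `|t| < 1 by apply: le_lt_trans trho rho1.
apply: le_trans (onem_boundP h0 t1 cy) _.
rewrite /oB /onem_bound (gtr0_norm rho0) ler_expR lerN2 ler_wpM2l ?(ltW h0)// ler_wpM2l//.
by rewrite ler_ln ?posrE ?subr_gt0// lerD2l lerN2.
Qed.

Lemma ratio_sum_le t y : `|t| <= rho -> cube y -> 0 <= ratio_sum t y <= m%:R * B.
Proof.
move=> trho cy; have r i := ratio_norm trho rho1 (open_cubeW i cy).
apply/andP; split; first by apply: sumr_ge0 => i _; have /andP[] := r i.
rewrite -[leRHS](_ : \sum_(i < m) B = _); last by rewrite sumr_const card_ord mulr_natl.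
by apply: ler_sum => i _; have /andP[] := r i.
Qed.

Lemma ratio_sqsum_le t y : `|t| <= rho -> cube y -> 0 <= ratio_sqsum t y <= m%:R * B ^+ 2.
Proof.
move=> trho cy; have r i := ratio_norm trho rho1 (open_cubeW i cy).
apply/andP; split; first by apply: sumr_ge0 => i _; exact: sqr_ge0.
rewrite -[leRHS](_ : \sum_(i < m) B ^+ 2 = _); last by rewrite sumr_const card_ord mulr_natl.
by apply: ler_sum => i _; have /andP[r0 r1] := r i; rewrite lerXn2r ?nnegrE.
Qed.

Definition dominant (k : R) y : R := k * oB * dom q y.

Lemma integrable_dominant k : mu.-integrable cube (EFin \o dominant k).
Proof.
apply: (eq_integrable _ (fun y => ((k * oB)%:E * (dom q y)%:E)%E)) => //.
  exact: measurable_open_cube.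
by apply: integrableZl; [exact: measurable_open_cube|exact: integrable_dom].
Qed.

Lemma dominant_ge0 k y : 0 <= k -> 0 <= dominant k y.
Proof. by move=> k0; rewrite !mulr_ge0 ?expR_ge0 ?dom_ge0. Qed.

Lemma tail_weight_mul_dom t y (k p : R) : `|t| <= rho -> cube y -> 0 <= p <= k ->
  `|tail_weight t y * p| <= dominant k y.
Proof.
move=> trho cy /andP[p0 pk]; have /andP[f0 f1] := onem_factor_le trho cy.
have w0 := base_weight_ge0 y; have w1 := base_weight_le cy.
have a0 : 0 <= tail_weight t y := mulr_ge0 w0 f0.
rewrite ger0_norm; last exact: mulr_ge0.
rewrite /dominant [leRHS](_ : _ = dom q y * oB * k); last by ring.
by apply: ler_pM => //; apply: ler_pM.
Qed.

Lemma tail_weight_dom t y : `|t| <= rho -> cube y -> `|tail_weight t y| <= dominant 1 y.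
Proof.
move=> trho cy; rewrite -[X in `|X|]mulr1; apply: tail_weight_mul_dom => //.
by rewrite ler01 lexx.
Qed.

Let k1 := h * (m%:R * B).
Let k2 := h ^+ 2 * (m%:R * B) ^+ 2 + h * (m%:R * B ^+ 2).

Lemma tail_weight'_dom t y : `|t| <= rho -> cube y -> `|tail_weight' t y| <= dominant k1 y.
Proof.
move=> trho cy; apply: tail_weight_mul_dom => //; have /andP[a b] := ratio_sum_le trho cy.
by rewrite mulr_ge0 ?(ltW h0)//= ler_wpM2l ?(ltW h0).
Qed.

Lemma tail_weight''_dom t y : `|t| <= rho -> cube y -> `|tail_weight'' t y| <= dominant k2 y.
Proof.
move=> trho cy; apply: tail_weight_mul_dom => //; have /andP[a b] := ratio_sum_le trho cy.
have /andP[c d] := ratio_sqsum_le trho cy; have h0' := ltW h0.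
rewrite addr_ge0 ?mulr_ge0 ?sqr_ge0//=; apply: lerD.
  by rewrite ler_wpM2l ?sqr_ge0// lerXn2r ?nnegrE// mulr_ge0.
by rewrite ler_wpM2l.
Qed.

Lemma measurable_tail_weight t : measurable_fun setT (tail_weight t).
Proof. by apply: measurable_funM; [exact: measurable_base_weight|exact: measurable_onem_factor]. Qed.

Lemma measurable_ratio t i : measurable_fun setT (fun y : m.-tuple R => ratio t (tnth y i)).
Proof.
apply: measurable_funM; first exact: measurable_tnth.
by apply: measurable_resolvent; exact: measurable_tnth.
Qed.

Lemma measurable_ratio_sum t : measurable_fun setT (ratio_sum t).
Proof. by apply: measurable_sum => i; exact: measurable_ratio. Qed.

Lemma measurable_ratio_sqsum t : measurable_fun setT (ratio_sqsum t).
Proof. by apply: measurable_sum => i; apply: measurable_funX; exact: measurable_ratio. Qed.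

Lemma measurable_tail_weight' t : measurable_fun setT (tail_weight' t).
Proof.
apply: measurable_funM; first exact: measurable_tail_weight.
by apply: measurable_funM => //; exact: measurable_ratio_sum.
Qed.

Lemma measurable_tail_weight'' t : measurable_fun setT (tail_weight'' t).
Proof.
apply: measurable_funM; first exact: measurable_tail_weight.
apply: measurable_funD; apply: measurable_funM => //; last exact: measurable_ratio_sqsum.
by apply: measurable_funX; exact: measurable_ratio_sum.
Qed.

Lemma dom_integrable (f : m.-tuple R -> R) k : measurable_fun setT f -> 0 <= k ->
  (forall y, cube y -> `|f y| <= dominant k y) -> mu.-integrable cube (EFin \o f).
Proof.
move=> mf k0 fG; have mc := @measurable_open_cube R m.
apply: (@le_integrable _ _ _ _ _ mc _ (EFin \o dominant k)).
- by apply/measurable_EFinP; exact: measurable_funTS.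
- by move=> y cy /=; rewrite lee_fin (le_trans (fG y cy))// ler_norm.
- exact: integrable_dominant.
Qed.

Lemma integrable_tail_weight t : `|t| <= rho -> mu.-integrable cube (EFin \o tail_weight t).
Proof.
move=> trho; apply: (@dom_integrable _ 1 (measurable_tail_weight t)) => // y cy.
exact: tail_weight_dom.
Qed.

Let k1_ge0 : 0 <= k1. Proof. by rewrite !mulr_ge0 ?(ltW h0). Qed.
Let k2_ge0 : 0 <= k2.
Proof. by rewrite addr_ge0 ?mulr_ge0 ?sqr_ge0 ?(ltW h0). Qed.

Lemma integrable_tail_weight' t : `|t| <= rho -> mu.-integrable cube (EFin \o tail_weight' t).
Proof.
move=> trho; apply: (@dom_integrable _ k1 (measurable_tail_weight' t)) => // y cy.
exact: tail_weight'_dom.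
Qed.

Lemma integrable_tail_weight'' t : `|t| <= rho -> mu.-integrable cube (EFin \o tail_weight'' t).
Proof.
move=> trho; apply: (@dom_integrable _ k2 (measurable_tail_weight'' t)) => // y cy.
exact: tail_weight''_dom.
Qed.

(** Differentiation under the integral sign on (- rho, rho), where the integrable
function dominant bounds all derivatives in t. *)
Lemma derive_under (f f' : R -> m.-tuple R -> R) k t : `|t| < rho -> 0 <= k ->
  (forall t, `|t| <= rho -> mu.-integrable cube (EFin \o f t)) ->
  (forall t y, `|t| < 1 -> cube y -> is_derive t 1 (f ^~ y) (f' t y)) ->
  (forall t y, `|t| <= rho -> cube y -> `|f' t y| <= dominant k y) ->
  is_derive t 1 (fun t => \int[mu]_(y in cube) f t y)%R (\int[mu]_(y in cube) f' t y)%R.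
Proof.
move=> trho k0 intf df f'G.
have I x : (`]- rho, rho[%classic : set R) x -> `|x| < rho.
  by rewrite /= in_itv /= ltr_norml.
have It : (`]- rho, rho[%classic : set R) t by rewrite /= in_itv /= -ltr_norml.
have intf' x : (`]- rho, rho[%classic : set R) x -> mu.-integrable cube (EFin \o f x).
  by move=> /I/ltW; exact: intf.
have lt1 x : (`]- rho, rho[%classic : set R) x -> `|x| < 1.
  by move=> /I/lt_trans; apply.
have der x y : (`]- rho, rho[%classic : set R) x -> cube y -> derivable (f ^~ y) x 1.
  by move=> /lt1 x1 cy; have [] := df x y x1 cy.
have d1E x y : (`]- rho, rho[%classic : set R) x -> cube y -> partial1of2 f x y = f' x y.
  by move=> /lt1 x1 cy; rewrite partial1of2E; have [_ ->] := df x y x1 cy.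
have ub x y : (`]- rho, rho[%classic : set R) x -> cube y -> `|partial1of2 f x y| <= dominant k y.
  by move=> Ix cy; rewrite d1E// f'G// ltW// I.
have G0 y : 0 <= dominant k y by exact: dominant_ge0.
have mc := @measurable_open_cube R m.
have D := @derivable_under_integral R _ _ mu f cube mc t _ _ It intf' der (dominant k) G0
  (integrable_dominant k) ub.
have E := @differentiation_under_integral R _ _ mu f cube mc t _ _ It intf' der (dominant k) G0
  (integrable_dominant k) ub.
apply: DeriveDef => //; rewrite -derive1E E.
by apply: eq_Rintegral => y; rewrite inE => cy; exact: d1E.
Qed.

Lemma derive_tail_int_rho t : `|t| < rho -> is_derive t 1 tail_int (tail_int' t).
Proof.
move=> trho; apply: (derive_under trho k1_ge0 integrable_tail_weight derive_tail_weight).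
exact: tail_weight'_dom.
Qed.

Lemma derive_tail_int'_rho t : `|t| < rho -> is_derive t 1 tail_int' (tail_int'' t).
Proof.
move=> trho; apply: (derive_under trho k2_ge0 integrable_tail_weight' derive_tail_weight').
exact: tail_weight''_dom.
Qed.

End domination.

Lemma norm_between (x : R) : `|x| < 1 -> exists2 rho, 0 < rho < 1 & `|x| < rho.
Proof.
move=> x1; have x0 := normr_ge0 x; exists ((1 + `|x|) / 2); last by lra.
by apply/andP; split; lra.
Qed.

Lemma derive_tail_int t : `|t| < 1 -> is_derive t 1 tail_int (tail_int' t).
Proof. by move=> /norm_between[rho /andP[r0 r1] tr]; exact: (derive_tail_int_rho r0 r1). Qed.

Lemma derive_tail_int' t : `|t| < 1 -> is_derive t 1 tail_int' (tail_int'' t).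
Proof. by move=> /norm_between[rho /andP[r0 r1] tr]; exact: (derive_tail_int'_rho r0 r1). Qed.

Let A := h * m%:R.
Let Bp := 1 + q + h * (m%:R - 1).
Let C := 2 + q + 2 * h * (m%:R - 1).

(** The integral of score_total0E against the weight is 0, and its three terms are
multiples of the integrals of tail_weight and of its two derivatives. *)
Lemma tail_int_ode t : `|t| < 1 ->
  t * (1 - t) * tail_int'' t + (C - (A + Bp + 1) * t) * tail_int' t - A * Bp * tail_int t = 0.
Proof.
move=> t1; have [rho /andP[r0 r1] /ltW tr] := norm_between t1.
have mc := @measurable_open_cube R m.
have i0 := integrable_tail_weight r0 r1 tr.
have i1 := integrable_tail_weight' r0 r1 tr.
have i2 := integrable_tail_weight'' r0 r1 tr.
have [_ ibp] := ibp_limit h0 q1 t1 n.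
have z (k : R) f : mu.-integrable cube (EFin \o f) ->
    mu.-integrable cube (EFin \o (fun y => k * f y)).
  by move=> fi; apply: (eq_integrable _ (fun y => (k%:E * (f y)%:E)%E)) => //; exact: integrableZl.
have E : \int[mu]_(y in cube) (base_weight h q y * onem_factor h t y * score_total0 h q t y) = 0.
  by rewrite /Rintegral ibp.
rewrite (@eq_Rintegral _ _ _ _ _ (fun y => h^-1 * (A * Bp * tail_weight t y +
   (- (C - (A + Bp + 1) * t) * tail_weight' t y + (- (t * (1 - t))) * tail_weight'' t y)))) in E; last first.
  move=> y; rewrite inE => cy; rewrite score_total0E// /tail_weight' /tail_weight'' -/(tail_weight t y) /A /Bp /C.
  by field; rewrite gt_eqF.
have iz : mu.-integrable cube (EFin \o (fun y => - (C - (A + Bp + 1) * t) * tail_weight' t y +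
    (- (t * (1 - t))) * tail_weight'' t y)).
  by have := integrableD mc (z (- (C - (A + Bp + 1) * t)) _ i1) (z (- (t * (1 - t))) _ i2).
have iz' : mu.-integrable cube (EFin \o (fun y => A * Bp * tail_weight t y +
   (- (C - (A + Bp + 1) * t) * tail_weight' t y + (- (t * (1 - t))) * tail_weight'' t y))).
  by have := integrableD mc (z (A * Bp) _ i0) iz.
move: E; rewrite RintegralZl// (RintegralD mc (z _ _ i0) iz) (RintegralD mc (z _ _ i1) (z _ _ i2)).
rewrite !RintegralZl// -/(tail_int t) -/(tail_int' t) -/(tail_int'' t) => /eqP.
rewrite mulf_eq0 invr_eq0 gt_eqF//= => /eqP E.
by rewrite -[RHS]oppr0 -E; ring.
Qed.

(** The tail integral is differentiable at 0, hence the solution regular there. *)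
Theorem tail_int_hyp2F1 t : 0 < t < 1 -> tail_int t = tail_int 0 * hyp2F1 A Bp C t.
Proof.
move=> t01.
have mm : 0 <= m%:R - 1 :> R by rewrite subr_ge0 ler1n.
have hm : 0 <= h * (m%:R - 1) by rewrite mulr_ge0// ltW.
have A0 : 0 < A by rewrite /A mulr_gt0.
have B0 : 0 < Bp by rewrite /Bp; move: q1 hm; lra.
have C0 : 0 < C by rewrite /C -mulrA; move: q1 hm; lra.
have z1 : `|0 : R| < 1 by rewrite normr0.
have sY : hyp_sol A Bp C tail_int tail_int'.
  exists tail_int'' => x /norm_lt1 x1; split; [exact: derive_tail_int|exact: derive_tail_int'|exact: tail_int_ode].
have Cn := pos_nonpole C0.
rewrite (hyp_sol_unique sY (hyp_sol_2F1 A Bp Cn) (l := tail_int 0) (lu := 1) _ _ _ _ _ _ t01) ?divr1//.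
- exact: right_limit (derive_tail_int z1).
- by apply: cvg_powR_mul => //; exact: right_limit (derive_tail_int' z1).
- exact: cvg_hyp_0.
- by apply: cvg_powR_mul => //; exact: cvg_hyp'_0.
- by move=> x x01; rewrite gt_eqF// (lt_le_trans ltr01)// hyp_ge1.
Qed.

End average.

(** * Boundaries of boxes are negligible *)

Section box_boundary.
Context {R : realType}.
Variable n : nat.
Local Notation mu := (lebesgue_tuple n).

Definition open_box (l : R) : set (n.-tuple R) := box (fun=> `]l, 1[%classic).

Lemma measurable_open_box l : measurable (open_box l).
Proof. by apply: measurable_box. Qed.

Lemma lebesgue_itv_box (bl br : bool) (l : R) : l < 1 ->
  mu (box (fun=> [set` Interval (BSide bl l) (BSide br 1)])) = ((1 - l) ^+ n)%:E.
Proof.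
move=> l1; rewrite -[LHS]/(mu [set x | forall i, [set` Interval (BSide bl l) (BSide br 1)] (tnth x i)]).
rewrite (lebesgue_tuple_box (A := fun=> [set` Interval (BSide bl l) (BSide br 1)]))//.
rewrite (eq_bigr (fun=> (1 - l)%:E)); last first.
  by move=> i _; rewrite lebesgue_measure_itv /= lte_fin l1 -EFinB.
by rewrite prodEFin prodr_const card_ord.
Qed.

(** The two boxes have the same finite measure. *)
Lemma integral_open_box (bl br : bool) (l : R) (f : n.-tuple R -> R) : l < 1 ->
  let D := box (fun=> [set` Interval (BSide bl l) (BSide br 1)]) in
  measurable_fun D f -> (forall x, D x -> 0 <= f x) ->
  (\int[mu]_(x in D) (f x)%:E = \int[mu]_(x in open_box l) (f x)%:E)%E.
Proof.
move=> l1 D mf f0.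
have mD : measurable D by apply: measurable_box.
have mE := measurable_open_box l.
have ED : open_box l `<=` D.
  move=> x h i; have := h i; rewrite /= !in_itv /= => /andP[x0 x1].
  by rewrite /Order.le /= /Order.le /=; case: bl br {D mf f0 mD mE} => -[] /=; rewrite ?x0 ?x1 ?(ltW x0) ?(ltW x1).
rewrite (@ge0_negligible_integral _ _ _ mu D (D `\` open_box l))//.
- by rewrite setDD setIidr.
- exact: measurableD.
- exact/measurable_EFinP.
rewrite measureD//.
  have := lebesgue_itv_box false true l1; have := lebesgue_itv_box bl br l1.
  rewrite setIidr// => E1 E2; rewrite -(subee (x := ((1 - l) ^+ n)%:E))//.
  by congr (_ - _)%E.
have := lebesgue_itv_box bl br l1; rewrite -/D => E1.
by apply: (@le_lt_trans _ _ ((1 - l) ^+ n)%:E); rewrite ?ltry// le_eqVlt; apply/orP; left; apply/eqP.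
Qed.

End box_boundary.

(** * The smallest entry of a tuple *)

Section smallest_entry.
Context {R : realType}.
Variables (n : nat) (m_gt0 : (0 < n)%N).

Lemma tuple_min_gtP (l : R) (x : n.-tuple R) :
  reflect (forall i, l < tnth x i) (l < tuple_min m_gt0 x).
Proof.
apply: (iffP idP) => [lx i|lx]; first exact: (lt_le_trans lx (bigmin_le _ _ _)).
by apply: lt_bigmin => // i _.
Qed.

Lemma measurable_tuple_min : measurable_fun setT (@tuple_min R n m_gt0).
Proof.
have mt i : measurable_fun setT (fun y : n.-tuple R => tnth y i) by exact: measurable_tnth.
rewrite /tuple_min; elim: (index_enum _) => [|i s ih].
  by under eq_fun do rewrite big_nil; exact: mt.
by under eq_fun do rewrite big_cons; apply: measurable_minr.
Qed.

End smallest_entry.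

(** * Measures on the line determined by the rays *)

Section rays.
Context {R : realType}.
Local Notation leb := (@lebesgue_measure R).

Section density_measure.
Context d (T : measurableType d) (mu : {measure set T -> \bar R}).
Variable f : T -> \bar R.
Hypotheses (mf : measurable_fun setT f) (f0 : forall x, (0 <= f x)%E).

(** The two hypotheses are arguments, so that the measure structure can be found
from the term alone. *)
Definition density_measure of measurable_fun setT f & (forall x, (0 <= f x)%E) : set T -> \bar R :=
  fun A => (\int[mu]_(x in A) f x)%E.

Local Notation nu := (density_measure mf f0).

Let d0 : nu set0 = 0%E.
Proof. by rewrite /nu integral_set0. Qed.

Let d_ge0 A : (0 <= nu A)%E.
Proof. by apply: integral_ge0 => x _. Qed.

Let d_add : semi_sigma_additive nu.
Proof. exact: semi_sigma_additive_nng_induced. Qed.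

HB.instance Definition _ := isMeasure.Build _ _ _ nu d0 d_ge0 d_add.

End density_measure.

(** The rays are closed under intersection and generate the Borel sets. *)
Lemma has_density_rays (nu : {measure set (measurableTypeR R) -> \bar R}) (D : set R) (f : R -> R) :
  measurable D -> measurable_fun D f -> (forall x, D x -> 0 <= f x) ->
  (nu setT < +oo)%E ->
  (forall l, nu `]l, +oo[%classic = \int[leb]_(x in `]l, +oo[ `&` D) (f x)%:E)%E ->
  has_density leb D nu f.
Proof.
move=> mD mf f0 nuT nuE; split => // A mA.
pose g : measurableTypeR R -> \bar R := (EFin \o f) \_ D.
have mg : measurable_fun setT g.
  by apply/(measurable_restrictT _ _).1 => //; exact/measurable_EFinP.
have g0 x : (0 <= g x)%E.
  by rewrite /g patchE; case: ifPn => //; rewrite inE => /f0; rewrite lee_fin.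
rewrite integral_mkcondr -/g -[RHS]/(density_measure leb mg g0 A).
pose G := [set A : set (measurableTypeR R) | exists x, A = `]x, +oo[%classic].
apply: (@measure_unique _ R (measurableTypeR R) G (fun k => `](- k%:R : R), +oo[%classic) _ _ _ _ nu (density_measure leb mg g0)) => //.
- exact: RGenOInfty.measurableE.
- move=> _ _ [x ->] [y ->]; exists (Num.max x y).
  by apply/seteqP; split => z /=; rewrite !in_itv /= !andbT gt_max => /andP.
- by move=> k; exists (- k%:R).
- apply/seteqP; split => // x _; exists (Num.truncn `|x|).+1 => //=.
  rewrite in_itv /= andbT ltrNl; apply: le_lt_trans (truncnS_gt _).
  by rewrite -normrN ler_norm.
- by move=> _ [l ->]; rewrite nuE integral_mkcondr.
- by move=> k; apply: le_lt_trans nuT; apply: le_measure; rewrite ?inE.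
Qed.

End rays.

(** * Products over pairs of indices *)

Section pair_products.
Context {R : realType}.

(** The factors with j < i are those with i < j after exchanging the indices. *)
Lemma prod_pairs_sym n (F : 'I_n -> 'I_n -> R) : (forall i j, F i j = F j i) ->
  \prod_(i < n) \prod_(j < n | j != i) F i j =
  \prod_(i < n) \prod_(j < n | (i < j)%N) (F i j * F i j).
Proof.
move=> sF.
transitivity (\prod_(i < n) ((\prod_(j < n | (i < j)%N) F i j) *
                             (\prod_(j < n | (j < i)%N) F i j))).
  apply: eq_bigr => i _; rewrite (bigID (fun j : 'I_n => (i < j)%N)) /=.
  by congr (_ * _); apply: eq_bigl => j; rewrite -val_eqE /=; case: ltngtP.
rewrite big_split /= [X in _ * X](_ : _ = \prod_(i < n) \prod_(j < n | (i < j)%N) F i j).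
  by rewrite -big_split; apply: eq_bigr => i _; rewrite big_split.
rewrite [LHS](exchange_big_dep xpredT) //=; apply: eq_bigr => i _.
by apply: eq_bigr => j _; exact: sF.
Qed.

Lemma prod_offdiag_const n (k : R) :
  \prod_(i < n.+1) \prod_(j < n.+1 | j != i) k = (k ^+ n) ^+ n.+1.
Proof.
rewrite (eq_bigr (fun=> k ^+ n)) ?prodr_const ?card_ord// => i _.
by rewrite prodr_const cardC1 card_ord.
Qed.

End pair_products.

(** * The tail of the Jacobi weight *)

Section jacobi_tail.
Context {R : realType}.
Variables (beta b : R) (n : nat).
Hypotheses (beta01 : 0 < beta < 2) (b1 : -1 < b).

Local Notation m := n.+1.
Local Notation a := (2 / beta - 2).
Local Notation h := (beta / 2).
Local Notation q := (h * (b + 1) - 1).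
Local Notation mu := (lebesgue_tuple m).

Let beta0 : 0 < beta. Proof. by case/andP: beta01. Qed.
Let h0 : 0 < h. Proof. by rewrite divr_gt0. Qed.
Let q1 : -1 < q.
Proof. by rewrite ltrBrDr addNr mulr_gt0//; move: b1; lra. Qed.

(** The choice of a is made for this exponent; see jacobi_weight_affine. *)
Lemma jacobi_exponent : h * (a + 1) - 1 = - h.
Proof. by field; rewrite gt_eqF. Qed.

(** The substitution turns x_i^(- h) into the factor (1 - s y_i)^(- h) and
(1 - x_i)^q into s^q y_i^q, while every difference is scaled by s. *)
Lemma jacobi_weight_affine s (y : m.-tuple R) : 0 < s < 1 -> open_cube m y ->
  jacobi_weight beta a b (affine_tuple s y) =
  (s `^ q * (s `^ h) ^+ n) ^+ m * tail_weight h q s y.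
Proof.
move=> /andP[s0 s1] cy.
have y01 i : 0 < tnth y i < 1 by have := cy i; rewrite /unit_itv /= in_itv.
have o0 i : 0 < 1 - s * tnth y i.
  by have /andP[z0 z1] := y01 i; rewrite subr_gt0 mulr_ilt1// ltW.
rewrite /jacobi_weight jacobi_exponent /tail_weight /base_weight /onem_factor.
rewrite [X in _ * X](_ : _ = ((s `^ h) ^+ n) ^+ m *
    \prod_(i < m) \prod_(j < m | j != i) `|tnth y i - tnth y j| `^ h); last first.
  rewrite -prod_offdiag_const -big_split /=.
  under [RHS]eq_bigr do rewrite -big_split /=.
  rewrite prod_pairs_sym => [|i j]; last by rewrite distrC.
  apply: eq_bigr => i _; apply: eq_bigr => j _; rewrite !tnth_affine.
  rewrite (_ : 1 - s * tnth y i - (1 - s * tnth y j) = s * (tnth y j - tnth y i)); last by ring.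
  rewrite normrM (gtr0_norm s0) (distrC (tnth y j)) -powRM ?(ltW s0)//.
  have hh : beta = h + h by field.
  rewrite [in LHS]hh powRD// gt_eqF//; exact: addr_gt0.
rewrite [X in X * _](_ : _ = (s `^ q) ^+ m * (\prod_(i < m) tnth y i `^ q *
    expR (- (h * \sum_(i < m) ln (1 - s * tnth y i))))); last first.
  rewrite -[X in expR X]mulNr mulr_sumr expR_sum -big_split /= -[m in _ ^+ m]card_ord -prodr_const.
  rewrite -big_split; apply: eq_bigr => i _; rewrite tnth_affine.
  rewrite (_ : 1 - (1 - s * tnth y i) = s * tnth y i); last by ring.
  have /andP[z0 z1] := y01 i.
  rewrite powRM ?(ltW s0) ?(ltW z0)// (_ : _ `^ (- h) = expR (- h * ln (1 - s * tnth y i))).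
    by rewrite /=; ring.
  by rewrite /powR (gt_eqF (o0 i)).
by rewrite exprMn; ring.
Qed.

Lemma affine_open_box s : 0 < s -> affine_tuple s @^-1` (@open_box R m (1 - s)) = open_cube m.
Proof.
move=> s0; apply/seteqP; split => y /= hy i; have := hy i;
  rewrite /unit_itv /= !in_itv /= tnth_affine => /andP[y0 y1]; apply/andP; split.
- by rewrite -(pmulr_rgt0 _ s0); move: y1; lra.
- by rewrite -(ltr_pM2l s0); move: y0; lra.
- by move: y1; rewrite -(ltr_pM2l s0); lra.
- by move: y0; rewrite -(pmulr_rgt0 _ s0); lra.
Qed.

Let A := h * m%:R.
Let B := h * (b + m%:R).
Let C := A + B + 1 - h.

(** The Jacobian s^m and the powers from jacobi_weight_affine add up to the
exponent A B / h = m B. *)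
Lemma tail_integral (c s : R) : 0 < s < 1 -> 0 < c ->
  measurable_fun (@open_box R m (1 - s)) (fun x => c * jacobi_weight beta a b x) ->
  (\int[mu]_(x in @open_box R m (1 - s)) (c * jacobi_weight beta a b x)%:E =
   (c * tail_int h q n 0 * (s `^ (A * B / h) * hyp2F1 A B C s))%:E)%E.
Proof.
move=> s01 c0 mw; have /andP[s0 s1] := s01; have mc := @measurable_open_cube R m.
have w0 x : 0 <= jacobi_weight beta a b (x : m.-tuple R).
  rewrite /jacobi_weight mulr_ge0// prodr_ge0// => i _; rewrite ?mulr_ge0 ?powR_ge0//.
  by rewrite prodr_ge0// => j _; rewrite powR_ge0.
rewrite (ge0_integral_affine s0 (measurable_open_box _))//; last 2 first.
- exact/measurable_EFinP.
- by move=> x _; rewrite lee_fin mulr_ge0// ltW.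
rewrite affine_open_box//.
set K := (s `^ q * (s `^ h) ^+ n) ^+ m.
rewrite (@eq_integral _ _ _ _ _ (fun y => ((c * K)%:E * (tail_weight h q s y)%:E)%E)); last first.
  by move=> y; rewrite inE => cy; rewrite jacobi_weight_affine// -EFinM mulrA.
have [rho /andP[r0 r1] sr] := norm_between (norm_lt1 s01).
have ia := integrable_tail_weight n h0 q1 r0 r1 (ltW sr).
rewrite integralZl//.
have -> : (\int[mu]_(y in open_cube m) (tail_weight h q s y)%:E)%E = (tail_int h q n s)%:E.
  by rewrite /tail_int /Rintegral fineK//; exact: integrable_fin_num.
rewrite -!EFinM tail_int_hyp2F1//; congr (_%:E).
have -> : 1 + q + h * (m%:R - 1) = B by rewrite /B; ring.
have -> : 2 + q + 2 * h * (m%:R - 1) = C by rewrite /C /A /B; ring.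
have -> : s `^ (A * B / h) = s ^+ m * K.
  rewrite /K -exprMn (_ : A * B / h = B * m%:R); last by rewrite /A; field; rewrite gt_eqF.
  rewrite powRrM powR_mulrn ?powR_ge0//; congr (_ ^+ _).
  rewrite -powR_mulrn ?powR_ge0// -powRrM -{2}(powRr1 (ltW s0)) -!powRD ?(gt_eqF s0) ?implybT//.
  by congr (_ `^ _); rewrite /B -natr1; ring.
by rewrite -/A; ring.
Qed.

End jacobi_tail.

(** * Integrating the derivative of the survival function *)

Section survival_integral.
Context {R : realType}.
Variables (a b h : R).
Hypotheses (a0 : 0 < a) (b0 : 0 < b) (h01 : 0 < h < 1).

(** The value v at the left end enters as a limit, because survival is not
differentiable at l = 0; there cvg_survival_0 gives v = 1. *)
Lemma integral_survival_density (l v : R) : 0 <= l < 1 ->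
  survival a b h x @[x --> l^'+] --> v ->
  (\int[@lebesgue_measure R]_(x in `]l, 1%R[%classic) (survival_density a b h x)%:E = v%:E)%E.
Proof.
move=> /andP[l0 l1] Sl; have ol : 0 < 1 - l by rewrite subr_gt0.
pose e (k : nat) : R := (1 - l) * harmonic k.+2.
have e0 k : 0 < e k by rewrite mulr_gt0// invr_gt0.
have ehalf k : 2 * e k < 1 - l.
  have : harmonic k.+2 <= (3 : R)^-1.
    by rewrite /harmonic /= lef_pV2 ?posrE// ler_nat.
  by rewrite -(ler_pM2l ol) -/(e k); move: ol; lra.
have de : {homo e : i j / (i <= j)%N >-> j <= i}.
  by move=> i j ij; rewrite /e ler_pM2l// /harmonic /= lef_pV2 ?posrE// ler_nat !ltnS.
have ce : e k @[k --> \oo] --> (0 : R).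
  apply: (cvg_lim_eq (l := (1 - l) * 0)); last by rewrite mulr0.
  apply: cvgM; first exact: cvg_cst.
  by have := @cvg_harmonic R; rewrite -(cvg_shiftn 2); under eq_fun do rewrite addn2.
pose a_ k := l + e k; pose b_ k := 1 - e k.
have in01 k x : a_ k <= x <= b_ k -> 0 < x < 1.
  by have := e0 k; rewrite /a_ /b_ => ? /andP[? ?]; apply/andP; split; move: l0; lra.
have := @FTC_exhaust R (survival_density a b h) (fun x => - survival a b h x) a_ b_.
have -> : \bigcup_k [set` `[a_ k, b_ k]] = `]l, 1[%classic.
  apply/seteqP; split => x /=; rewrite ?in_itv /=.
    move=> [k _]; rewrite /= in_itv /= /a_ /b_ => /andP[x0 x1]; have := e0 k.
    by move=> ?; apply/andP; split; lra.
  move=> /andP[x0 x1].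
  have m0 : 0 < Num.min (x - l) (1 - x) by rewrite lt_min !subr_gt0 x0 x1.
  move: (ce) => /cvgr_lt /(_ _ m0) [k _ /(_ k (leqnn k))].
  rewrite lt_min => /andP[ka kb]; exists k => //=.
  by rewrite in_itv /= /a_ /b_; apply/andP; split; move: ka kb; lra.
move=> H.
have {}H : ((- survival a b h (b_ k) - - survival a b h (a_ k))%:E @[k --> \oo] -->
    \int[@lebesgue_measure R]_(x in `]l, 1%R[%classic) (survival_density a b h x)%:E)%E.
  apply: H.
  - by move=> k; rewrite /a_ /b_; have := ehalf k; lra.
  - by move=> i j /de; rewrite /a_; lra.
  - by move=> i j /de; rewrite /b_; lra.
  - by move=> k x /in01; exact: survival_density_ge0.
  - move=> k x /in01 x01.
    by have := deriveN_fun (derive_survival a0 b0 h01 x01); rewrite opprK.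
  - by move=> k x /in01; exact: survival_density_continuous.
rewrite -(cvg_lim _ H)//; apply/cvg_lim => //; apply: cvg_EFin; first exact: nearW.
apply: (cvg_lim_eq (l := - 0 - - v)); last by ring.
apply: cvgB; apply: cvgN.
  by move: (cvg_survival_1 a0 b0 h01) => /cvg_at_rightP; apply; split.
move: Sl => /cvg_at_rightP; apply; split.
  by move=> k; rewrite /a_ ltrDl.
apply: (cvg_lim_eq (l := l + 0)); last by rewrite addr0.
by apply: cvgD; [exact: cvg_cst|].
Qed.

Lemma hyp2F1C (u v c x : R) : hyp2F1 u v c x = hyp2F1 v u c x.
Proof. by rewrite /hyp2F1; under eq_fun do rewrite (mulrC (pochhammer u _)). Qed.

(** The Gamma function at - h, a - h and b - h is brought to positive arguments by
Gamma_inv_rec, which also covers a = h, where 1 / Gamma (a - h) is 0. *)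
Lemma survival_density_Gamma (x : R) : -1 < a - h -> -1 < b - h -> 0 < x < 1 ->
  survival_density a b h x =
  (Gamma (- h) * Gamma (1 + h) / Gamma (1 - h) * (a * b / h) *
   (Gamma (b - h + 1) / Gamma (b + 1)) * Gamma (a - h + 1)) *
  x `^ (- h) * (1 - x) `^ (a * b / h - 1) *
  ((Gamma (- h))^-1 * (Gamma (a + 1))^-1 * hyp2F1 (b - h) (a - h) (- h) x -
   x `^ (1 + h) * ((Gamma (h + 2))^-1 * (Gamma (a - h))^-1) *
   (Gamma (b + 1) / Gamma (b - h)) * hyp2F1 (a + 1) (b + 1) (2 + h) x).
Proof.
move=> ah bh x01; have /andP[h0 h1] := h01; have /andP[x0 x1] := x01.
have oh : 0 < 1 - h by lra.
have h1' : 0 < h + 1 by lra.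
have c0 : 0 < a + b + 1 - h by move: a0 b0; lra.
have ga0 := Gamma_gt0 a0; have gb0 := Gamma_gt0 b0; have gh0 := Gamma_gt0 h0.
have ga1 : 0 < Gamma (a - h + 1) by apply: Gamma_gt0; lra.
have gb1 : 0 < Gamma (b - h + 1) by apply: Gamma_gt0; lra.
have goh := Gamma_gt0 oh; have gc := Gamma_gt0 c0.
have Eh : Gamma (- h) = Gamma (1 - h) / - h.
  have := @Gamma_inv_rec R (- h); rewrite (addrC (- h) 1) => Eh.
  by rewrite -[LHS]invrK Eh ?ltrN2//; field; rewrite !gt_eqF.
have p : x `^ (h + 1) * x `^ (- h) = x.
  by rewrite -powRD ?(gt_eqF x0) ?implybT// (_ : h + 1 - h = 1) ?powRr1 ?ltW//; ring.
rewrite survival_densityE// (hyp2F1C (b - h)) (addrC 2 h).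
rewrite (@Gamma_inv_rec _ (a - h))// (@Gamma_inv_rec _ (b - h))// Eh.
rewrite (addrC 1 h) (_ : h + 2 = h + 1 + 1); last by ring.
rewrite (GammaS h1') (GammaS h0) (GammaS a0) (GammaS b0) /gauss_value.
rewrite (_ : b + 1 - h = b - h + 1); last by ring.
rewrite (_ : a + 1 - h = a - h + 1); last by ring.
set P := hyp2F1 _ _ _ _; set Q := hyp2F1 _ _ _ _; set X := (1 - x) `^ _.
move: p; set Y := x `^ (h + 1); set Z := x `^ (- h) => p.
rewrite -[in LHS]p.
move: (lt0r_neq0 ga0) (lt0r_neq0 gb0) (lt0r_neq0 gh0) (lt0r_neq0 ga1) (lt0r_neq0 gb1).
move: (lt0r_neq0 goh) (lt0r_neq0 gc) (lt0r_neq0 a0) (lt0r_neq0 b0) (lt0r_neq0 h0) (lt0r_neq0 h1').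
move=> *; field; do ?[apply/andP; split]; rewrite ?oppr_eq0 //.
Qed.

End survival_integral.

(** * The smallest eigenvalue *)

Section smallest_eigenvalue.
Context {R : realType}.
Variables (beta b : R) (n : nat).
Hypotheses (beta01 : 0 < beta < 2) (b1 : -1 < b).

Local Notation m := n.+1.
Local Notation a := (2 / beta - 2).
Local Notation h := (beta / 2).
Local Notation mu := (lebesgue_tuple m).
Local Notation leb := (@lebesgue_measure R).
Local Notation A := (h * m%:R).
Local Notation B := (h * (b + m%:R)).

Let beta0 : 0 < beta. Proof. by case/andP: beta01. Qed.
Let h01 : 0 < h < 1.
Proof. by case/andP: beta01 => ? ?; apply/andP; split; lra. Qed.
Let h0 : 0 < h. Proof. by case/andP: h01. Qed.
Let m1 : 1 <= m%:R :> R. Proof. by rewrite ler1n. Qed.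
Let A0 : 0 < A. Proof. by rewrite mulr_gt0// ltr0n. Qed.
Let B0 : 0 < B. Proof. by rewrite mulr_gt0//; move: b1 m1; lra. Qed.

(** For m = 1 one has A = h, and the second term of the density vanishes. *)
Lemma min_pdfE (x : R) : 0 < x < 1 ->
  min_pdf beta b m%:R x = survival_density A B h x.
Proof.
move=> x01.
have Ah : -1 < A - h.
  by rewrite (_ : A - h = h * (m%:R - 1)); [|ring]; apply: lt_le_trans (mulr_ge0 _ _);
    rewrite ?ltrN10 ?subr_ge0 ?(ltW h0).
have Bh : -1 < B - h.
  have /andP[_ h1] := h01.
  have : 0 < h * (b + m%:R) by [].
  by lra.
rewrite survival_density_Gamma// /min_pdf /min_const.
have hn : h != 0 by rewrite gt_eqF.
have bn : beta != 0 by rewrite gt_eqF.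
rewrite (_ : beta / 2 * m%:R * (b + m%:R) = A * B / h); last by field.
rewrite (_ : beta / 2 * (b + m%:R - 1) + 1 = B - h + 1); last by ring.
rewrite (_ : beta / 2 * (m%:R - 1) + 1 = A - h + 1); last by ring.
rewrite (_ : beta * m%:R * (b + m%:R) / 2 - 1 = A * B / h - 1); last by field.
rewrite (_ : beta * m%:R / 2 + 1 = A + 1); last by ring.
rewrite (_ : beta * (b + m%:R - 1) / 2 = B - h); last by ring.
rewrite (_ : beta * (m%:R - 1) / 2 = A - h); last by ring.
by rewrite (_ : beta * (b + m%:R) / 2 + 1 = B + 1)//; ring.
Qed.

Variable nu : probability (m.-tuple R) R.
Hypothesis nuJ : jacobi_distributed beta a b nu.

Definition entries_gt (l : R) : set (m.-tuple R) := [set x | forall i, l < tnth x i].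

Lemma measurable_entries_gt l : measurable (entries_gt l).
Proof.
rewrite (_ : entries_gt l = box (fun=> `]l, +oo[%classic)).
  exact: measurable_box.
by apply/seteqP; split => x /= hx i; have := hx i; rewrite /= in_itv /= andbT.
Qed.

Lemma unit_cubeE : @unit_cube R m = box (fun=> `[0%R, 1%R]%classic).
Proof. by apply/seteqP; split => x hx i; have := hx i; rewrite /= in_itv. Qed.

Lemma measurable_unit_cube : measurable (@unit_cube R m).
Proof. by rewrite unit_cubeE; exact: measurable_box. Qed.

(** The normalization is recorded together with the tails, because the constant c
of the ensemble is not known explicitly. *)
Lemma nu_entries_gt_integral : exists c : R,
  [/\ 0 < c, measurable_fun (@unit_cube R m) (fun x => c * jacobi_weight beta a b x),
  (\int[mu]_(x in @open_box R m 0) (c * jacobi_weight beta a b x)%:E = 1)%E &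
  forall l, 0 <= l < 1 -> nu (entries_gt l) =
    (\int[mu]_(x in @open_box R m l) (c * jacobi_weight beta a b x)%:E)%E].
Proof.
have [c c0 [mw w0 nuE]] := nuJ; exists c; split => // [|l /andP[l0 l1]].
  rewrite -(@probability_setT _ _ _ nu) nuE// setTI unit_cubeE.
  by rewrite (integral_open_box (bl := true) (br := false) ltr01)//; rewrite -?unit_cubeE.
have E : entries_gt l `&` @unit_cube R m = box (fun=> `]l, 1%R]%classic).
  apply/seteqP; split => x /=.
    by move=> [xl x01] i; rewrite /= in_itv /= xl; have /andP[] := x01 i.
  move=> hx; split => i; have := hx i; rewrite /= in_itv /= => /andP[xl x1] //.
  by rewrite x1 (ltW (le_lt_trans l0 xl)).
have s : box (fun=> `]l, 1%R]%classic) `<=` @unit_cube R m by rewrite -E; exact: subIsetr.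
rewrite nuE; last exact: measurable_entries_gt.
rewrite E (integral_open_box (bl := false) (br := false))//.
- by apply: measurable_funS mw; [exact: measurable_unit_cube|].
- by move=> x /s; exact: w0.
Qed.

Lemma nu_entries_gt0 : nu (entries_gt 0) = 1%E.
Proof. by have [c [_ _ c1 ->]] := nu_entries_gt_integral; rewrite ?lexx ?ltr01. Qed.

Lemma nu_entries_gt_gauss : exists k : R, forall l, 0 < l < 1 ->
  nu (entries_gt l) = (k * survival A B h l)%:E.
Proof.
have [c [c0 mw _ nuE]] := nu_entries_gt_integral.
exists (c * tail_int h (h * (b + 1) - 1) n 0 * gauss_value A B h) => l l01.
have /andP[l0 l1] := l01.
have ol : 0 < 1 - l < 1 by apply/andP; split; lra.
rewrite nuE ?(ltW l0)//.
have := @tail_integral R beta b n beta01 b1 c (1 - l) ol c0.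
rewrite (_ : 1 - (1 - l) = l); last by ring.
move=> ->.
  have := lt0r_neq0 (gauss_value_gt0 A0 B0 h01) => g0.
  rewrite /survival; congr (_%:E).
  by set P := _ `^ _; set Q := hyp2F1 _ _ _ _; field.
apply: measurable_funS mw.
  exact: measurable_unit_cube.
move=> x hx i; have := hx i; rewrite /= in_itv /= => /andP[? ?].
by apply/andP; split; lra.
Qed.

(** Continuity of the measure from below as l decreases to 0 shows that the unknown
constant is 1. *)
Theorem nu_entries_gt l : 0 < l < 1 -> nu (entries_gt l) = (survival A B h l)%:E.
Proof.
have [k nuE] := nu_entries_gt_gauss.
suff k1 : k = 1 by move=> /nuE ->; rewrite k1 mul1r.
pose u (i : nat) : R := harmonic i.+1.
have u01 i : 0 < u i < 1.
  by rewrite /u /harmonic /= invr_gt0 ltr0n /= invf_lt1// ltr1n.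
have u0 : u i @[i --> \oo] --> (0 : R).
  by have := @cvg_harmonic R; rewrite -(cvg_shiftn 1); under eq_fun do rewrite addn1.
have lim : nu (entries_gt (u i)) @[i --> \oo] --> nu (\bigcup_i entries_gt (u i)).
  apply: nondecreasing_cvg_mu.
  - by move=> i; exact: measurable_entries_gt.
  - by apply: bigcupT_measurable => i; exact: measurable_entries_gt.
  - move=> i j ij; apply/subsetPset => x hx k'; apply: le_lt_trans (hx k').
    by rewrite /u /harmonic /= lef_pV2 ?posrE// ler_nat !ltnS.
rewrite (_ : \bigcup_i entries_gt (u i) = entries_gt 0) in lim; last first.
  apply/seteqP; split => x /=.
    by move=> [i _ hx] j; have /andP[ui _] := u01 i; exact: lt_trans ui (hx j).
  move=> hx; have m0 : 0 < tuple_min (ltn0Sn n) x by exact/tuple_min_gtP.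
  move: (u0) => /cvgr_lt /(_ _ m0) [i _ /(_ i (leqnn i)) ui].
  by exists i => //; apply/(tuple_min_gtP (ltn0Sn n)).
rewrite nu_entries_gt0 in lim.
have lim' : (k * survival A B h (u i))%:E @[i --> \oo] --> (1%:E : \bar R).
  by move: lim; under eq_fun do rewrite nuE//.
have lk : k * survival A B h (u i) @[i --> \oo] --> k * 1.
  apply: cvgM; first exact: cvg_cst.
  move: (cvg_survival_0 A0 B0 h01) => /cvg_at_rightP; apply; split => // i.
  by have /andP[] := u01 i.
(* The limit of the measures computed from the formula is k, because survival
   tends to 1 at 0. *)
have lkE : (k * survival A B h (u i))%:E @[i --> \oo] --> (k * 1)%:E.
  by apply: cvg_EFin => //; exact: nearW.
by rewrite -[k]mulr1; apply: EFin_inj; rewrite -(cvg_lim _ lkE)//; exact/cvg_lim.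
Qed.

(** The tails at l <= 0 and l >= 1 are 1 and 0; in between the tail is survival,
whose derivative has the right integral. *)
Theorem density_tuple_min :
  has_density leb `]0, 1[ (pushforward nu (@tuple_min R m (ltn0Sn n))) (min_pdf beta b m%:R).
Proof.
have mt : measurable_fun setT (tuple_min (ltn0Sn n) : m.-tuple R -> measurableTypeR R).
  exact: measurable_tuple_min.
have f0 (x : R) : `]0, 1[%classic x -> 0 <= min_pdf beta b m%:R x.
  by rewrite /= in_itv /= => x01; rewrite min_pdfE//; exact: survival_density_ge0.
have md : measurable_fun (`]0%R, 1%R[%classic : set R) (survival_density A B h : R -> R).
  apply: open_continuous_measurable_fun; first exact: interval_open.
  by move=> x; rewrite inE /= in_itv /= => x01; exact: survival_density_continuous.
have mf : measurable_fun (`]0%R, 1%R[%classic : set R) (min_pdf beta b m%:R : R -> R).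
  apply: eq_measurable_fun md => x; rewrite inE /= in_itv /= => x01.
  by rewrite min_pdfE.
have tailE (l : R) : tuple_min (ltn0Sn n) @^-1` `]l, +oo[%classic = entries_gt l.
  by apply/seteqP; split => x /=; rewrite in_itv /= andbT => /tuple_min_gtP.
have I (l v : R) : 0 <= l < 1 -> survival A B h x @[x --> l^'+] --> v ->
    (\int[leb]_(x in `]l, 1%R[%classic) (min_pdf beta b m%:R x)%:E = v%:E)%E.
  move=> l01 lv; rewrite -(integral_survival_density A0 B0 h01 l01 lv).
  apply: eq_integral => x; rewrite inE /= in_itv /= => /andP[xl x1].
  by rewrite min_pdfE// x1 andbT; case/andP: l01 => ? _; lra.
rewrite -[pushforward _ _]/(pushforward nu (tuple_min (ltn0Sn n) : m.-tuple R -> measurableTypeR R)).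
apply: has_density_rays => //.
  exact: (le_lt_trans (probability_le1 nu measurableT) (ltry 1)).
move=> l; rewrite [LHS](congr1 nu (tailE l)).
have [l1|l1] := leP 1 l.
  rewrite (_ : `]l, +oo[ `&` `]0, 1[ = set0); last first.
    by apply/seteqP; split => x //=; rewrite !in_itv /= andbT => -[? /andP[? ?]]; lra.
  rewrite integral_set0; apply/eqP; rewrite eq_le measure_ge0 andbT.
  have [c [c0 [mw w0 nuE]]] := nuJ.
  rewrite nuE; last exact: measurable_entries_gt.
  rewrite (_ : _ `&` _ = set0) ?integral_set0//.
  apply/seteqP; split => x //= [hx h01']; have := hx ord0; have := h01' ord0.
  by move=> /andP[_ ?] ?; lra.
have [l0|l0] := leP l 0.
  rewrite (_ : `]l, +oo[ `&` `]0, 1[ = `]0%R, 1%R[%classic); last first.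
    apply/seteqP; split => x /=; rewrite !in_itv /= ?andbT; first by case.
    by move=> /andP[? ?]; split; [lra|apply/andP].
  rewrite (I 0 1) ?lexx ?ltr01//; last exact: cvg_survival_0.
  apply/eqP; rewrite eq_le probability_le1; last exact: measurable_entries_gt.
  rewrite -nu_entries_gt0; apply: le_measure; rewrite ?inE; do ?exact: measurable_entries_gt.
  by move=> x hx i; exact: le_lt_trans l0 (hx i).
have l01 : 0 < l < 1 by rewrite l0 l1.
rewrite (_ : `]l, +oo[ `&` `]0, 1[ = `]l, 1%R[%classic); last first.
  apply/seteqP; split => x /=; rewrite !in_itv /= ?andbT.
    by move=> [? /andP[? ?]]; apply/andP.
  by move=> /andP[? ?]; split => //; apply/andP; split; lra.
rewrite nu_entries_gt//; apply/esym/I; first by rewrite (ltW l0).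
exact: right_limit (derive_survival A0 B0 h01 l01).
Qed.

End smallest_eigenvalue.

Theorem theorem3p6 (R : realType) (d : measure_display) (T : measurableType d)
    (P : probability T R) (beta a b : R) (m : nat) (m_gt0 : (0 < m)%N)
    (X : {RV P >-> m.-tuple R}) :
  0 < beta < 2 -> a = 2 / beta - 2 -> -1 < b ->
  jacobi_distributed beta a b (distribution P X) ->
  has_density lebesgue_measure `]0, 1[
    (pushforward P (tuple_min m_gt0 \o X)) (min_pdf beta b m%:R).
Proof.
case: m m_gt0 X => [//|n] m_gt0 X beta01 -> b1 XJ.
rewrite (bool_irrelevance m_gt0 (ltn0Sn n)).
exact: (density_tuple_min beta01 b1 XJ).
Qed.
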